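(* Let $T>0$, let $m\ge 1$, let $\alpha_0>\alpha_1>\cdots>\alpha_m\ge 0$ be real numbers, let $n_i$ be the nonnegative integer with $n_i-1<\alpha_i\le n_i$ ($i=0,\dots,m$), and let $\gamma=n_0-\alpha_0\in[0,1)$. Consider the equation $${}^cD_{0+}^{\alpha_0}y(t)=-\sum_{i=1}^m a_i(t)\,{}^cD_{0+}^{\alpha_i}y(t),\qquad 0<t<T.\tag{E}$$ Assume that $n_0=n_1$ and that $a_i\in C^1_\gamma[0,T]$ and $D_{0+}^{n_0-\alpha_0}a_i\in C[0,T]$ for $i=1,\dots,m$. Assume that $H_0\ne\emptyset$, where $H_j=\{i\in\{1,\dots,m\}:0\le\alpha_i\le j\}$ (so that every $H_j$ is nonempty), and put $h_j=\min H_j$. Then there exists a unique canonical fundamental system $y_j\in C_\gamma^{n_0}[0,T]$, $j=0,1,\dots,n_0-1$, of solutions of (E), and it is given by $$y_j(t)=\Phi_{j+1}(t)+\sum_{k=0}^\infty(-1)^{k+1}I_{0+}^{\alpha_0}\Big[\sum_{i=1}^m a_i(t)I_{0+}^{\alpha_0-\alpha_i}\Big]^k\sum_{i=h_j}^m a_i(t)\Phi_{j+1-\alpha_i}(t),\qquad j=0,1,\dots,n_0-1.$$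
   Context: All functions are real valued. For $0\le\gamma<1$, $C_\gamma[0,T]$ is the space of functions $f$ on $(0,T]$ such that $t\mapsto t^\gamma f(t)$ belongs to $C[0,T]$ (i.e. extends continuously to $[0,T]$); $C_0[0,T]=C[0,T]$. For $n\in\mathbb N$, $C^n_\gamma[0,T]$ is the space of functions $f$ that are $n-1$ times continuously differentiable on $[0,T]$ and have an $n$-th derivative $f^{(n)}\in C_\gamma[0,T]$; $C^0_\gamma=C_\gamma$. Riemann–Liouville integral: $I_{0+}^\alpha f(t)=\frac1{\Gamma(\alpha)}\int_0^t(t-\tau)^{\alpha-1}f(\tau)\,d\tau$ for $\alpha>0$, and $I^0_{0+}f=f$. Riemann–Liouville derivative: for $n-1<\alpha\le n$, $D_{0+}^\alpha f(t)=\frac{d^n}{dt^n}I_{0+}^{n-\alpha}f(t)$ for $t>0$ (with $D^0_{0+}f=f$). Caputo derivative: for $n-1<\alpha\le n$, ${}^cD_{0+}^\alpha f(t)=D_{0+}^\alpha\big[f(t)-\sum_{k=0}^{n-1}\frac{f^{(k)}(0)}{k!}t^k\big]$; in particular ${}^cD^0_{0+}f=f$. $\Phi_{\beta}(t)=t^{\beta-1}/\Gamma(\beta)$ for $\beta>0$; thus $\Phi_{j+1}(t)=t^j/j!$, and $\Phi_{j+1-\alpha_i}=D_{0+}^{\alpha_i}\Phi_{j+1}$ when $\alpha_i\le j$. The bracket $\big[\sum_i a_i(t)I_{0+}^{\alpha_0-\alpha_i}\big]^k$ is the $k$-th power (composition) of the operator $g\mapsto\sum_{i=1}^m a_i\cdot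 I_{0+}^{\alpha_0-\alpha_i}g$, the $0$-th power being the identity. The infinite series is the limit of its partial sums, for each $t\in[0,T]$. A canonical fundamental system of solutions of (E) is a system of functions $y_0,\dots,y_{n_0-1}$, each satisfying (E), with $D^ky_j(t)|_{t=+0}=1$ if $k=j$ and $=0$ if $k\ne j$, for $k,j=0,1,\dots,n_0-1$, where $D^k=d^k/dt^k$. *)

(* Defs.v *)
From HB Require Import structures.
From mathcomp Require Export all_boot all_order all_algebra.
From mathcomp Require Export all_classical all_reals all_analysis.
Export Order.TTheory GRing.Theory Num.Theory.
Export numFieldNormedType.Exports.

#[export] Set Implicit Arguments.
#[export] Unset Strict Implicit.
#[export] Unset Printing Implicit Defensive.

#[export] Set Warnings "-notation-overridden".
Global Open Scope classical_set_scope.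
Global Open Scope ring_scope.

(* Functions on [0, T] or (0, T] are represented by total functions R -> R;
   nothing below depends on their values outside [0, T]. *)

(* Derivatives are taken relatively to a set A, always [0, T] in the sequel:
   at interior points this is the usual derivative, at 0 and at T the one-sided
   one.  The operator deriv_on is total, so existence is stated separately. *)
Definition derivable_on (R : realType) (A : set R) (f : R -> R) (x : R) : Prop :=
  cvg ((f y - f x) / (y - x) @[y --> within A x^']).

Definition deriv_on (R : realType) (A : set R) (f : R -> R) (x : R) : R :=
  lim ((f y - f x) / (y - x) @[y --> within A x^']).

Definition derivn_on (R : realType) (A : set R) (n : nat) (f : R -> R) : R -> R :=
  iter n (deriv_on A) f.

(* C_gamma[0,T]; f 0 is irrelevant, also for gamma = 0, where membership means
   that the restriction of f to (0, T] extends to an element of C[0,T]. *)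
Definition Cgamma (R : realType) (T gamma : R) (f : R -> R) : Prop :=
  exists2 g : R -> R, {within `[0, T], continuous g} &
    forall t : R, 0 < t <= T -> g t = t `^ gamma * f t.

(* C^n_gamma[0,T] *)
Definition Cngamma (R : realType) (T : R) (n : nat) (gamma : R) (f : R -> R) : Prop :=
  [/\ forall k, (k < n)%N -> {within `[0, T], continuous (derivn_on `[0, T] k f)},
      forall k, (k.+1 < n)%N -> forall t : R, 0 <= t <= T ->
        derivable_on `[0, T] (derivn_on `[0, T] k f) t,
      forall k, (k < n)%N -> forall t : R, 0 < t <= T ->
        derivable_on `[0, T] (derivn_on `[0, T] k f) t &
      Cgamma T gamma (derivn_on `[0, T] n f)].

(* Euler's Gamma function at x > 0 *)
Definition Gamma (R : realType) (x : R) : R :=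
  \int[lebesgue_measure]_(u in `[0, +oo[) (u `^ (x - 1) * expR (- u)).

Definition Phi (R : realType) (beta t : R) : R := t `^ (beta - 1) / Gamma beta.

(* Riemann-Liouville integral, for alpha >= 0 *)
Definition RLint (R : realType) (alpha : R) (f : R -> R) (t : R) : R :=
  if alpha == 0 then f t
  else (Gamma alpha)^-1 *
       \int[lebesgue_measure]_(s in `[0, t]) ((t - s) `^ (alpha - 1) * f s).

(* For alpha >= 0, the natural number n such that n - 1 < alpha <= n *)
Definition ceiln (R : realType) (alpha : R) : nat := `|Num.ceil alpha|%N.

(* Riemann-Liouville derivative, for alpha >= 0 and 0 < t <= T *)
Definition RLder (R : realType) (T alpha : R) (f : R -> R) : R -> R :=
  let n := ceiln alpha in derivn_on `[0, T] n (RLint (n%:R - alpha) f).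

(* Existence of the Riemann-Liouville derivative at all the points of B *)
Definition RLderivable (R : realType) (T alpha : R) (B : set R) (f : R -> R) : Prop :=
  let n := ceiln alpha in
  forall k, (k < n)%N -> forall t, B t ->
    derivable_on `[0, T] (derivn_on `[0, T] k (RLint (n%:R - alpha) f)) t.

Definition subTaylor (R : realType) (T : R) (n : nat) (f : R -> R) (t : R) : R :=
  f t - \sum_(0 <= k < n) derivn_on `[0, T] k f 0 / k`!%:R * t ^+ k.

Definition Caputo (R : realType) (T alpha : R) (f : R -> R) : R -> R :=
  RLder T alpha (subTaylor T (ceiln alpha) f).

Definition Caputo_derivable (R : realType) (T alpha : R) (B : set R) (f : R -> R) : Prop :=
  RLderivable T alpha B (subTaylor T (ceiln alpha) f).

(* y satisfies the equation on (0, T), all the derivatives involved existing.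
   Only alpha 0, ..., alpha m and a 1, ..., a m are relevant. *)
Definition solution (R : realType) (T : R) (m : nat) (alpha : nat -> R)
    (a : nat -> R -> R) (y : R -> R) : Prop :=
  (forall i, (i <= m)%N -> Caputo_derivable T (alpha i) `]0, T[ y) /\
  (forall t : R, 0 < t < T ->
     Caputo T (alpha 0%N) y t =
     - \sum_(1 <= i < m.+1) a i t * Caputo T (alpha i) y t).

Definition canonical_system (R : realType) (T : R) (m : nat) (alpha : nat -> R)
    (a : nat -> R -> R) (n0 : nat) (y : 'I_n0 -> R -> R) : Prop :=
  (forall j, solution T m alpha a (y j)) /\
  (forall k j : 'I_n0, derivn_on `[0, T] k (y j) t @[t --> 0^'+] --> ((k == j)%:R : R)).

Definition Hset (R : realType) (m : nat) (alpha : nat -> R) (j : nat) : set nat :=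
  [set i | (1 <= i <= m)%N /\ 0 <= alpha i <= j%:R].

Definition is_min (A : set nat) (k : nat) : Prop :=
  A k /\ forall i, A i -> (k <= i)%N.

(* g |-> sum_(i = 1)^m a_i I^(alpha_0 - alpha_i) g *)
Definition opA (R : realType) (m : nat) (alpha : nat -> R) (a : nat -> R -> R)
    (g : R -> R) (t : R) : R :=
  \sum_(1 <= i < m.+1) a i t * RLint (alpha 0%N - alpha i) g t.

(* Main.v *)
From HB Require Import structures.
Require Import Defs.
From mathcomp Require Import measurable_realfun ring lra.

(* A solution in C_gamma^n0 with the j-th initial condition is
   y = t^j/j! + I^n0 v with v in C_gamma, and (E) becomes a Volterra equation
     I^gamma v = - sum_i a_i I^(beta_i + gamma) v - g_j,
   where beta_i = alpha_0 - alpha_i > 0 and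
   g_j = sum_(i >= h_j) a_i Phi_(j + 1 - alpha_i).
   It can be solved for v because a I^gamma p lies in I^gamma (C_gamma) when a
   is in C^1_gamma and p in C_gamma: integrating I^(1 - gamma) (a I^gamma p) by
   parts gives a I^gamma p = I^gamma q with
     q(t) = a(t) p(t) + gamma/Gamma(1 - gamma) *
            int_0^t (a(t) - a(s)) (t - s)^(-1 - gamma) (I^gamma p)(s) ds.
   In the norm sup t^gamma e^(- lambda t) |v(t)| this multiplication is bounded
   uniformly in lambda, while I^beta tends to 0 as lambda grows, so the map
   v |-> - I^(- gamma) sum_i a_i I^(beta_i + gamma) v is a contraction.  Its
   fixed point equation has a unique solution, given by the Neumann series, and
   I^n0 of that series is the series of the theorem. *)

(** The obstacle is multiplication by a_i: it does not commute with fractional integration, so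
    I^gamma must be brought back in front of every term. Applying I^(1 - gamma) to the claimed
    identity a I^gamma p = I^gamma q leaves ordinary primitives to compare, and injectivity of I^(1
    - gamma) concludes. For gamma = 0 there is nothing to invert and q = a p. Convolutions run over
    the whole line with kernels vanishing on the negative half-line, so that supports replace the
    limits of integration; functions of C_gamma[0,T] are extended past T for that purpose. No
    complete function space is set up. The operator to be inverted is known only through a chosen
    image of each v, and its linearity is never invoked: the iterates are halved at each step in the
    weighted norm, a Weierstrass test sums them, and the equation passes to the limit in the form
    where I^gamma has been applied. Uniqueness applies the same halving to the difference of two
    solutions, on each [0, S'] with S' < T, since (E) is only given on the open interval. *)

(** * Affine substitutions in integrals over the line *)

Section affine_change.
Variable R : realType.
Notation mu := (@lebesgue_measure R).
Variables (c b : R).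
Hypothesis c0 : c != 0.

Let phi (x : R) : R := c * x + b.

Lemma measurable_affine : measurable_fun [set: R] phi.
Proof.
apply: continuous_measurable_fun => x; apply: cvgD; last exact: cvg_cst.
by apply: cvgM; [exact: cvg_cst|exact: cvg_id].
Qed.

Let nu : {measure set (measurableTypeR R) -> \bar R} :=
  @measure_function_pushforward__canonical__measure_function_Measure _ _
    (measurableTypeR R) (measurableTypeR R) R mu phi measurable_affine.

(** Lebesgue measure is determined by half-open intervals, so it suffices to compute their
    preimages; for c < 0 the orientation is reversed and the preimage is closed on the left instead,
    with the same length. *)
Lemma lebesgue_measure_affine (A : set R) : measurable A ->
  mscale (`|c|%:nng)%R nu A = mu A.
Proof.
move=> mA; apply/esym; apply: (@lebesgue_measure_unique R
  (mscale (`|c|%:nng)%R nu)) => //= _ [[u v]] _ <-.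
rewrite /mscale /nu/= /pushforward /=.
have [cp|cn|/eqP] := ltgtP 0 c; last by rewrite eq_sym (negbTE c0).
  have -> : phi @^-1` `]u, v] = `](u - b) / c, (v - b) / c]%classic.
    apply/seteqP; split => x /=; rewrite !in_itv/= /phi ltr_pdivrMr// ler_pdivlMr// ltrBlDr lerBrDr mulrC;
    by rewrite mulrC.
  rewrite !lebesgue_measure_itv/= !lte_fin ltr_pM2r ?invr_gt0// ltrD2r.
  case: ifP => uv; last by rewrite mule0.
  by rewrite -!EFinD -EFinM gtr0_norm// -mulrBl mulrC divfK//; congr EFin; ring.
have -> : phi @^-1` `]u, v] = `[(v - b) / c, (u - b) / c[%classic.
  apply/seteqP; split => x /=; rewrite !in_itv/= /phi ltr_ndivlMr// ler_ndivrMr// ltrBlDr lerBrDr andbC mulrC;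
  by rewrite mulrC.
rewrite !lebesgue_measure_itv/= !lte_fin ltr_nM2r ?invr_lt0// ltrD2r.
case: ifP => uv; last by rewrite mule0.
by rewrite -!EFinD -EFinM ltr0_norm// -mulrBl mulNr mulrC divfK//; congr EFin; ring.
Qed.

Lemma ge0_integral_affine (f : R -> \bar R) : measurable_fun [set: R] f ->
  (forall x, 0 <= f x)%E ->
  (\int[mu]_x f x = `|c|%:E * \int[mu]_x f (c * x + b)%R)%E.
Proof.
move=> mf f0.
transitivity (\int[mscale (`|c|%:nng)%R nu]_x f x)%E.
  by apply: eq_measure_integral => A mA _; exact/esym/lebesgue_measure_affine.
rewrite ge0_integral_mscale//=; congr (_ * _)%E.
by have := @ge0_integral_pushforward _ _ (measurableTypeR R) (measurableTypeR R) R phi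
  measurable_affine mu setT f measurableT mf (fun x _ => f0 x); rewrite preimage_setT.
Qed.

Lemma integrable_affine (f : R -> R) : mu.-integrable setT (EFin \o f) ->
  mu.-integrable setT (EFin \o (fun x => f (c * x + b))).
Proof.
move=> fi.
have mf := measurable_int _ fi.
have mf' : measurable_fun [set: R] (EFin \o (fun x => f (c * x + b))).
  exact: (measurableT_comp mf measurable_affine).
apply/integrableP; split => //.
have /integrableP[_] := fi.
have maf : measurable_fun [set: R] (fun x => `|(EFin \o f) x|%E) by exact: measurableT_comp mf.
rewrite ge0_integral_affine//=.
move=> cf; have [oo|]  := eqVneq (\int[mu]_x (`|f (c * x + b)|)%:E)%E +oo%E.
  by move: cf; rewrite oo mulry gtr0_sg ?normr_gt0// mul1e.
by rewrite -ltey.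
Qed.

Lemma Rintegral_affine (f : R -> R) : mu.-integrable setT (EFin \o f) ->
  \int[mu]_x f x = `|c| * \int[mu]_x f (c * x + b).
Proof.
move=> fi; have fi' := integrable_affine fi.
have mf := measurable_int _ fi.
pose F : R -> \bar R := EFin \o f.
have pf : (\int[mu]_x F^\+ (c * x + b)%R \is a fin_num)%E.
  have := @integrable_pos_fin_num _ _ _ mu setT measurableT _ fi'.
  by congr (_ \is a fin_num); apply: eq_integral => x _; rewrite !funeposE.
have nf : (\int[mu]_x F^\- (c * x + b)%R \is a fin_num)%E.
  have := @integrable_neg_fin_num _ _ _ mu setT measurableT _ fi'.
  by congr (_ \is a fin_num); apply: eq_integral => x _; rewrite !funenegE.
have -> : \int[mu]_x f (c * x + b) =
    fine (\int[mu]_x F^\+ (c * x + b)%R - \int[mu]_x F^\- (c * x + b)%R)%E.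
  rewrite /Rintegral integralE; congr (fine (_ - _));
    by apply: eq_integral => x _; rewrite ?funeposE ?funenegE.
have -> : \int[mu]_x f x = fine (\int[mu]_x F^\+ x - \int[mu]_x F^\- x)%E.
  by rewrite /Rintegral integralE.
rewrite [X in (X - _)%E]ge0_integral_affine//; last exact: measurable_funepos.
rewrite [X in (_ - X)%E]ge0_integral_affine//; last exact: measurable_funeneg.
rewrite -muleBr//; last exact: fin_num_adde_defr.
by rewrite fineM// fin_numB pf nf.
Qed.
End affine_change.

(** * The Gamma function and the kernels t^(a-1)/Gamma(a) *)

Section gamma.
Variable R : realType.
Notation mu := (@lebesgue_measure R).

Lemma continuous_powR_gt0 (p x : R) : 0 < x -> {for x, continuous (fun u => u `^ p)}.
Proof.
move=> x0; apply: differentiable_continuous; apply/derivable1_diffP.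
by apply: derivable_powR; rewrite in_itv/= x0.
Qed.

Lemma is_derive_powR (p x : R) : 0 < x -> is_derive x 1 (fun u => u `^ p) (p * x `^ (p - 1)).
Proof.
move=> x0; apply: DeriveDef; first by apply: derivable_powR; rewrite in_itv/= x0.
by rewrite -derive1E powR_derive1// in_itv/= x0.
Qed.

Lemma within_continuous_gt0 (f : R -> R) (a b : R) : 0 < a ->
  (forall x, 0 < x -> {for x, continuous f}) -> {within `[a, b], continuous f}.
Proof.
move=> a0 cf; apply: continuous_in_subspaceT => x; rewrite inE/= in_itv/= => /andP[ax _].
by apply: cf; exact: lt_le_trans ax.
Qed.

(** Monotone convergence along the intervals [1/(i + 1), 1], on which the primitive u^x / x bounds
    the integral by 1/x. *)
Lemma gamma_head_lty (x : R) : 0 < x ->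
  (\int[mu]_(u in `]0%R, 1%R]) (u `^ (x - 1))%:E < +oo)%E.
Proof.
move=> x0.
pose F (i : nat) : set R := `[i.+1%:R^-1, 1]%classic.
have FU : `]0%R, 1%R]%classic = \bigcup_i F i.
  apply/seteqP; split => [u/=|u [i _]]; rewrite /F/= !in_itv/=.
    move=> /andP[u0 u1]; exists (Num.truncn u^-1) => //=.
    rewrite in_itv/= u1 andbT invf_ple ?posrE//.
    by rewrite ltW// truncnS_gt.
  by move=> /andP[iu ->]; rewrite andbT (lt_le_trans _ iu).
have bd i : (\int[mu]_(u in F i) (u `^ (x - 1))%:E <= x^-1%:E)%E.
  (* For i = 0 the interval is the single point 1, to which the fundamental theorem on a proper
     interval does not apply. *)
  have [i0|i0] := eqVneq i 0%N.
    by rewrite /F i0 invr1 set_itv1 integral_set1 lee_fin invr_ge0 ltW.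
  have i1 : i.+1%:R^-1 < 1 :> R by rewrite invf_lt1// ltr1n ltnS lt0n.
  have ip : 0 < i.+1%:R^-1 :> R by rewrite invr_gt0.
  rewrite (@continuous_FTC2 _ _ (fun u => x^-1 * u `^ x))//.
  - rewrite powR1 mulr1 -EFinD lee_fin gerBl// mulr_ge0// ?powR_ge0// invr_ge0; exact: ltW.
  - by apply: within_continuous_gt0 => // u u0; exact: continuous_powR_gt0.
  - split.
    + move=> u; rewrite in_itv/= => /andP[iu _]; apply: derivableM => //.
      by apply: derivable_powR; rewrite in_itv/= (lt_trans ip iu).
    + apply: cvg_at_right_filter; apply: cvgMr; exact: continuous_powR_gt0.
    + apply: cvg_at_left_filter; apply: cvgMr; exact: continuous_powR_gt0.
  - move=> u; rewrite in_itv/= => /andP[iu _].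
    have u0 := lt_trans ip iu.
    have D := is_deriveZ (x^-1) (is_derive_powR x u0).
    rewrite derive1E (@derive_val _ _ _ _ _ _ _ D).
    by rewrite /GRing.scale/= mulKf// gt_eqF.
have mF i : measurable_fun (F i) (fun u => (u `^ (x - 1))%:E).
  by apply/measurable_EFinP; apply: measurable_funTS; exact: measurable_powR.
have ndF : {homo F : n m / (n <= m)%N >-> (n <= m)%O}.
  move=> i j ij; apply/subsetPset; apply: subset_itvr; rewrite bnd_simp.
  by rewrite lef_pV2 ?posrE// ler_nat ltnS.
have mFi i : measurable (F i) by exact: measurable_itv.
have F0 i u : F i u -> (0 <= (u `^ (x - 1))%:E)%E by rewrite lee_fin powR_ge0.
rewrite FU; apply: (@le_lt_trans _ _ x^-1%:E); last by rewrite ltry.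
have cv := @ge0_nondecreasing_set_cvg_integral _ (measurableTypeR R) R F (fun u => (u `^ (x - 1))%:E) mu ndF mFi mF F0.
by rewrite -(cvg_lim _ cv)//; apply: lime_le; [exact: cvgP cv|exact: nearW].
Qed.

(** For u >= 1 the power is at most u^(n + 1), and one term of the exponential series at u/2 bounds
    it by a multiple of e^(u/2). The point 0 is included because the majorant must hold off ]0, 1];
    there the power is 0 or 1, whence the summand 1 in C. *)
Lemma powR_expR_le (x : R) : exists2 C, 1 <= C &
  forall u, 0 <= u -> (u <= 0) || (1 <= u) -> u `^ (x - 1) * expR (- u) <= C * expR (- (2^-1 * u)).
Proof.
pose n := (Num.truncn `|x|).
exists (1 + 2 ^+ n.+1 * n.+1`!%:R); first by rewrite lerDl mulr_ge0// exprn_ge0.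
move=> u u0 /orP[u0'|u1].
  have -> : u = 0 by apply/eqP; rewrite eq_le u0 u0'.
  rewrite mulr0 oppr0 expR0 !mulr1 /powR eqxx.
  apply: (@le_trans _ _ 1); first by case: (_ == _).
  by rewrite lerDl mulr_ge0// exprn_ge0.
have h : u `^ (x-1) <= u ^+ n.+1.
  rewrite -powR_mulrn//; apply: ler_powR => //.
  rewrite lerBlDr; apply: (le_trans (ler_norm x)).
  apply: (@le_trans _ _ n.+1%:R); first by rewrite ltW// truncnS_gt.
  by rewrite lerDl.
have h2 : u ^+ n.+1 <= 2 ^+ n.+1 * n.+1`!%:R * expR (2^-1 * u).
  have := @expR_ge1Dxn R (2^-1 * u) n; rewrite mulr_ge0// => /(_ isT) h3.
  have h4 : (2^-1 * u) ^+ n.+1 / (n.+1)`!%:R <= expR (2^-1 * u).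
    by apply: le_trans h3; rewrite lerDr.
  have E : (2^-1 * u) ^+ n.+1 / (n.+1)`!%:R = u ^+ n.+1 / (2 ^+ n.+1 * n.+1`!%:R).
    by rewrite exprMn exprVn invfM mulrA [_ ^-1 * _]mulrC.
  rewrite E ler_pdivrMr ?mulr_gt0 ?exprn_gt0 ?ltr0n ?fact_gt0// in h4.
  by rewrite (le_trans h4)// le_eqVlt; apply/orP; left; apply/eqP; ring.
have -> : - u = - (2^-1 * u) - 2^-1 * u by field.
rewrite expRD mulrA ler_pM2r ?expR_gt0//.
rewrite expRN ler_pdivrMr ?expR_gt0//.
apply: (le_trans h); apply: (le_trans h2); rewrite ler_pM2r ?expR_gt0//.
by rewrite lerDr.
Qed.

Lemma measurable_gamma_integrand (x : R) :
  measurable_fun [set: R] (fun u : R => u `^ (x - 1) * expR (- u)).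
Proof.
apply: measurable_funM; first exact: measurable_powR.
by apply: measurableT_comp => //; exact: measurable_expR.
Qed.

(** The majorant is u^(x - 1) on ]0, 1] plus 2 C times the exponential density of rate 1/2, whose
    integral is 1. *)
Lemma gamma_lty (x : R) : 0 < x ->
  (\int[mu]_(u in `[0%R, +oo[) (u `^ (x - 1) * expR (- u))%:E < +oo)%E.
Proof.
move=> x0; have [C C1 HC] := powR_expR_le x.
have C0 : 0 <= C by rewrite (le_trans _ C1).
pose G1 : R -> \bar R := (fun u : R => (u `^ (x - 1))%:E) \_ `]0, 1].
pose G2 : R -> \bar R := fun u => ((2 * C)%:E * (exponential_pdf 2^-1 u)%:E)%E.
have mG1 : measurable_fun setT G1.
  apply/(measurable_restrictT _ _).1 => //.
  by apply/measurable_EFinP; apply: measurable_funTS; exact: measurable_powR.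
have mG2 : measurable_fun setT G2.
  apply: emeasurable_funM => //; apply/measurable_EFinP; exact: measurable_exponential_pdf.
have G10 u : (0 <= G1 u)%E.
  by rewrite /G1 patchE; case: ifP => // _; rewrite lee_fin powR_ge0.
have G20 u : (0 <= G2 u)%E.
  by rewrite mule_ge0// lee_fin ?mulr_ge0// exponential_pdf_ge0.
apply: (@le_lt_trans _ _ (\int[mu]_u (G1 u + G2 u))%E).
  rewrite integral_mkcond; apply: ge0_le_integral => //.
  - move=> u _; rewrite patchE; case: ifP => // _.
    by rewrite lee_fin mulr_ge0 ?powR_ge0 ?expR_ge0.
  - apply/(measurable_restrictT _ _).1 => //.
    by apply/measurable_EFinP; apply: measurable_funTS; exact: measurable_gamma_integrand.
  - exact: emeasurable_funD.
  - move=> u _; rewrite patchE; case: ifPn => [|_]; last by rewrite adde_ge0.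
    rewrite inE/= in_itv/= andbT => u0.
    rewrite /G1 patchE; case: ifPn => [|].
      move=> _; apply: (@le_trans _ _ (u `^ (x - 1))%:E); last by rewrite leeDl.
      rewrite lee_fin ler_piMr ?powR_ge0// -expR0 ler_expR; lra.
    rewrite notin_setE/= in_itv/= => /negP; rewrite negb_and -leNgt -ltNge => h.
    rewrite add0e /G2 exponential_pdfE// -EFinM lee_fin.
    have -> : 2 * C * (2^-1 * expR (- 2^-1 * u)) = C * expR (- (2^-1 * u)).
      by rewrite mulNr; field.
    by apply: HC => //; case/orP : h => [->//|/ltW ->]; rewrite orbT.
rewrite ge0_integralD//= ge0_integralZl//; last 3 first.
- by apply/measurable_EFinP; exact: measurable_exponential_pdf.
- by move=> u _; rewrite lee_fin exponential_pdf_ge0.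
- by rewrite lee_fin mulr_ge0.
rewrite integral_exponential_pdf ?invr_gt0// mule1.
by rewrite lte_add_pinfty ?ltry// /G1 -integral_mkcond gamma_head_lty.
Qed.

Lemma gamma_fin (x : R) : 0 < x ->
  (\int[mu]_(u in `[0%R, +oo[) (u `^ (x - 1) * expR (- u))%:E = (Gamma x)%:E)%E.
Proof.
move=> x0; rewrite fineK// ge0_fin_numE ?gamma_lty//.
by apply: integral_ge0 => u _; rewrite lee_fin mulr_ge0 ?powR_ge0 ?expR_ge0.
Qed.

(** On [1, 2] the integrand is at least e^(-2) / 2, because u^(x - 1) >= u^(-1) >= 1/2. *)
Lemma Gamma_gt0 (x : R) : 0 < x -> 0 < Gamma x.
Proof.
move=> x0; rewrite -lte_fin -gamma_fin//.
apply: (@lt_le_trans _ _ (\int[mu]_(u in `[1%R, 2%R]) (cst (2^-1 * expR (- 2))%R%:E u))%E).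
  rewrite integral_cst//= lebesgue_measure_itv/= lte_fin ltr1n/= -EFinD -EFinM lte_fin.
  by rewrite !mulr_gt0 ?expR_gt0//; lra.
apply: (@le_trans _ _ (\int[mu]_(u in `[1%R, 2%R]) (u `^ (x - 1) * expR (- u))%:E)%E).
  apply: ge0_le_integral => //.
  - by move=> u _; rewrite lee_fin mulr_ge0 ?expR_ge0.
  - by apply/measurable_EFinP; apply: measurable_funTS; exact: measurable_gamma_integrand.
  - move=> u /=; rewrite in_itv/= => /andP[u1 u2]; rewrite lee_fin ler_pM ?expR_ge0//.
      apply: (@le_trans _ _ (u `^ (-1))); last by apply: ler_powR => //; lra.
      rewrite powR_inv1; last lra.
      by rewrite lef_pV2 ?posrE//; lra.
    by rewrite ler_expR; lra.
apply: ge0_subset_integral => //.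
- by apply/measurable_EFinP; apply: measurable_funTS; exact: measurable_gamma_integrand.
- by move=> u _; rewrite lee_fin mulr_ge0 ?powR_ge0 ?expR_ge0.
- by move=> u /=; rewrite !in_itv/= => /andP[u1 _]; rewrite andbT; lra.
Qed.

Lemma Gamma1 : Gamma 1 = 1 :> R.
Proof.
apply: EFin_inj; rewrite -gamma_fin// -(@integral_exponential_pdf R 1)//.
rewrite integral_mkcond; apply: eq_integral => u _; rewrite /exponential_pdf !patchE.
by case: ifP => // _; rewrite subrr powRr0 mulN1r.
Qed.
End gamma.

Definition kern (R : realType) (a x : R) : R := if 0 < x then Phi a x else 0.

Section kern.
Variable R : realType.
Notation mu := (@lebesgue_measure R).
Implicit Types a b t x : R.

Lemma kern_gt0 a x : 0 < x -> kern a x = x `^ (a - 1) / Gamma a.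
Proof. by rewrite /kern => ->. Qed.

Lemma kern_le0 a x : x <= 0 -> kern a x = 0.
Proof. by rewrite /kern ltNge => ->. Qed.

Lemma kern_ge0 a x : 0 < a -> 0 <= kern a x.
Proof.
move=> a0; rewrite /kern; case: ifP => // x0.
by rewrite divr_ge0 ?powR_ge0// ltW// Gamma_gt0.
Qed.

Lemma measurable_kern a : measurable_fun [set: R] (kern a).
Proof.
rewrite /kern; apply: measurable_fun_ifT => //=.
- exact: measurable_fun_ltr.
- apply: measurable_funM => //; exact: measurable_powR.
Qed.

Lemma measurable_kernB a t : measurable_fun [set: R] (fun s => kern a (t - s)).
Proof.
by apply: (measurableT_comp (measurable_kern a)); exact: measurable_funB.
Qed.

Lemma measurable_kernB2 a :
  measurable_fun [set: R * R] (fun z => kern a (z.1 - z.2)).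
Proof.
by apply: (measurableT_comp (measurable_kern a)); exact: measurable_funB.
Qed.

Lemma measurable_expRN : measurable_fun [set: R] (fun u : R => expR (- u)).
Proof. by apply: measurableT_comp => //; exact: measurable_expR. Qed.

Lemma ge0_integralZ (k : \bar R) (f : R -> R) : measurable_fun [set: R] f ->
  (forall x, 0 <= f x) -> (0 <= k)%E ->
  (\int[mu]_x (k * (f x)%:E) = k * \int[mu]_x (f x)%:E)%E.
Proof.
move=> mf f0 k0; apply: ge0_integralZl; [exact: measurableT| |by move=> x _; rewrite lee_fin|exact: k0].
by apply/measurable_EFinP; exact: mf.
Qed.

(** The factor 1/Gamma(a) normalises the Laplace transform at 1 to the value 1; this is what
    evaluates the Beta integral below. *)
Lemma kern_laplace a : 0 < a ->
  (\int[mu]_u (kern a u * expR (- u))%:E = 1)%E.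
Proof.
move=> a0; have G0 := Gamma_gt0 a0.
transitivity ((Gamma a)^-1%:E * (Gamma a)%:E)%E; last first.
  by rewrite -EFinM mulVf// gt_eqF.
rewrite -gamma_fin// -integral_itv_obnd_cbnd; last first.
  apply/measurable_EFinP; apply: measurable_funTS; exact: measurable_gamma_integrand.
rewrite -ge0_integralZl//; last 3 first.
- apply/measurable_EFinP; apply: measurable_funTS; exact: measurable_gamma_integrand.
- by move=> u _; rewrite lee_fin mulr_ge0 ?powR_ge0 ?expR_ge0.
- by rewrite lee_fin invr_ge0 ltW.
rewrite [RHS]integral_mkcond; apply: eq_integral => u _; rewrite patchE.
case: ifPn => [|]; rewrite ?inE ?notin_setE/= in_itv/= andbT => u0.
  by rewrite kern_gt0// -EFinM mulrAC mulrC.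
by rewrite kern_le0 ?mul0r// leNgt; exact/negP.
Qed.

Lemma kernM a t x : 0 < t -> kern a (t * x) = t `^ (a - 1) * kern a x.
Proof.
move=> t0; rewrite /kern pmulr_rgt0//; case: ifP => x0; last by rewrite mulr0.
by rewrite /Phi powRM ?mulrA// ltW.
Qed.

Lemma kern_conv_le0 a b x s : x <= 0 -> kern a (x - s) * kern b s = 0.
Proof.
move=> x0; have [s0|s0] := leP s 0; first by rewrite (kern_le0 b s0) mulr0.
by rewrite (@kern_le0 a (x - s)) ?mul0r//; lra.
Qed.

Let conv a b t : \bar R := (\int[mu]_s (kern a (t - s) * kern b s)%:E)%E.

Let mconv a b t : measurable_fun [set: R] (fun s => kern a (t - s) * kern b s).
Proof. by apply: measurable_funM; [exact: measurable_kernB|exact: measurable_kern]. Qed.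

Let conv_scale a b t : 0 < a -> 0 < b -> 0 < t ->
  (conv a b t = (t `^ (a + b - 1))%:E * conv a b 1)%E.
Proof.
move=> a0 b0 t0; have t0' : t != 0 by rewrite gt_eqF.
rewrite /conv (@ge0_integral_affine _ t 0 t0' (fun s => (kern a (t - s) * kern b s)%:E)); first last.
- by move=> s; rewrite lee_fin mulr_ge0 ?kern_ge0.
- by apply/measurable_EFinP; exact: mconv.
have -> : (\int[mu]_s (kern a (t - (t * s + 0)) * kern b (t * s + 0))%:E =
    \int[mu]_s ((t `^ (a - 1) * t `^ (b - 1))%:E * (kern a (1 - s) * kern b s)%:E))%E.
  apply: eq_integral => s _.
  rewrite addr0 (_ : t - t * s = t * (1 - s)); last by rewrite mulrBr mulr1.
  by rewrite !kernM// -EFinM; congr EFin; ring.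
rewrite ge0_integralZ; [|exact: mconv|by move=> s; rewrite mulr_ge0 ?kern_ge0|by rewrite lee_fin mulr_ge0 ?powR_ge0].
rewrite muleA -EFinM; congr (_%:E * _)%E.
rewrite gtr0_norm// mulrA mulr_powRB1//; last exact: ltW.
by rewrite -powRD ?t0' ?implybT// addrA.
Qed.

(* Scaling reduces the convolution to its value K at t = 1; comparing Laplace
   transforms at 1 yields Gamma(a + b) K = 1. *)
Lemma conv_kern a b t : 0 < a -> 0 < b ->
  (\int[mu]_s (kern a (t - s) * kern b s)%:E = (kern (a + b) t)%:E)%E.
Proof.
move=> a0 b0; have ab0 : 0 < a + b by rewrite addr_gt0.
have G0 := Gamma_gt0 ab0.
rewrite -/(conv a b t).
have [t0|t0] := ltP 0 t; last first.
  by rewrite kern_le0// /conv; apply: integral0_eq => s _; rewrite kern_conv_le0.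
suff c1 : conv a b 1 = (Gamma (a + b))^-1%:E.
  by rewrite conv_scale// c1 kern_gt0.
pose f (z : R * R) := (kern a (z.1 - z.2) * kern b z.2 * expR (- z.1))%:E.
have mf : measurable_fun [set: R * R] f.
  apply/measurable_EFinP; apply: measurable_funM.
    apply: measurable_funM; first exact: measurable_kernB2.
    exact: (measurableT_comp (measurable_kern b)).
  exact: (measurableT_comp measurable_expRN).
have f0 z : (0 <= f z)%E by rewrite lee_fin !mulr_ge0 ?kern_ge0 ?expR_ge0.
have FT := fubini_tonelli (m1 := mu) (m2 := mu) f mf f0.
have c0 : (0 <= conv a b 1)%E.
  by apply: integral_ge0 => s _; rewrite lee_fin mulr_ge0 ?kern_ge0.
have conv0 x : x <= 0 -> conv a b x = 0%E.
  by move=> x0; apply: integral0_eq => s _; rewrite kern_conv_le0.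
have L : (\int[mu]_x \int[mu]_y f (x, y) = (Gamma (a + b))%:E * conv a b 1)%E.
  transitivity (\int[mu]_x (((Gamma (a + b))%:E * conv a b 1) * (kern (a + b) x * expR (- x))%:E))%E.
    suff inner (x : R) : (\int[mu]_y f (x, y) =
        ((Gamma (a + b))%:E * conv a b 1) * (kern (a + b) x * expR (- x))%:E)%E.
      by apply: eq_integral => x _; exact: inner.
    transitivity (\int[mu]_y ((expR (- x))%:E * (kern a (x - y) * kern b y)%:E))%E.
      by apply: eq_integral => y _; rewrite /f/= EFinM muleC.
    rewrite ge0_integralZ; [|exact: mconv|by move=> s; rewrite mulr_ge0 ?kern_ge0|by rewrite lee_fin expR_ge0].
    rewrite -/(conv a b x).
    have [x0|x0] := ltP 0 x; last first.
      have -> := conv0 x x0; rewrite (kern_le0 _ x0) mul0r.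
      by move: (conv a b 1) => K; rewrite !mule0.
    rewrite (conv_scale a0 b0 x0) (kern_gt0 _ x0); move: (conv a b 1) => K.
    rewrite [RHS]muleC !muleA -!EFinM; congr (_%:E * _)%E.
    by field; rewrite gt_eqF.
  move: (conv a b 1) c0 => K K0.
  rewrite ge0_integralZ; first by rewrite (kern_laplace ab0) mule1.
  - by apply: measurable_funM; [exact: measurable_kern|exact: measurable_expRN].
  - by move=> s; rewrite mulr_ge0 ?kern_ge0 ?expR_ge0.
  - by apply: mule_ge0; [rewrite lee_fin; exact: ltW|exact: K0].
have Rr : (\int[mu]_y \int[mu]_x f (x, y) = 1)%E.
  rewrite -[RHS](kern_laplace b0); apply: eq_integral => y _.
  rewrite /f/=.
  transitivity (\int[mu]_x ((kern b y * expR (- y))%:E * (kern a (x - y) * expR (- (x - y)))%:E))%E.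
    apply: eq_integral => x _; rewrite -EFinM; congr EFin.
    have -> : expR (- x) = expR (- y) * expR (- (x - y)) by rewrite -expRD; congr expR; ring.
    by ring.
  rewrite ge0_integralZ; first last.
  - by rewrite lee_fin mulr_ge0 ?kern_ge0 ?expR_ge0.
  - by move=> s; rewrite mulr_ge0 ?kern_ge0 ?expR_ge0.
  - apply: measurable_funM.
      by apply: (measurableT_comp (measurable_kern a)); exact: measurable_funB.
    by apply: (measurableT_comp measurable_expRN); exact: measurable_funB.
  have -> : (\int[mu]_x (kern a (x - y) * expR (- (x - y)))%:E = 1)%E.
    rewrite -[RHS](kern_laplace a0).
    rewrite (@ge0_integral_affine _ 1 (- y) (oner_neq0 _) (fun u => (kern a u * expR (- u))%:E)); first last.
    - by move=> s; rewrite lee_fin mulr_ge0 ?kern_ge0 ?expR_ge0.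
    - apply/measurable_EFinP; apply: measurable_funM; [exact: measurable_kern|exact: measurable_expRN].
    by rewrite normr1 mul1e; apply: eq_integral => s _; rewrite mul1r.
  by rewrite mule1.
rewrite L Rr in FT.
(* Finiteness of the convolution is itself read off the identity: a positive multiple of +oo is not
   1. *)
have cfin : conv a b 1 \is a fin_num.
  rewrite ge0_fin_numE//.
  have [oo|] := eqVneq (conv a b 1) +oo%E; last by rewrite -ltey.
  by move: FT; rewrite oo mulry gtr0_sg// mul1e.
have {}FT : Gamma (a + b) * fine (conv a b 1) = 1.
  by apply: EFin_inj; rewrite EFinM (fineK cfin); exact: FT.
rewrite -(fineK cfin); move: (fine (conv a b 1)) FT => K FT; congr EFin.
by rewrite -[RHS]mulr1 -FT mulKf// gt_eqF.
Qed.

Lemma integrable_conv_kern a b t : 0 < a -> 0 < b ->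
  mu.-integrable setT (EFin \o (fun s => kern a (t - s) * kern b s)).
Proof.
move=> a0 b0; apply/integrableP; split; first by apply/measurable_EFinP; exact: mconv.
under eq_integral => s _ do rewrite /= ger0_norm ?mulr_ge0 ?kern_ge0//.
by rewrite conv_kern// ltry.
Qed.

Lemma Rconv_kern a b t : 0 < a -> 0 < b ->
  \int[mu]_s (kern a (t - s) * kern b s) = kern (a + b) t.
Proof. by move=> a0 b0; rewrite /Rintegral conv_kern. Qed.

Lemma kern1 x : 0 < x -> kern 1 x = 1.
Proof. by move=> x0; rewrite kern_gt0// subrr powRr0 Gamma1 divr1. Qed.

Lemma conv_kern_shift a b t r : 0 < a -> 0 < b ->
  mu.-integrable setT (EFin \o (fun s => kern a (t - s) * kern b (s - r))) /\
  \int[mu]_s (kern a (t - s) * kern b (s - r)) = kern (a + b) (t - r).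
Proof.
move=> a0 b0; have i1 := @integrable_conv_kern a b (t - r) a0 b0.
have E (s : R) : kern a (t - r - (1 * s + - r)) * kern b (1 * s + - r) = kern a (t - s) * kern b (s - r).
  by congr (kern a _ * kern b _); ring.
split.
  have := @integrable_affine R 1 (- r) (oner_neq0 R) _ i1.
  by congr (_.-integrable _ _); apply/funext => s; congr EFin; exact: E.
rewrite -(Rconv_kern (t - r) a0 b0) [RHS](@Rintegral_affine R 1 (- r) (oner_neq0 R) _ i1) normr1 mul1r.
by apply: eq_Rintegral => s _; rewrite E.
Qed.

(** The majorant is a triple convolution of kernels, whose double integral is a multiple of
    [kern (a + (b + c)) t], hence finite. Domination by it thus serves as a ready-made integrability
    criterion. The integrability of the inner integral is returned as well, because linearity of the
    outer one is used afterwards. *)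
Lemma fubini_kern (F : R * R -> R) (C a b c t : R) : 0 < a -> 0 < b -> 0 < c ->
  measurable_fun [set: R * R] F ->
  (forall s r, `|F (s, r)| <= C * (kern a (t - s) * (kern b (s - r) * kern c r))) ->
  \int[mu]_s \int[mu]_r F (s, r) = \int[mu]_r \int[mu]_s F (s, r) /\
  mu.-integrable setT (EFin \o (fun r => \int[mu]_s F (s, r))).
Proof.
move=> a0 b0 c0 mF FC.
pose G s r := kern a (t - s) * (kern b (s - r) * kern c r).
have mG : measurable_fun [set: R * R] (fun z => C * G z.1 z.2).
  apply: measurable_funM => //; apply: measurable_funM.
    by apply: (measurableT_comp (measurable_kernB a t)).
  apply: measurable_funM; first exact: measurable_kernB2.
  exact: (measurableT_comp (measurable_kern c)).
have G0 s r : 0 <= G s r by rewrite !mulr_ge0 ?kern_ge0.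
have i1 s : (\int[mu]_r (`|C * G s r|)%:E = (`|C| * (kern a (t - s) * kern (b + c) s))%:E)%E.
  transitivity (\int[mu]_r ((`|C| * kern a (t - s))%:E * (kern b (s - r) * kern c r)%:E))%E.
    by apply: eq_integral => r _; rewrite -EFinM normrM (ger0_norm (G0 _ _)) mulrA.
  rewrite ge0_integralZ; [by rewrite conv_kern// -EFinM mulrA|exact: mconv| |].
  - by move=> r; rewrite mulr_ge0 ?kern_ge0.
  - by rewrite lee_fin mulr_ge0 ?kern_ge0.
have bc0 : 0 < b + c by rewrite addr_gt0.
have i2 : (\int[mu]_s (`|C| * (kern a (t - s) * kern (b + c) s))%:E < +oo)%E.
  rewrite (_ : (\int[mu]_s _) = (`|C| * kern (a + (b + c)) t)%:E)%E ?ltry//.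
  transitivity (\int[mu]_s (`|C|%:E * (kern a (t - s) * kern (b + c) s)%:E))%E.
    by apply: eq_integral => s _; rewrite -EFinM.
  rewrite ge0_integralZ; [by rewrite conv_kern// -EFinM|exact: mconv| |by rewrite lee_fin].
  by move=> r; rewrite mulr_ge0 ?kern_ge0.
have mF1 s : measurable_fun [set: R] (fun r => F (s, r)).
  exact: (measurableT_comp mF).
have mF2 r : measurable_fun [set: R] (fun s => F (s, r)).
  exact: (measurableT_comp mF).
have iF : (mu \x mu)%E.-integrable setT (EFin \o F).
  have iG : (mu \x mu)%E.-integrable setT (EFin \o (fun z : R * R => C * G z.1 z.2)).
    apply/integrable12ltyP; first by apply/measurable_EFinP; exact: mG.
    apply: le_lt_trans i2; rewrite le_eqVlt; apply/orP; left; apply/eqP/eq_integral => s _; exact: i1.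
  apply: (le_integrable _ _ _ iG) => //.
  - by apply/measurable_EFinP; exact: mF.
  - by move=> [s r] _ /=; rewrite lee_fin (le_trans (FC s r))// ler_norm.
have iF1 s : mu.-integrable setT (EFin \o (fun r => F (s, r))).
  have iG : mu.-integrable setT (EFin \o (fun r : R => C * G s r)).
    apply/integrableP; split; first by apply/measurable_EFinP/measurable_funM => //; apply: measurable_funM => //; exact: mconv.
    by rewrite [X in (X < _)%E]i1 ltry.
  have bd (r : R) : `|F (s, r)| <= `|C * G s r| by rewrite (le_trans (FC s r))// ler_norm.
  apply: (le_integrable _ _ _ iG) => //.
  - by apply/measurable_EFinP; exact: mF1.
  - by move=> r _ /=; rewrite lee_fin; exact: bd.
have bd2 (r s : R) : `|F (s, r)| <= `|C * kern c r * (kern a (t - s) * kern b (s - r))|.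
  rewrite (le_trans (FC s r))// (le_trans (ler_norm _))//.
  by move: (kern a _) (kern b _) (kern c _) => A B D; rewrite -mulrA (mulrCA D) (mulrC D).
have iG2 (r : R) : mu.-integrable setT (EFin \o (fun s : R => C * kern c r * (kern a (t - s) * kern b (s - r)))).
  have [iG _] := conv_kern_shift t r a0 b0.
  exact: (integrableZl measurableT (C * kern c r) iG).
have iF2 r : mu.-integrable setT (EFin \o (fun s => F (s, r))).
  apply: (le_integrable _ _ _ (iG2 r)) => //.
  - by apply/measurable_EFinP; exact: mF2.
  - by move=> s _ /=; rewrite lee_fin; exact: bd2.
have E (r : R) : (\int[mu]_s F (s, r))%:E = (\int[mu]_s (F (s, r))%:E)%E.
  by rewrite fineK//; exact: integrable_fin_num (iF2 r).
split; last first.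
  have iH : mu.-integrable setT (EFin \o (fun r : R => C * (kern (a + b) (t - r) * kern c r))).
    exact: (integrableZl measurableT C (integrable_conv_kern t (addr_gt0 a0 b0) c0)).
  have bd (r : R) : `|\int[mu]_s F (s, r)| <= `|C * (kern (a + b) (t - r) * kern c r)|.
    apply: (le_trans (le_normr_Rintegral measurableT (iF2 r))).
    have [iG vG] := conv_kern_shift t r a0 b0.
    have -> : `|C * (kern (a + b) (t - r) * kern c r)| =
        \int[mu]_s `|C * kern c r * (kern a (t - s) * kern b (s - r))|.
      transitivity (\int[mu]_s (`|C * kern c r| * (kern a (t - s) * kern b (s - r)))).
        rewrite RintegralZl// vG !normrM (ger0_norm (kern_ge0 _ c0)).
        by rewrite (ger0_norm (kern_ge0 _ (addr_gt0 a0 b0))) mulrAC mulrA.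
      apply: eq_Rintegral => s _; rewrite [RHS]normrM; congr (_ * _).
      by rewrite ger0_norm// mulr_ge0 ?kern_ge0.
    apply: le_Rintegral => //; [exact: integrable_norm (iF2 r)|exact: integrable_norm (iG2 r)].
  apply: (le_integrable _ _ _ iH) => //; last by move=> r _ /=; rewrite lee_fin; exact: bd.
  have := measurable_fubini_G iF; apply: eq_measurable_fun => r _ /=.
  by rewrite E.
have FU := Fubini iF.
transitivity (fine (\int[mu]_s \int[mu]_r (F (s, r))%:E)%E).
  congr fine; apply: eq_integral => s _; rewrite fineK//.
  exact: integrable_fin_num (iF1 s).
by rewrite FU; congr fine; apply: eq_integral => r _; rewrite E.
Qed.
End kern.

(** * Real-valued integrals over the line and their dependence on a parameter *)

Notation Rintegrable f := (lebesgue_measure.-integrable setT (EFin \o f)).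

Section Rintegrable.
Variable R : realType.
Notation mu := (@lebesgue_measure R).
Implicit Types f g : R -> R.

Lemma Rintegrable_le f g : measurable_fun [set: R] f ->
  (forall x, `|f x| <= g x) -> Rintegrable g -> Rintegrable f.
Proof.
move=> mf fg ig.
have bd (x : R) : `|f x| <= `|g x| by rewrite (le_trans (fg x))// ler_norm.
apply: (le_integrable measurableT _ _ ig).
- by apply/measurable_EFinP; exact: mf.
- by move=> x _ /=; rewrite lee_fin; exact: bd.
Qed.

Lemma RintegrableZl (k : R) f : Rintegrable f -> Rintegrable (fun x => k * f x).
Proof. by move=> fi; exact: (integrableZl measurableT k fi). Qed.

Lemma Rintegrable_ext f g : f =1 g -> Rintegrable f -> Rintegrable g.
Proof. by move=> /funext ->. Qed.

Lemma RintegralTZl (k : R) f : Rintegrable f -> \int[mu]_x (k * f x) = k * \int[mu]_x f x.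
Proof. by move=> fi; rewrite RintegralZl. Qed.

Lemma RintegralTD f g : Rintegrable f -> Rintegrable g ->
  \int[mu]_x (f x + g x) = \int[mu]_x f x + \int[mu]_x g x.
Proof. by move=> fi gi; rewrite RintegralD. Qed.

Lemma Rintegral_norm_le f g : Rintegrable f -> Rintegrable g ->
  (forall x, `|f x| <= g x) -> `|\int[mu]_x f x| <= \int[mu]_x g x.
Proof.
move=> fi gi fg; apply: (le_trans (le_normr_Rintegral measurableT fi)).
by apply: le_Rintegral => //; exact: integrable_norm fi.
Qed.

Lemma eq_RintegralT f g : f =1 g -> \int[mu]_x f x = \int[mu]_x g x.
Proof. by move=> fg; apply: eq_Rintegral => x _; exact: fg. Qed.

(** Dominated convergence on ]t0 - 1, t0 + 1[. The bound on H is only required where K does not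
    vanish: in the applications K lives on ]0, 1[ and H may be unbounded elsewhere. *)
Lemma continuous_Rintegral_param (K : R -> R) (H : R -> R -> R) : Rintegrable K ->
  (forall s, continuous (H ^~ s)) -> (forall t, measurable_fun [set: R] (H t)) ->
  (forall A : R, exists M : R, forall t s : R, `|t| <= A -> K s != 0 -> `|H t s| <= M) ->
  continuous (fun t => \int[mu]_s (K s * H t s)).
Proof.
move=> iK cH mH bH t0.
have mK : measurable_fun [set: R] K by apply/measurable_EFinP; exact: measurable_int iK.
have [M HM] := bH (`|t0| + 1).
have iMK := RintegrableZl `|M| (integrable_norm iK).
have bd (t s : R) : t \in `](t0 - 1), (t0 + 1)[ -> `|K s * H t s| <= `|M| * `|K s|.
  rewrite in_itv/= => /andP[t1 t2].
  have [->|K0] := eqVneq (K s) 0; first by rewrite mul0r normr0 mulr0.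
  rewrite normrM mulrC ler_wpM2r// (le_trans _ (ler_norm M))// HM//.
  rewrite ler_norml; apply/andP; split.
    by have := ler_norm (- t0); rewrite normrN; lra.
  by have := ler_norm t0; lra.
apply: (@continuity_under_integral R _ _ mu (fun t s => K s * H t s) setT measurableT
   (t0 - 1) (t0 + 1) _ _ (fun s => `|M| * `|K s|) iMK).
- move=> t /= t1; apply: (Rintegrable_le _ _ iMK) => [|s]; last exact: bd.
  by apply: measurable_funM; [exact: mK|exact: mH].
- by apply: aeW => s _ t _; apply: cvgM; [exact: cvg_cst|exact: cH].
- by move=> t /= t1; apply: aeW => s _; exact: bd.
- by rewrite inE/= in_itv/=; apply/andP; split; lra.
Qed.

(** The absolute value yields an extension of t^p that is continuous across 0, so that weights can
    be multiplied with functions continuous on the whole line. *)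
Lemma continuous_norm_powR (p : R) : 0 <= p -> continuous (fun t : R => `|t| `^ p).
Proof.
rewrite le_eqVlt => /predU1P[<-|p0] t.
  by under eq_fun do rewrite powRr0; exact: cvg_cst.
have [->|t0] := eqVneq t 0; last first.
  have tp : 0 < `|t| by rewrite normr_gt0.
  apply: (@continuous_comp _ _ _ (fun t : R => `|t|) (fun u => u `^ p)).
    exact: norm_continuous.
  exact: continuous_powR_gt0.
apply/cvgrPdist_le => /= e e0; near=> s.
rewrite normr0 powR0 ?gt_eqF// sub0r normrN ger0_norm ?powR_ge0//.
have -> : e = (e `^ p^-1) `^ p by rewrite -powRrM mulVf ?gt_eqF// powRr1// ltW.
apply: ge0_ler_powR; rewrite ?nnegrE ?powR_ge0//; first exact: ltW.
near: s; apply/nbhs_normP; exists (e `^ p^-1) => /=; first exact: powR_gt0.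
by move=> s /=; rewrite sub0r normrN => /ltW.
Unshelve. all: by end_near. Qed.

Lemma continuous_bounded (g : R -> R) : continuous g ->
  forall A, exists2 M, 0 <= M & forall t, `|t| <= A -> `|g t| <= M.
Proof.
move=> cg A; have [A0|A0] := ltP A 0.
  by exists 0 => // t; rewrite leNgt (lt_le_trans A0).
have cn : {within `[- A, A], continuous (fun x => `|g x|)}.
  by apply: continuous_subspaceT => x; apply: cvg_norm; exact: cg.
have [c _ Hc] := @EVT_max R (fun x => `|g x|) (- A) A ltac:(lra) cn.
exists `|g c| => // t; rewrite ler_norml => tA.
by apply: Hc; rewrite in_itv.
Qed.
End Rintegrable.

(** * Riemann-Liouville integrals of functions that are O(t^(-c)) at 0 *)

Definition pospart (R : realType) (f : R -> R) (x : R) : R := if 0 < x then f x else 0.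

(* C_c on the whole half-line, f being arbitrary on (-oo, 0] *)
Definition Cg (R : realType) (c : R) (f : R -> R) : Prop :=
  exists2 g : R -> R, continuous g & forall t, 0 < t -> f t = t `^ (- c) * g t.

(* RLint for a > 0, as a convolution over R, so that affine substitutions and
   the integrals of the kernels over R apply directly *)
Definition RL (R : realType) (a : R) (f : R -> R) (t : R) : R :=
  \int[lebesgue_measure]_s (kern a (t - s) * pospart f s).

Section Cg.
Variable R : realType.
Notation mu := (@lebesgue_measure R).
Implicit Types (f g h : R -> R) (a b c k p s t S : R).

Lemma gt0_powRD s p k : 0 < s -> s `^ (p + k) = s `^ p * s `^ k.
Proof. by move=> s0; rewrite powRD// [s == 0]gt_eqF// implybT. Qed.

Lemma Cg_ext c f g : (forall t, 0 < t -> f t = g t) -> Cg c f -> Cg c g.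
Proof. by move=> fg [u cu fu]; exists u => // t t0; rewrite -fg// fu. Qed.

Lemma CgD c f g : Cg c f -> Cg c g -> Cg c (fun t => f t + g t).
Proof.
move=> [u cu fu] [v cv gv]; exists (fun t => u t + v t).
  by move=> x; apply: cvgD; [exact: cu|exact: cv].
by move=> t t0; rewrite fu// gv// mulrDr.
Qed.

Lemma CgM c h f : continuous h -> Cg c f -> Cg c (fun t => h t * f t).
Proof.
move=> ch [u cu fu]; exists (fun t => h t * u t).
  by move=> x; apply: cvgM; [exact: ch|exact: cu].
by move=> t t0; rewrite fu// mulrCA.
Qed.

Lemma CgZ c k f : Cg c f -> Cg c (fun t => k * f t).
Proof. by apply: CgM => x; exact: cvg_cst. Qed.

Lemma Cg0 c : Cg c (fun=> 0).
Proof. by exists (fun=> 0) => [x|t _]; [exact: cvg_cst|rewrite mulr0]. Qed.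

Lemma Cg_sum c (I : Type) (r : seq I) (P : pred I) (F : I -> R -> R) :
  (forall i, P i -> Cg c (F i)) -> Cg c (fun t => \sum_(i <- r | P i) F i t).
Proof.
move=> H; elim: r => [|i r IH].
  by apply: (Cg_ext _ (Cg0 c)) => t _; rewrite big_nil.
have [Pi|Pi] := boolP (P i).
  apply: (Cg_ext _ (CgD (H i Pi) IH)) => t _; rewrite big_cons Pi//.
by apply: (Cg_ext _ IH) => t _; rewrite big_cons (negbTE Pi).
Qed.

Lemma Cg_continuous f : continuous f -> Cg 0 f.
Proof. by move=> cf; exists f => // t t0; rewrite oppr0 powRr0 mul1r. Qed.

Lemma Cg_powR c p f : 0 <= p + c -> Cg 0 f -> Cg c (fun t => t `^ p * f t).
Proof.
move=> pc [u cu fu].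
apply: (Cg_ext (f := fun t => t `^ (- c) * (t `^ (p + c) * u t))).
  move=> t t0; rewrite fu// oppr0 powRr0 mul1r mulrA -gt0_powRD//.
  by rewrite addrC addrK.
exists (fun t => `|t| `^ (p + c) * u t).
  by move=> x; apply: cvgM; [exact: continuous_norm_powR|exact: cu].
by move=> t t0; rewrite gtr0_norm.
Qed.

Lemma Cg_le c c' f : c <= c' -> Cg c f -> Cg c' f.
Proof.
move=> cc' [u cu fu].
apply: (Cg_ext (f := fun t => t `^ (- c) * u t)) => [t t0|]; first by rewrite fu.
apply: Cg_powR; first by lra.
exact: Cg_continuous.
Qed.

Lemma Cg_continuous_at c f t : Cg c f -> 0 < t -> {for t, continuous f}.
Proof.
move=> [u cu fu] t0.
have H : {for t, continuous (fun t => t `^ (- c) * u t)}.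
  by apply: cvgM; [exact: continuous_powR_gt0|exact: cu].
rewrite /prop_for /continuous_at fu//; apply: cvg_trans H; apply: near_eq_cvg.
by near=> s; rewrite fu//; near: s; exact: lt_nbhsr.
Unshelve. all: by end_near. Qed.

Lemma measurable_pospart c f : Cg c f -> measurable_fun [set: R] (pospart f).
Proof.
move=> [u cu fu].
rewrite (_ : pospart f = fun x => if 0 < x then x `^ (- c) * u x else 0); last first.
  by apply/funext => x; rewrite /pospart; case: ifPn => // x0; rewrite fu.
apply: measurable_fun_ifT => //=.
- exact: measurable_fun_ltr.
- by apply: measurable_funM; [exact: measurable_powR|exact: continuous_measurable_fun].
Qed.

Lemma Cg_bound c f : Cg c f -> forall S, exists2 M, 0 <= M &
  forall s, 0 < s <= S -> `|f s| <= M * s `^ (- c).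
Proof.
move=> [u cu fu] S; have [M M0 HM] := continuous_bounded cu S.
exists M => // s /andP[s0 sS]; rewrite fu// normrM ger0_norm ?powR_ge0// mulrC.
by rewrite ler_wpM2r ?powR_ge0// HM// gtr0_norm.
Qed.

(** Turning the weight into a kernel lets weighted bounds be integrated by [Rconv_kern]. *)
Lemma kern_powRN c s : 0 < s -> c < 1 -> s `^ (- c) = Gamma (1 - c) * kern (1 - c) s.
Proof.
move=> s0 c1; rewrite kern_gt0// mulrC divfK ?gt_eqF ?Gamma_gt0 ?subr_gt0//.
by congr (_ `^ _); ring.
Qed.

Lemma pospart_bound c f : c < 1 -> Cg c f -> forall S, exists2 M, 0 <= M &
  forall s, s <= S -> `|pospart f s| <= M * kern (1 - c) s.
Proof.
move=> c1 Cf S; have [M M0 HM] := Cg_bound Cf S.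
have G0 : 0 < Gamma (1 - c) by rewrite Gamma_gt0// subr_gt0.
exists (M * Gamma (1 - c)) => [|s sS]; first by rewrite mulr_ge0// ltW.
rewrite /pospart; case: ifPn => s0; last by rewrite normr0 kern_le0 ?mulr0// leNgt.
by rewrite -mulrA -kern_powRN// HM// s0.
Qed.

Lemma RL_bound_aux (a c : R) f : c < 1 -> Cg c f -> 0 < a -> forall t, exists2 M, 0 <= M &
  forall s, `|kern a (t - s) * pospart f s| <= M * (kern a (t - s) * kern (1 - c) s).
Proof.
move=> c1 Cf a0 t; have [M M0 HM] := pospart_bound c1 Cf t; exists M => // s.
have [st|st] := leP s t; last by rewrite kern_le0 ?mul0r ?normr0 ?mulr0// subr_le0 ltW.
rewrite normrM ger0_norm ?kern_ge0// [leRHS]mulrCA; apply: ler_wpM2l; first exact: kern_ge0.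
exact: HM.
Qed.

Lemma measurable_RL_integrand a c f t : Cg c f ->
  measurable_fun [set: R] (fun s => kern a (t - s) * pospart f s).
Proof.
by move=> Cf; apply: measurable_funM; [exact: measurable_kernB|exact: measurable_pospart Cf].
Qed.

Lemma Rintegrable_RL a c f t : c < 1 -> Cg c f -> 0 < a ->
  Rintegrable (fun s => kern a (t - s) * pospart f s).
Proof.
move=> c1 Cf a0; have [M M0 HM] := RL_bound_aux c1 Cf a0 t.
apply: (Rintegrable_le (measurable_RL_integrand a t Cf) HM).
by apply: RintegrableZl; apply: integrable_conv_kern => //; rewrite subr_gt0.
Qed.

Lemma RL_le0 a f t : t <= 0 -> RL a f t = 0.
Proof.
move=> t0; rewrite /RL; rewrite (@eq_RintegralT _ _ (fun=> 0)).
  by rewrite Rintegral_cst// mul0r.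
move=> s; rewrite /pospart; case: ifPn => s0; rewrite ?mulr0//.
by rewrite kern_le0 ?mul0r//; lra.
Qed.

Lemma eq_RL a f g t : (forall s, 0 < s < t -> f s = g s) -> RL a f t = RL a g t.
Proof.
move=> fg; apply: eq_RintegralT => s.
have [st|st] := leP t s; first by rewrite kern_le0 ?mul0r// subr_le0.
by rewrite /pospart; case: ifPn => // s0; rewrite fg// s0.
Qed.

(** The endpoints are negligible, so f only has to agree with a function of [Cg c] on ]0, t[;
    measurability of f there is inherited from g. Functions known on part of the line only are
    handled through this. *)
Lemma RLintE a c f g t : 0 < a -> c < 1 -> Cg c g ->
  (forall s, 0 < s < t -> f s = g s) -> RLint a f t = RL a g t.
Proof.
move=> a0 c1 Cg_g fg; rewrite /RLint gt_eqF//.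
have G0 := Gamma_gt0 a0.
pose k s := (t - s) `^ (a - 1) * f s.
have ik : Rintegrable (fun s => Gamma a * (kern a (t - s) * pospart g s)).
  by apply: RintegrableZl; exact: Rintegrable_RL c1 Cg_g a0.
have kE s : `]0, t[%classic s -> k s = Gamma a * (kern a (t - s) * pospart g s).
  rewrite /= in_itv/= => /andP[s0 st]; rewrite /pospart s0 kern_gt0 ?subr_gt0// mulrA mulrC.
  by rewrite (mulrC (Gamma a)) divfK ?gt_eqF// mulrC /k fg// s0.
have mk : measurable_fun `]0, t[ (EFin \o k).
  apply: (eq_measurable_fun (EFin \o (fun s => Gamma a * (kern a (t - s) * pospart g s)))).
    by move=> s; rewrite inE => /kE /= ->.
  by apply: measurable_funTS; exact: measurable_int ik.
have -> : \int[mu]_(s in `[0, t]) k s = \int[mu]_(s in `]0, t[) k s.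
  by rewrite /Rintegral integral_itv_bndoo.
have -> : \int[mu]_(s in `]0, t[) k s = \int[mu]_s (Gamma a * (kern a (t - s) * pospart g s)).
  rewrite Rintegral_mkcond; apply: eq_RintegralT => s; rewrite patchE.
  case: ifPn => [|]; rewrite ?inE ?notin_setE => h; first exact: kE.
  move: h; rewrite /= in_itv/= => /negP; rewrite negb_and -!leNgt => /orP[s0|st].
    by rewrite /pospart ltNge s0/= !mulr0.
  by rewrite kern_le0 ?mul0r ?mulr0// subr_le0.
rewrite RintegralTZl; last exact: Rintegrable_RL c1 Cg_g a0.
by rewrite mulKf// gt_eqF.
Qed.

Lemma RLD a c f g t : 0 < a -> c < 1 -> Cg c f -> Cg c g ->
  RL a (fun s => f s + g s) t = RL a f t + RL a g t.
Proof.
move=> a0 c1 Cf Cg_g; rewrite /RL -RintegralTD; [|exact: Rintegrable_RL c1 Cf a0|exact: Rintegrable_RL c1 Cg_g a0].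
by apply: eq_RintegralT => s; rewrite /pospart; case: ifP; rewrite ?mulrDr// mulr0 addr0.
Qed.

Lemma RLZ a c k f t : 0 < a -> c < 1 -> Cg c f -> RL a (fun s => k * f s) t = k * RL a f t.
Proof.
move=> a0 c1 Cf; rewrite /RL -RintegralTZl; last exact: Rintegrable_RL c1 Cf a0.
by apply: eq_RintegralT => s; rewrite /pospart; case: ifP; rewrite ?mulr0// mulrCA.
Qed.

Lemma RL0 a t : RL a (fun=> 0) t = 0.
Proof.
rewrite /RL (@eq_RintegralT _ _ (fun=> 0)); first by rewrite Rintegral_cst// mul0r.
by move=> s; rewrite /pospart if_same mulr0.
Qed.

Lemma RL_sum a c (I : Type) (r : seq I) (F : I -> R -> R) t : 0 < a -> c < 1 ->
  (forall i, Cg c (F i)) -> RL a (fun s => \sum_(i <- r) F i s) t = \sum_(i <- r) RL a (F i) t.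
Proof.
move=> a0 c1 H; elim: r => [|i r IH].
  by rewrite big_nil -[RHS](RL0 a t); apply: eq_RL => s _; rewrite big_nil.
rewrite big_cons -IH -(RLD t a0 c1 (H i)); last by apply: Cg_sum => j _; exact: H.
by apply: eq_RL => s _; rewrite big_cons.
Qed.

(** After Fubini the integral in s is a translate of the convolution of two kernels. *)
Lemma RL_semigroup a b c f t : 0 < a -> 0 < b -> c < 1 -> Cg c f ->
  RL a (RL b f) t = RL (a + b) f t.
Proof.
move=> a0 b0 c1 Cf.
have pp : pospart (RL b f) = RL b f.
  apply/funext => s; rewrite /pospart; case: ifPn => // s0; rewrite RL_le0//.
  by rewrite leNgt.
have c10 : 0 < 1 - c by rewrite subr_gt0.
rewrite {1}/RL pp.
pose F (z : R * R) := kern a (t - z.1) * (kern b (z.1 - z.2) * pospart f z.2).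
transitivity (\int[mu]_s \int[mu]_r F (s, r)).
  by apply: eq_RintegralT => s; rewrite /RL -RintegralTZl//; exact: Rintegrable_RL c1 Cf b0.
have [M M0 HM] := pospart_bound c1 Cf t.
have [||-> _] := @fubini_kern R F M a b (1 - c) t a0 b0 c10.
- apply: measurable_funM.
    exact: (measurableT_comp (measurable_kernB a t)).
  apply: measurable_funM; first exact: measurable_kernB2.
  exact: (measurableT_comp (measurable_pospart Cf)).
- move=> s r; rewrite /F/=.
  (* The bound on f holds up to t only; for r > t one of the two kernels vanishes, according to the
     position of s with respect to t. *)
  have [rt|rt] := leP r t.
    rewrite !normrM !(ger0_norm (kern_ge0 _ _))// [leRHS]mulrCA; apply: ler_wpM2l; first exact: kern_ge0.
    by rewrite [leRHS]mulrCA; apply: ler_wpM2l; [exact: kern_ge0|exact: HM].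
  have [st|st] := leP s t.
    by rewrite (@kern_le0 _ b (s - r)) ?mul0r ?mulr0 ?normr0//; lra.
  by rewrite (@kern_le0 _ a (t - s)) ?mul0r ?mulr0 ?normr0//; lra.
apply: eq_RintegralT => r; rewrite /F/=.
transitivity (\int[mu]_s (pospart f r * (kern a (t - s) * kern b (s - r)))).
  apply: eq_RintegralT => s; move: (kern a _) (kern b _) (pospart f r) => A B D.
  by rewrite mulrA mulrC.
have [i2 v2] := conv_kern_shift t r a0 b0.
by rewrite RintegralTZl// v2 mulrC.
Qed.

(** I^b f behaves like t^(b - c) at 0. Regularity of fractional integrals is read off this form: the
    weight c always persists, it drops to 0 if c <= b, and continuity on the line holds if c < b. *)
Lemma RL_regular b c f : 0 < b -> c < 1 -> Cg c f ->
  exists2 G : R -> R, continuous G & forall t, 0 < t -> RL b f t = t `^ (b - c) * G t.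
Proof.
move=> b0 c1 [u cu fu]; have c10 : 0 < 1 - c by rewrite subr_gt0.
pose K s := kern b (1 - s) * kern (1 - c) s.
have iK : Rintegrable K by exact: integrable_conv_kern.
(* substitution s := t * s in the integral *)
exists (fun t => Gamma (1 - c) * \int[mu]_s (K s * u (t * s))).
  suff cI : continuous (fun t : R => \int[mu]_s (K s * u (t * s))).
    by move=> t; apply: cvgM; [exact: cvg_cst|exact: cI].
  apply: (@continuous_Rintegral_param _ K (fun t s => u (t * s))) => //.
  - move=> s t; apply: (@continuous_comp _ _ _ (fun t : R => t * s) u); last exact: cu.
    by apply: cvgM; [exact: cvg_id|exact: cvg_cst].
  - move=> t; apply: (measurableT_comp (continuous_measurable_fun cu)).
    by apply: measurable_funM.
  - move=> A; have [M M0 HM] := continuous_bounded cu A; exists M => t s tA Ks.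
    apply: HM; rewrite normrM.
    have s0 : 0 < s by rewrite ltNge; apply/negP => s0; rewrite /K (@kern_le0 _ (1 - c) s)// mulr0 eqxx in Ks.
    have s1 : s < 1 by rewrite ltNge; apply/negP => s1; rewrite /K (@kern_le0 _ b (1 - s)) ?subr_le0// mul0r eqxx in Ks.
    by apply: le_trans tA; rewrite ler_piMr// gtr0_norm// ltW.
move=> t t0; have t0' : t != 0 by rewrite gt_eqF.
have Cf : Cg c f by exists u.
rewrite /RL (@Rintegral_affine R t 0 t0' _ (Rintegrable_RL t c1 Cf b0)) gtr0_norm//.
have E (s : R) : kern b (t - (t * s + 0)) * pospart f (t * s + 0) =
    (t `^ (b - c - 1) * Gamma (1 - c)) * (K s * u (t * s)).
  rewrite addr0 (_ : t - t * s = t * (1 - s)); last by rewrite mulrBr mulr1.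
  rewrite kernM// /K /pospart pmulr_rgt0//; case: ifPn => s0; last first.
    by rewrite (@kern_le0 _ (1 - c) s) ?leNgt// !(mulr0, mul0r).
  rewrite fu ?mulr_gt0// powRM ?ltW// (kern_powRN s0 c1).
  rewrite (_ : b - c - 1 = (b - 1) + (- c)); last by ring.
  rewrite (gt0_powRD (b - 1) (- c) t0); move: (t `^ _) (t `^ _) (kern _ _) (kern _ _) (u _) (Gamma _) => A B C D X Y.
  by ring.
have k0 : t `^ (b - c - 1) * Gamma (1 - c) != 0.
  by rewrite mulf_neq0 ?gt_eqF ?powR_gt0 ?Gamma_gt0.
have iKu : Rintegrable (fun s : R => K s * u (t * s)).
  have /(RintegrableZl ((t `^ (b - c - 1) * Gamma (1 - c))^-1)) :=
    @integrable_affine R t 0 t0' _ (Rintegrable_RL t c1 Cf b0).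
  by apply: Rintegrable_ext => s; rewrite E mulKf.
rewrite (eq_RintegralT E) RintegralTZl// !mulrA; congr (_ * _ * _).
by rewrite -[X in X * _](powRr1 (ltW t0)) -gt0_powRD//; congr (_ `^ _); ring.
Qed.
End Cg.

(** * Continuity of fractional integrals, the fundamental theorem of calculus and injectivity *)

Section FTC.
Variable R : realType.
Notation mu := (@lebesgue_measure R).
Implicit Types (f g h : R -> R) (a b c k p s t S : R).

Lemma RL_Cg b c f : 0 < b -> c < 1 -> Cg c f -> Cg c (RL b f).
Proof.
move=> b0 c1 Cf; have [G cG RG] := RL_regular b0 c1 Cf.
apply: (Cg_ext (f := fun t => t `^ (b - c) * G t)) => [t t0|]; first by rewrite RG.
by apply: Cg_powR; [lra|exact: Cg_continuous].
Qed.

Lemma RL_Cg0 b c f : 0 < b -> c < 1 -> c <= b -> Cg c f -> Cg 0 (RL b f).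
Proof.
move=> b0 c1 cb Cf; have [G cG RG] := RL_regular b0 c1 Cf.
apply: (Cg_ext (f := fun t => t `^ (b - c) * G t)) => [t t0|]; first by rewrite RG.
by apply: Cg_powR; [lra|exact: Cg_continuous].
Qed.

Lemma RL_continuous b c f : 0 < b -> c < 1 -> c < b -> Cg c f -> continuous (RL b f).
Proof.
move=> b0 c1 cb Cf; have [G cG RG] := RL_regular b0 c1 Cf.
(* Truncation at 0 covers the negative half-line too: t^(b - c) vanishes at 0 because c < b. *)
have -> : RL b f = fun t => `|Num.max t 0| `^ (b - c) * G t.
  apply/funext => t; have [t0|t0] := ltP 0 t.
    by rewrite RG// gtr0_norm.
  by rewrite RL_le0// normr0 powR0 ?mul0r// gt_eqF ?subr_gt0.
move=> t; apply: cvgM; last exact: cG.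
apply: (@continuous_comp _ _ _ (fun t : R => Num.max t 0) (fun u => `|u| `^ (b - c))).
  by apply: continuous_max; [exact: cvg_id|exact: cvg_cst].
by apply: continuous_norm_powR; rewrite subr_ge0 ltW.
Qed.

(** The integrand of I^1 at S + 1 is already known to be integrable, and its kernel equals 1 on
    [0, S]. At S itself the kernel would vanish at the right endpoint. *)
Lemma Rintegrable_pospart c f S : c < 1 -> Cg c f ->
  mu.-integrable `[0, S] (EFin \o pospart f).
Proof.
move=> c1 Cf.
have H := Rintegrable_RL (S + 1) c1 Cf ltr01.
have H2 : mu.-integrable `[0, S] (EFin \o (fun s => kern 1 (S + 1 - s) * pospart f s)).
  exact: (integrableS measurableT _ _ H).
apply: eq_integrable H2 => // s; rewrite inE/= in_itv/= => /andP[s0 sS].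
by rewrite kern1 ?mul1r//; lra.
Qed.

Lemma RL1E c f t : c < 1 -> Cg c f -> RL 1 f t = \int[mu]_(s in `[0, t]) pospart f s.
Proof.
move=> c1 Cf.
have -> : \int[mu]_(s in `[0, t]) pospart f s = \int[mu]_(s in `]0, t[) pospart f s.
  rewrite /Rintegral integral_itv_bndoo//; apply: measurable_funTS.
  by apply/measurable_EFinP; exact: measurable_pospart Cf.
rewrite Rintegral_mkcond; apply: eq_RintegralT => s; rewrite patchE.
case: ifPn => [|]; rewrite ?inE ?notin_setE /= in_itv/= => h.
  by move/andP: h => [s0 st]; rewrite kern1 ?mul1r// subr_gt0.
move/negP: h; rewrite negb_and -!leNgt => /orP[s0|st].
  by rewrite /pospart ltNge s0/= mulr0.
by rewrite kern_le0 ?mul0r// subr_le0.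
Qed.

Lemma RL1_derive c f t : c < 1 -> Cg c f -> 0 < t -> is_derive t 1 (RL 1 f) (f t).
Proof.
move=> c1 Cf t0.
have E : RL 1 f = fun t => \int[mu]_(s in `[0, t]) pospart f s.
  by apply/funext => s; exact: RL1E c1 Cf.
have pt : pospart f t = f t by rewrite /pospart t0.
have cp : {for t, continuous (pospart f)}.
  rewrite /prop_for /continuous_at pt; apply: cvg_trans (Cg_continuous_at Cf t0).
  apply: near_eq_cvg; near=> s; rewrite /pospart ifT//.
  by near: s; exact: lt_nbhsr.
have tt : t < t + 1 by rewrite ltrDl.
have [d dE] := continuous_FTC1_closed tt (Rintegrable_pospart (t + 1) c1 Cf) t0 cp.
rewrite E; apply: DeriveDef => //.
by rewrite -derive1E dE.
Unshelve. all: by end_near. Qed.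

Lemma is_derive_eq0_near (f : R -> R) t (d : R) :
  is_derive t 1 f d -> (\forall s \near t, f s = 0) -> d = 0.
Proof.
move=> df f0; rewrite -(@derive_val _ _ _ _ _ _ _ df).
rewrite -(@near_eq_derive _ _ _ (cst 0) f t 1).
  by rewrite derive_cst.
by apply: filterS f0 => s ->.
Qed.

Lemma RL1_inj c f g S : c < 1 -> Cg c f -> Cg c g ->
  (forall t, 0 < t < S -> RL 1 f t = RL 1 g t) -> forall t, 0 < t < S -> f t = g t.
Proof.
move=> c1 Cf Cg_g fg t /andP[t0 tS].
have Ch : Cg c (fun s => f s + (-1) * g s) by apply: CgD => //; exact: CgZ.
apply/eqP; rewrite -subr_eq0; apply/eqP; rewrite -mulN1r.
apply: (is_derive_eq0_near (RL1_derive c1 Ch t0)); near=> s.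
rewrite (RLD s ltr01 c1 Cf (CgZ (-1) Cg_g)) (RLZ (-1) s ltr01 c1 Cg_g) fg ?mulN1r ?subrr//.
apply/andP; split; near: s; [exact: lt_nbhsr|exact: lt_nbhsl].
Unshelve. all: by end_near. Qed.

(** Composition with I^(1 - b) reduces to I^1, which is undone by differentiation. *)
Lemma RL_inj b c f g S : 0 < b < 1 -> c < 1 -> Cg c f -> Cg c g ->
  (forall t, 0 < t < S -> RL b f t = RL b g t) -> forall t, 0 < t < S -> f t = g t.
Proof.
move=> /andP[b0 b1] c1 Cf Cg_g fg; apply: (RL1_inj c1 Cf Cg_g) => t /andP[t0 tS].
have b'0 : 0 < 1 - b by rewrite subr_gt0.
have <- : 1 - b + b = 1 by rewrite subrK.
rewrite -(RL_semigroup t b'0 b0 c1 Cf) -(RL_semigroup t b'0 b0 c1 Cg_g).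
apply: eq_RL => s /andP[s0 st].
by apply: fg; rewrite s0 (lt_trans st).
Qed.

(** The derivative may be unbounded at 0, so the mean value theorem is applied to f - I^1 df, which
    is continuous up to 0 and has zero derivative inside. *)
Lemma Cg_FTC c f df S : c < 1 -> Cg c df -> {within `[0, S], continuous f} ->
  (forall t, 0 < t < S -> is_derive t 1 f (df t)) ->
  forall t, 0 <= t <= S -> f t = f 0 + RL 1 df t.
Proof.
move=> c1 Cdf cf dfE t /andP[]; rewrite le_eqVlt => /predU1P[<-|t0] tS.
  by rewrite RL_le0// addr0.
have [] := @MVT R (fun s => f s - RL 1 df s) (fun s => df s - df s) 0 t t0.
- move=> s; rewrite in_itv/= => /andP[s0 st]; apply: is_deriveB.
    by apply: dfE; rewrite s0 (lt_le_trans st).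
  exact: RL1_derive c1 Cdf s0.
- have cR : continuous (RL 1 df) by exact: (RL_continuous ltr01 c1 c1 Cdf).
  move=> x; apply: cvgB; last exact: (continuous_subspaceT cR).
  apply: (continuous_subspaceW _ cf).
  by apply: subset_itvl; rewrite bnd_simp.
have := @RL_le0 _ 1 df 0 (lexx 0).
move: (RL 1 df 0) (RL 1 df t) => u v -> s _; rewrite (subrr (df s)) mul0r; lra.
Qed.

Lemma pospart_Phi p : pospart (Phi p) = kern p :> (R -> R).
Proof. by []. Qed.

Lemma RL_Phi b p t : 0 < b -> 0 < p -> RL b (Phi p) t = kern (b + p) t.
Proof. by move=> b0 p0; rewrite /RL pospart_Phi Rconv_kern. Qed.

Lemma Cg_Phi c p : 1 <= p + c -> Cg c (Phi p : R -> R).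
Proof.
move=> pc; rewrite /Phi.
apply: (Cg_powR (p := p - 1) (f := fun=> (Gamma p)^-1)); first lra.
by apply: Cg_continuous => x; exact: cvg_cst.
Qed.

(** A bound O(t^(-c)) does not give a limit of t^c f(t) at 0, but for any c' > c it forces t^c' f(t)
    to tend to 0. *)
Lemma Cg_gt_bound c c' f : (forall t, 0 < t -> {for t, continuous f}) -> c < c' ->
  (forall S, exists M, forall t, 0 < t <= S -> `|f t| <= M * t `^ (- c)) -> Cg c' f.
Proof.
move=> cf cc' bf.
exists (fun t => if 0 < t then t `^ c' * f t else 0).
  move=> t; have [t0|t0|->] := ltgtP t 0.
  - have tf : (0 < t) = false by apply/negbTE; rewrite -leNgt ltW.
    rewrite /continuous_at tf; apply: cvg_near_cst; near=> s.
    rewrite ifF//; apply/negbTE; rewrite -leNgt ltW//.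
    by near: s; exact: lt_nbhsl.
  - have H : {for t, continuous (fun t => t `^ c' * f t)}.
      by apply: cvgM; [exact: continuous_powR_gt0|exact: cf].
    rewrite /continuous_at t0; apply: cvg_trans H; apply: near_eq_cvg; near=> s.
    by rewrite ifT//; near: s; exact: lt_nbhsr.
  rewrite /continuous_at ltxx; have [M HM] := bf 1.
  apply: (@norm_cvg0 _ R); apply: (@squeeze_cvgr _ _ _ _ (cst 0) (fun t => `|M| * `|t| `^ (c' - c))).
  - near=> s; rewrite /= normr_ge0/=; case: ifPn => s0; last first.
      by rewrite normr0 mulr_ge0// powR_ge0.
    rewrite normrM ger0_norm ?powR_ge0// (gtr0_norm s0).
    rewrite (gt0_powRD _ _ s0) mulrCA; apply: ler_wpM2l; first exact: powR_ge0.
    apply: (@le_trans _ _ (M * s `^ (- c))).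
      apply: HM; rewrite s0/= ltW//; near: s; exact: lt_nbhsl.
    by rewrite ler_wpM2r ?powR_ge0// ler_norm.
  - exact: cvg_cst.
  - rewrite -[X in _ --> X](mulr0 `|M|); apply: cvgM; first exact: cvg_cst.
    have := @continuous_norm_powR R (c' - c) _ 0.
    by rewrite /continuous_at normr0 powR0 ?gt_eqF ?subr_gt0//; apply; rewrite subr_ge0 ltW.
by move=> t t0; rewrite t0 mulrA -gt0_powRD// addNr powRr0 mul1r.
Unshelve. all: by end_near. Qed.
End FTC.

(** * Exponentially weighted bounds *)

Definition wbound (R : realType) (c lam S K : R) (f : R -> R) : Prop :=
  forall t, 0 < t <= S -> `|f t| <= K * (t `^ (- c) * expR (lam * t)).

Section wbound.
Variable R : realType.
Notation mu := (@lebesgue_measure R).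
Implicit Types (f g h p q : R -> R) (a b c k t s S : R).

Lemma RL_norm_le a c f g t : 0 < a -> c < 1 -> Cg c f -> Cg c g ->
  (forall s, 0 < s < t -> `|f s| <= g s) -> `|RL a f t| <= RL a g t.
Proof.
move=> a0 c1 Cf Cg_g fg; apply: Rintegral_norm_le => [||s].
- exact: Rintegrable_RL c1 Cf a0.
- exact: Rintegrable_RL c1 Cg_g a0.
- have [st|st] := leP t s; first by rewrite (@kern_le0 _ _ (t - s)) ?subr_le0// !mul0r normr0.
  rewrite normrM ger0_norm ?kern_ge0//; apply: ler_wpM2l; first exact: kern_ge0.
  by rewrite /pospart; case: ifPn => s0; rewrite ?normr0// fg// s0.
Qed.

(** On ]0, t[ the factor e^(lam s) is replaced by e^(lam t), which leaves a multiple of Phi of order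
    1 - c to integrate. The constant neither gains nor loses in lam. *)
Lemma wbound_RL a c lam S K p t : 0 < a -> c < 1 -> Cg c p -> 0 <= lam -> 0 <= K ->
  wbound c lam S K p -> t <= S ->
  `|RL a p t| <= K * expR (lam * t) * (Gamma (1 - c) * kern (a + (1 - c)) t).
Proof.
move=> a0 c1 Cp lam0 K0 Hp tS; have c10 : 0 < 1 - c by rewrite subr_gt0.
have CP : Cg c (Phi (1 - c) : R -> R) by apply: Cg_Phi; rewrite subrK.
have CP2 := CgZ (K * expR (lam * t) * Gamma (1 - c)) CP.
rewrite mulrA -RL_Phi// -(RLZ _ _ a0 c1 CP).
apply: (RL_norm_le a0 c1 Cp CP2) => s /andP[s0 st].
have sS : 0 < s <= S by rewrite s0 ltW// (lt_le_trans st).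
apply: (le_trans (Hp s sS)); rewrite (kern_powRN s0 c1) /kern s0.
have P0 : 0 <= Gamma (1 - c) * Phi (1 - c) s.
  by rewrite mulr_ge0 ?divr_ge0 ?powR_ge0// ltW// Gamma_gt0.
move: (Gamma _) (Phi _ _) P0 => G P P0.
rewrite (_ : K * expR (lam * t) * G * P = K * (G * P * expR (lam * t))); last by ring.
apply: ler_wpM2l => //; apply: ler_wpM2l => //.
by rewrite ler_expR ler_wpM2l// ltW.
Qed.

Lemma RintegralT0 f : (forall x, f x = 0) -> \int[mu]_x f x = 0.
Proof. by move=> /funext ->; rewrite Rintegral_cst// mul0r. Qed.

Lemma RintegrableB f g : Rintegrable f -> Rintegrable g -> Rintegrable (fun x => f x - g x).
Proof. by move=> fi gi; exact: (integrableB measurableT fi gi). Qed.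

Lemma RintegralTB f g : Rintegrable f -> Rintegrable g ->
  \int[mu]_x (f x - g x) = \int[mu]_x f x - \int[mu]_x g x.
Proof. by move=> fi gi; rewrite RintegralB. Qed.
End wbound.

(** * Multiplication by a C^1_c function on the range of I^c *)

Section marchaud_fubini.
Variable R : realType.
Notation mu := (@lebesgue_measure R).
Implicit Types (r s t : R).

Lemma powRN_anti (c s r : R) : 0 <= c -> 0 < s -> s <= r -> r `^ (- c) <= s `^ (- c).
Proof.
move=> c0 s0 sr; have r0 := lt_le_trans s0 sr.
rewrite !powRN lef_pV2 ?posrE ?powR_gt0//.
by apply: ge0_ler_powR; rewrite ?nnegrE// ltW.
Qed.

#[local] Opaque kern Gamma RL.

Lemma kern_anti (c s r : R) : 0 <= c -> c < 1 -> 0 < s -> s <= r -> kern (1 - c) r <= kern (1 - c) s.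
Proof.
move=> c0 c1 s0 sr; have := powRN_anti c0 s0 sr.
rewrite (kern_powRN s0 c1) (kern_powRN (lt_le_trans s0 sr) c1).
by rewrite ler_pM2l// Gamma_gt0// subr_gt0.
Qed.

(* Both double integrals are exchanged after inserting the value of the
   kernel int D r s dr given by the last hypothesis. *)
Lemma marchaud_fubini (c : R) (A b w J : R -> R) (D : R -> R -> R) (kap t : R) :
  0 < c -> c < 1 -> Cg c b -> continuous A ->
  measurable_fun [set: R * R] (fun z => D z.1 z.2) ->
  Cg 0 w -> pospart w = w -> (forall r, r <= 0 -> J r = 0) ->
  (forall r, J r = \int[mu]_s (D r s * w s)) ->
  (exists2 M, 0 <= M & forall s r, r <= t ->
    `|D r s * w s| <= M * (r `^ (- c) * (kern (1 - c) (r - s) * kern 1 s))) ->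
  (forall r, Rintegrable (fun s => D r s * w s)) ->
  (forall s, 0 < s -> Rintegrable (fun r => kern 1 (t - r) * D r s)) ->
  (forall s, 0 < s -> Rintegrable (fun r => kern 1 (t - r) * (kern (1 - c) (r - s) * pospart b r))) ->
  (forall s, 0 < s -> kap * \int[mu]_r (kern 1 (t - r) * D r s) =
    \int[mu]_r (kern 1 (t - r) * (kern (1 - c) (r - s) * pospart b r)) -
      kern (1 - c) (t - s) * (A t - A s)) ->
  kap * RL 1 J t = RL 1 (fun s => b s * RL (1 - c) w s) t - A t * RL (1 - c) w t +
    RL (1 - c) (fun s => A s * w s) t.
Proof.
move=> c0 c1 Cb cA mD Cw pw J_le0 JE [M M0 HM] iDw iD iB hD.
have c10 : 0 < 1 - c by rewrite subr_gt0.
have [N N0 HN] := pospart_bound c1 Cb t.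
have [W W0 HW] := pospart_bound (ltr01 : 0 < 1 :> R) Cw t.
have w0 s : s <= 0 -> w s = 0 by move=> s0; rewrite -pw /pospart ltNge s0.
have mw : measurable_fun [set: R] w by rewrite -pw; exact: measurable_pospart Cw.
have mb := measurable_pospart Cb.
have pJ : pospart J = J.
  by apply/funext => s; rewrite /pospart; case: ifPn => // s0; rewrite J_le0// leNgt.
have k10 r : 0 <= kern 1 r :> R by exact: kern_ge0.
have kc0 r : 0 <= kern (1 - c) r by exact: kern_ge0.
pose F (z : R * R) := kern 1 (t - z.1) * (D z.1 z.2 * w z.2).
have [||FE iF] := @fubini_kern R F (M * Gamma (1 - c)) 1 (1 - c) (1 - c) t ltr01 c10 c10.
- apply: measurable_funM; first exact: (measurableT_comp (measurable_kernB 1 t)).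
  by apply: measurable_funM; [exact: mD|exact: (measurableT_comp mw)].
- move=> r s; rewrite /F/= normrM (ger0_norm (k10 _)) [leRHS]mulrCA.
  have [tr|rt] := leP t r.
    by have -> : kern 1 (t - r) = 0 :> R; [apply: kern_le0; rewrite subr_le0|rewrite !mul0r].
  apply: (ler_wpM2l (k10 _)); apply: (le_trans (HM s r (ltW rt))).
  rewrite -mulrA; apply: (ler_wpM2l M0).
  have [s0|s0] := leP s 0.
    have -> : kern 1 s = 0 :> R by exact: kern_le0.
    have -> : kern (1 - c) s = 0 :> R by exact: kern_le0.
    by rewrite !mulr0.
  rewrite (kern1 s0) mulr1.
  have [rs|sr] := leP r s.
    have -> : kern (1 - c) (r - s) = 0 by apply: kern_le0; rewrite subr_le0.
    by rewrite mul0r !mulr0.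
  rewrite mulrC [leRHS]mulrCA; apply: (ler_wpM2l (kc0 _)).
  by rewrite -(kern_powRN s0 c1); exact: (powRN_anti (ltW c0) s0 (ltW sr)).
pose F2 (z : R * R) := kern 1 (t - z.1) * (kern (1 - c) (z.1 - z.2) * (pospart b z.1 * w z.2)).
have [||F2E iF2] := @fubini_kern R F2 (N * W) 1 (1 - c) (1 - c) t ltr01 c10 c10.
- apply: measurable_funM; first exact: (measurableT_comp (measurable_kernB 1 t)).
  apply: measurable_funM; first exact: measurable_kernB2.
  by apply: measurable_funM; [exact: (measurableT_comp mb)|exact: (measurableT_comp mw)].
- move=> r s; rewrite /F2/= normrM (ger0_norm (k10 _)) [leRHS]mulrCA.
  have [tr|rt] := leP t r.
    by have -> : kern 1 (t - r) = 0 :> R; [apply: kern_le0; rewrite subr_le0|rewrite !mul0r].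
  apply: (ler_wpM2l (k10 _)).
  have [s0|s0] := leP s 0.
    by rewrite (w0 s s0) !mulr0 normr0 mulr_ge0// mulr_ge0.
  have [rs|sr] := leP r s.
    have -> : kern (1 - c) (r - s) = 0 by apply: kern_le0; rewrite subr_le0.
    by rewrite !mul0r normr0 mulr0.
  rewrite normrM (ger0_norm (kc0 _)) [leRHS]mulrCA; apply: (ler_wpM2l (kc0 _)).
  have h1 : `|pospart b r| <= N * kern (1 - c) s.
    apply: (le_trans (HN r (ltW rt))); apply: (ler_wpM2l N0).
    exact: kern_anti (ltW c0) c1 s0 (ltW sr).
  have h2 : `|w s| <= W.
    have := HW s (ltW (lt_trans sr rt)); rewrite pw subr0.
    by rewrite (kern1 s0) mulr1.
  rewrite normrM mulrAC; exact: (ler_pM (normr_ge0 _) (normr_ge0 _) h1 h2).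
pose X s := \int[mu]_r (kern 1 (t - r) * D r s).
pose Y s := \int[mu]_r (kern 1 (t - r) * (kern (1 - c) (r - s) * pospart b r)).
have FX s : \int[mu]_r F (r, s) = w s * X s.
  have [s0|s0] := leP s 0.
    rewrite (w0 s s0) mul0r; apply: RintegralT0.
    by move=> r; rewrite /F/= (w0 s s0) !mulr0.
  rewrite -(RintegralTZl _ (iD s s0)); apply: eq_RintegralT => r; rewrite /F/=.
  by rewrite mulrA mulrC.
have FY s : \int[mu]_r F2 (r, s) = w s * Y s.
  have [s0|s0] := leP s 0.
    rewrite (w0 s s0) mul0r; apply: RintegralT0.
    by move=> r; rewrite /F2/= (w0 s s0) !mulr0.
  rewrite -(RintegralTZl _ (iB s s0)); apply: eq_RintegralT => r; rewrite /F2/=.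
  by move: (kern _ _) (kern _ _) (pospart _ _) (w s) => U V S T; ring.
have iX : Rintegrable (fun s => w s * X s) by exact: (Rintegrable_ext FX iF).
have iY : Rintegrable (fun s => w s * Y s) by exact: (Rintegrable_ext FY iF2).
have E1 : RL 1 J t = \int[mu]_s (w s * X s).
  rewrite [LHS]/(\int[mu]_r (kern 1 (t - r) * pospart J r)) pJ -(eq_RintegralT FX) -FE.
  by apply: eq_RintegralT => r; rewrite JE -(RintegralTZl _ (iDw r)).
have E2 : RL 1 (fun s => b s * RL (1 - c) w s) t = \int[mu]_s (w s * Y s).
  rewrite -(eq_RintegralT FY) -F2E; apply: eq_RintegralT => r.
  have iR := Rintegrable_RL r (ltr01 : 0 < 1 :> R) Cw c10.
  have -> : \int[mu]_s F2 (r, s) = (kern 1 (t - r) * pospart b r) * RL (1 - c) w r.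
    rewrite -[RL (1 - c) w r]/(\int[mu]_s (kern (1 - c) (r - s) * pospart w s)) -(RintegralTZl _ iR).
    apply: eq_RintegralT => s; rewrite pw /F2/=.
    by move: (kern _ _) (kern _ _) (pospart _ _) (w s) => U V S T; ring.
  by rewrite -mulrA /pospart; case: ifP; rewrite ?mul0r.
have CAw : Cg 0 (fun s => A s * w s) by exact: CgM.
have i1 := Rintegrable_RL t (ltr01 : 0 < 1 :> R) Cw c10.
have i2 := Rintegrable_RL t (ltr01 : 0 < 1 :> R) CAw c10.
pose Z s := A t * (kern (1 - c) (t - s) * pospart w s) -
  kern (1 - c) (t - s) * pospart (fun s => A s * w s) s.
have iZ : Rintegrable Z by exact: (RintegrableB (RintegrableZl (A t) i1) i2).
have E3 : \int[mu]_s Z s = A t * RL (1 - c) w t - RL (1 - c) (fun s => A s * w s) t.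
  by rewrite (RintegralTB (RintegrableZl (A t) i1) i2) (RintegralTZl _ i1).
rewrite E1 E2 -(RintegralTZl kap iX).
have -> : \int[mu]_s (kap * (w s * X s)) = \int[mu]_s (w s * Y s - Z s).
  apply: eq_RintegralT => s; rewrite mulrCA /Z pw.
  have [s0|s0] := leP s 0.
    by rewrite (w0 s s0) !mul0r !mulr0 /pospart ltNge s0/= mulr0 subr0 subr0.
  rewrite hD// -/(Y s) /pospart s0.
  by move: (kern _ _) (w s) (A s) (A t) (Y s) => U V S T Q; ring.
by rewrite (RintegralTB iY iZ) E3 opprB addrA addrAC.
Qed.

(** Integration by parts: A I^1 p vanishes at 0 and has derivative A p + b I^1 p. *)
Lemma RL1_product (c : R) (A b p : R -> R) (t : R) : c < 1 -> Cg c b -> Cg c p -> continuous A ->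
  (forall s : R, 0 < s -> is_derive s 1 A (b s)) -> 0 <= t ->
  RL 1 (fun s => A s * p s) t + RL 1 (fun s => b s * RL 1 p s) t = A t * RL 1 p t.
Proof.
move=> c1 Cb Cp cA dA t0.
have C1 : Cg c (fun s => A s * p s) by exact: CgM.
have cp : continuous (RL 1 p) by exact: (RL_continuous ltr01 c1 c1 Cp).
have C2 : Cg c (fun s => b s * RL 1 p s).
  by apply: (Cg_ext _ (CgM cp Cb)) => s _; rewrite mulrC.
rewrite -(RLD t ltr01 c1 C1 C2).
have cAp : continuous (fun s => A s * RL 1 p s) by move=> s; apply: cvgM; [exact: cA|exact: cp].
have df s : 0 < s < t -> is_derive s 1 (fun s => A s * RL 1 p s) (A s * p s + b s * RL 1 p s).
  move=> /andP[s0 _]; have D1 := is_deriveM (dA s s0) (RL1_derive c1 Cp s0).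
  rewrite (_ : A s * p s + b s * RL 1 p s = A s *: p s + RL 1 p s *: b s); first exact: D1.
  by rewrite /GRing.scale/= (mulrC (b s)).
have tt : 0 <= t <= t by rewrite t0 lexx.
have := Cg_FTC c1 (CgD C1 C2) (continuous_subspaceT cAp) df tt.
rewrite (@RL_le0 _ 1 p 0 (lexx 0)) mulr0 => ->.
by move: (RL 1 _ t) => X; rewrite add0r.
Qed.

(** Both sides are compared after I^(1 - c). The left one becomes I^1 (A p) + kap I^1 J; Fubini
    rewrites the J term, and integration by parts cancels everything but I^(1 - c) (A I^c p). *)
Lemma marchaud_product (c : R) (A b p J : R -> R) (D : R -> R -> R) (kap : R) :
  0 < c -> c < 1 -> Cg c b -> continuous A -> (forall s : R, 0 < s -> is_derive s 1 A (b s)) ->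
  measurable_fun [set: R * R] (fun z => D z.1 z.2) -> Cg c p ->
  Cg 0 (RL c p) -> pospart (RL c p) = RL c p -> Cg c J -> (forall r, r <= 0 -> J r = 0) ->
  (forall r, J r = \int[mu]_s (D r s * RL c p s)) ->
  (forall S, exists2 M, 0 <= M & forall s r, r <= S ->
    `|D r s * RL c p s| <= M * (r `^ (- c) * (kern (1 - c) (r - s) * kern 1 s))) ->
  (forall r, Rintegrable (fun s => D r s * RL c p s)) ->
  (forall s t, 0 < s -> Rintegrable (fun r => kern 1 (t - r) * D r s)) ->
  (forall s t, 0 < s -> Rintegrable (fun r => kern 1 (t - r) * (kern (1 - c) (r - s) * pospart b r))) ->
  (forall s t, 0 < s -> kap * \int[mu]_r (kern 1 (t - r) * D r s) =
    \int[mu]_r (kern 1 (t - r) * (kern (1 - c) (r - s) * pospart b r)) -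
      kern (1 - c) (t - s) * (A t - A s)) ->
  forall t, 0 < t -> RL c (fun s => A s * p s + kap * J s) t = A t * RL c p t.
Proof.
move=> c0 c1 Cb cA dA mD Cp Cw pw CJ J0 JE HM iDw iD iB hD t t0.
have c10 : 0 < 1 - c by rewrite subr_gt0.
(* Injectivity speaks of open intervals; t + 1 is any bound beyond t. *)
have tt : 0 < t < t + 1 by rewrite t0/= ltrDl.
have CAw : Cg c (fun s => A s * RL c p s) by apply: (Cg_le (ltW c0)); exact: CgM.
have c01 : 0 < 1 - c < 1 by rewrite c10 gtrBl.
have Cq : Cg c (fun s => A s * p s + kap * J s) by apply: CgD; [exact: CgM|exact: CgZ].
apply: (RL_inj c01 c1 (RL_Cg c0 c1 Cq) CAw _ tt) => s /andP[s0 _].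
rewrite (RL_semigroup s c10 c0 c1 Cq) subrK.
rewrite (RLD s ltr01 c1 (CgM cA Cp) (CgZ kap CJ)) (RLZ kap s ltr01 c1 CJ).
have RL1w r : RL (1 - c) (RL c p) r = RL 1 p r by rewrite (RL_semigroup r c10 c0 c1 Cp) subrK.
have := marchaud_fubini c0 c1 Cb cA mD Cw pw J0 JE (HM s) iDw (fun s => iD s _) (fun s => iB s _)
  (fun r => hD r s).
have -> : (fun s => b s * RL (1 - c) (RL c p) s) = (fun s => b s * RL 1 p s).
  by apply/funext => r; rewrite RL1w.
rewrite (RL1w s) => ->; rewrite -(RL1_product c1 Cb Cp cA dA (ltW s0)).
by move: (RL _ _ _) (RL _ _ _) (RL _ _ _) => X Y Z; ring.
Qed.
End marchaud_fubini.

(** * The Marchaud quotient: estimates, regularity and the value of its primitive *)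

Section product.
Variable R : realType.
Notation mu := (@lebesgue_measure R).
Variables (c a0 : R) (b : R -> R).
Hypotheses (c0 : 0 < c) (c1 : c < 1) (Cb : Cg c b).
Implicit Types (f g p w : R -> R) (t s r S k x : R).

Let c10 : 0 < 1 - c. Proof. by rewrite subr_gt0. Qed.
Let A t := a0 + RL 1 b t.

Let cA : continuous A.
Proof.
move=> t; apply: cvgD; first exact: cvg_cst.
exact: (RL_continuous ltr01 c1 c1 Cb).
Qed.

Let A_le0 t : t <= 0 -> A t = a0.
Proof. by move=> t0; rewrite /A RL_le0// addr0. Qed.

Let A_derive t : 0 < t -> is_derive t 1 A (b t).
Proof.
move=> t0; rewrite -[b t]add0r; apply: is_deriveD.
exact: RL1_derive c1 Cb t0.
Qed.

(** Writing t^(1 - c) as t t^(-c), it remains to see s t^(-c) <= s s^(-c), the negative power being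
    decreasing. *)
Lemma powR_increment_le s t : 0 <= s -> s <= t -> 0 < t ->
  t `^ (1 - c) - s `^ (1 - c) <= t `^ (- c) * (t - s).
Proof.
move=> s0 st t0; rewrite mulrBr lerB//.
  by rewrite addrC gt0_powRD// powRr1// ltW.
have [->|sn0] := eqVneq s 0; first by rewrite mulr0 powR_ge0.
have sp : 0 < s by rewrite lt_neqAle eq_sym sn0.
rewrite addrC gt0_powRD// powRr1//; apply: ler_wpM2r => //.
rewrite !powRN lef_pV2 ?posrE ?powR_gt0//; apply: ge0_ler_powR => //; first exact: ltW.
by rewrite nnegrE ltW.
Qed.

(** The integral of b over [s, t] is dominated by that of r^(-c), a difference of kernels of order 2
    - c. The weight t^(-c) sits at the larger endpoint, so it can be taken out of integrals in s. *)
Lemma primitive_increment S : exists2 L, 0 <= L &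
  forall s t, 0 <= s -> s <= t -> 0 < t -> t <= S ->
    `|RL 1 b t - RL 1 b s| <= L * (t `^ (- c) * (t - s)).
Proof.
have [M M0 HM] := pospart_bound c1 Cb S.
have G0 : 0 < Gamma (1 + (1 - c)) by rewrite Gamma_gt0// addr_gt0.
exists (M / Gamma (1 + (1 - c))) => [|s t s0 st t0 tS]; first by rewrite divr_ge0// ltW.
have iT x := Rintegrable_RL x c1 Cb ltr01.
have iK x := @integrable_conv_kern R 1 (1 - c) x ltr01 c10.
have -> : RL 1 b t - RL 1 b s = \int[mu]_r ((kern 1 (t - r) - kern 1 (s - r)) * pospart b r).
  rewrite -(RintegralTB (iT t) (iT s)).
  by apply: eq_RintegralT => r; rewrite mulrBl.
have iD : Rintegrable (fun r => (kern 1 (t - r) - kern 1 (s - r)) * pospart b r).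
  by apply: (Rintegrable_ext _ (RintegrableB (iT t) (iT s))) => r; rewrite mulrBl.
have iD2 : Rintegrable (fun r => (kern 1 (t - r) - kern 1 (s - r)) * kern (1 - c) r).
  by apply: (Rintegrable_ext _ (RintegrableB (iK t) (iK s))) => r; rewrite mulrBl.
have kd r : 0 <= kern 1 (t - r) - kern 1 (s - r).
  have [rs|rs] := ltP r s; first by rewrite !kern1 ?subr_gt0// ?subrr// (lt_le_trans rs).
  by rewrite (@kern_le0 _ 1 (s - r)) ?subr_le0// subr0 kern_ge0.
apply: (@le_trans _ _ (M * (kern (1 + (1 - c)) t - kern (1 + (1 - c)) s))).
  have -> : M * (kern (1 + (1 - c)) t - kern (1 + (1 - c)) s) =
      \int[mu]_r (M * ((kern 1 (t - r) - kern 1 (s - r)) * kern (1 - c) r)).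
    rewrite RintegralTZl// -!(Rconv_kern _ ltr01 c10) -(RintegralTB (iK t) (iK s)).
    by congr (M * _); apply: eq_RintegralT => r; rewrite mulrBl.
  apply: Rintegral_norm_le => [//||r]; first exact: RintegrableZl.
  rewrite normrM (ger0_norm (kd r)) mulrCA.
  have [rS|rS] := leP r S; first by apply: ler_wpM2l => //; exact: HM.
  by rewrite !(@kern_le0 _ 1) ?subrr ?mul0r//; lra.
rewrite -mulrA; apply: ler_wpM2l => //.
have kE x : 0 <= x -> kern (1 + (1 - c)) x = (Gamma (1 + (1 - c)))^-1 * x `^ (1 - c).
  rewrite le_eqVlt => /predU1P[<-|x0].
    by rewrite kern_le0// powR0 ?mulr0// gt_eqF.
  by rewrite kern_gt0// mulrC; congr (_ * _ `^ _); rewrite addrC addKr.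
rewrite !kE//; last exact: ltW.
by rewrite -mulrBr; apply: ler_wpM2l; [rewrite invr_ge0 ltW|exact: powR_increment_le].
Qed.

Let A_increment S : exists2 L, 0 <= L &
  forall s t, 0 <= s -> s <= t -> 0 < t -> t <= S -> `|A t - A s| <= L * (t `^ (- c) * (t - s)).
Proof.
have [L L0 HL] := primitive_increment S; exists L => // s t s0 st t0 tS.
by rewrite /A opprD addrACA subrr add0r HL.
Qed.

(* the Marchaud difference quotient of A *)
Let D t s := if s < t then (A t - A s) * (t - s) `^ (- 1 - c) else 0.

Let mD : measurable_fun [set: R * R] (fun z => D z.1 z.2).
Proof.
have mA := continuous_measurable_fun cA.
apply: measurable_fun_if => //=.
- exact: measurable_fun_ltr.
- apply: measurable_funTS; apply: measurable_funM.
    by apply: measurable_funB; apply: (measurableT_comp mA).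
  by apply: (measurableT_comp (measurable_powR (- 1 - c))); exact: measurable_funB.
Qed.

(** The increment of A supplies one power of t - s, which turns the nonintegrable exponent -1 - c
    into -c. *)
Let D_bound S : exists2 L, 0 <= L &
  forall s t, 0 <= s -> 0 < t -> t <= S -> `|D t s| <= L * (t `^ (- c) * kern (1 - c) (t - s)).
Proof.
have [L L0 HL] := A_increment S.
have G0 := Gamma_gt0 c10.
exists (L * Gamma (1 - c)) => [|s t s0 t0 tS]; first by rewrite mulr_ge0// ltW.
rewrite /D; case: ifPn => st; last by rewrite normr0 kern_le0 ?mulr0// subr_le0 leNgt.
have ts0 : 0 < t - s by rewrite subr_gt0.
rewrite normrM (ger0_norm (powR_ge0 _ _)).
apply: (@le_trans _ _ (L * (t `^ (- c) * (t - s)) * (t - s) `^ (- 1 - c))).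
  by apply: ler_wpM2r; [exact: powR_ge0|apply: HL => //; exact: ltW].
rewrite -!mulrA; apply: ler_wpM2l => //.
rewrite [leRHS]mulrCA; apply: ler_wpM2l; first exact: powR_ge0.
rewrite -(kern_powRN ts0 c1) -[X in X * _](powRr1 (ltW ts0)) -gt0_powRD//.
by rewrite addrA subrr add0r.
Qed.

Section factor.
Variable p : R -> R.
Hypothesis Cp : Cg c p.

Let w := RL c p.
Let Cw : Cg 0 w. Proof. exact: RL_Cg0 c0 c1 (lexx c) Cp. Qed.
Let lt01 : 0 < 1 :> R. Proof. exact: ltr01. Qed.
Let pw : pospart w = w.
Proof.
apply/funext => s; rewrite /pospart; case: ifPn => // s0; rewrite /w RL_le0//.
by rewrite leNgt.
Qed.
Let w_le0 s : s <= 0 -> w s = 0.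
Proof. by move=> s0; rewrite /w RL_le0. Qed.
Let mw : measurable_fun [set: R] w.
Proof. by rewrite -pw; exact: measurable_pospart Cw. Qed.
Let w_bound S : exists2 M, 0 <= M & forall s, s <= S -> `|w s| <= M * kern 1 s.
Proof.
have [M M0 HM] := pospart_bound lt01 Cw S; exists M; first exact: M0.
by move=> s sS; have := HM s sS; rewrite pw subr0.
Qed.

Let J t := \int[mu]_s (D t s * w s).

Let DW_bound S : exists2 M, 0 <= M & forall s t, t <= S ->
  `|D t s * w s| <= M * (t `^ (- c) * (kern (1 - c) (t - s) * kern 1 s)).
Proof.
have [L L0 HL] := D_bound S; have [M M0 HM] := w_bound S.
exists (L * M) => [|s t tS]; first by rewrite mulr_ge0.
have [s0|s0] := leP s 0.
  by rewrite (w_le0 s0) (kern_le0 _ s0) !mulr0 normr0.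
have [ts|st] := leP t s.
  by rewrite /D ltNge ts/= mul0r normr0 kern_le0 ?subr_le0// mul0r !mulr0.
have sS : s <= S by rewrite ltW// (lt_le_trans st).
rewrite normrM.
apply: (le_trans (ler_pM (normr_ge0 _) (normr_ge0 _) (HL s t (ltW s0) (lt_trans s0 st) tS) (HM s sS))).
by rewrite le_eqVlt; apply/orP; left; apply/eqP; move: (kern _ _) (kern _ _) => X Y; ring.
Qed.

Let mDw t : measurable_fun [set: R] (fun s => D t s * w s).
Proof.
apply: measurable_funM; last exact: mw.
exact: (measurableT_comp mD (pair1_measurable t)).
Qed.

Let iDw t : Rintegrable (fun s => D t s * w s).
Proof.
have [M M0 HM] := DW_bound t.
apply: (Rintegrable_le (mDw t) (fun s => HM s t (lexx t))).
by apply: RintegrableZl; apply: RintegrableZl; exact: integrable_conv_kern.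
Qed.

(** I^c maps s^(-c) to the constant Gamma(1 - c), so I^c p is at most K Gamma(1 - c) e^(lam t) on
    ]0, t[. What remains is a convolution equal to [kern (1 - c + 1) t], which increases in t. The
    resulting constant is free of lam. *)
Let J_bound T L : 0 <= L ->
  (forall s t, 0 <= s -> 0 < t -> t <= T -> `|D t s| <= L * (t `^ (- c) * kern (1 - c) (t - s))) ->
  forall lam S K, 0 <= lam -> S <= T -> 0 <= K ->
  wbound c lam S K p -> wbound c lam S (L * Gamma (1 - c) * kern (1 - c + 1) T * K) J.
Proof.
move=> L0 HL lam S K lam0 ST K0 HK t /andP[t0 tS].
have G0 := ltW (Gamma_gt0 c10).
have c20 : 0 < 1 - c + 1 by rewrite addr_gt0.
pose X := L * Gamma (1 - c) * K * (t `^ (- c) * expR (lam * t)).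
have X0 : 0 <= X by rewrite !mulr_ge0 ?powR_ge0 ?expR_ge0.
have iK := @integrable_conv_kern R (1 - c) 1 t c10 ltr01.
apply: (@le_trans _ _ (\int[mu]_s (X * (kern (1 - c) (t - s) * kern 1 s)))).
  apply: Rintegral_norm_le => [||s]; [exact: iDw|exact: RintegrableZl|].
  have [s0|s0] := leP s 0.
    by rewrite (w_le0 s0) (kern_le0 _ s0) !mulr0 normr0.
  have [ts|st] := leP t s.
    by rewrite /D ltNge ts/= mul0r normr0 kern_le0 ?subr_le0// mul0r mulr0.
  have h1 := HL s t (ltW s0) t0 (le_trans tS ST).
  have h2 : `|w s| <= K * expR (lam * t) * (Gamma (1 - c) * kern 1 s).
    have := @wbound_RL R c c lam S K p s c0 c1 Cp lam0 K0 HK (ltW (lt_le_trans st tS)).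
    rewrite [c + (1 - c)]addrC subrK => h; apply: (le_trans h).
    apply: ler_wpM2r; first by rewrite mulr_ge0// kern_ge0.
    by apply: ler_wpM2l => //; rewrite ler_expR ler_wpM2l// ltW.
  rewrite normrM; apply: (le_trans (ler_pM (normr_ge0 _) (normr_ge0 _) h1 h2)).
  rewrite le_eqVlt; apply/orP; left; apply/eqP; rewrite /X.
  by move: (kern _ _) (kern _ _) (Gamma _) => U V G; ring.
rewrite RintegralTZl// Rconv_kern//.
have hk : kern (1 - c + 1) t <= kern (1 - c + 1) T.
  rewrite !kern_gt0//; last by rewrite (lt_le_trans t0)// (le_trans tS).
  apply: ler_wpM2r; first by rewrite invr_ge0 ltW// Gamma_gt0.
  by rewrite addrK; apply: ge0_ler_powR; rewrite ?nnegrE; rewrite ?(ltW c10)//; lra.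
apply: (le_trans (ler_wpM2l X0 hk)).
rewrite le_eqVlt; apply/orP; left; apply/eqP; rewrite /X.
by move: (kern _ _) (Gamma _) => U G; ring.
Qed.

(** After s := t s the quotient yields t^(-1 - c) and the differential t, hence the weight t^(-c);
    the rest is a parameter integral over ]0, 1[. *)
Let J_regular : Cg c J.
Proof.
have [W cW wW] := Cw; have G0 := Gamma_gt0 c10.
pose K s := kern (1 - c) (1 - s) * kern 1 s.
(* Of (1 - s)^(-1 - c) only the integrable part (1 - s)^(-c) goes to K. The factor (1 - s)^(-1)
   stays with the increment of A, which is at most L t^(1 - c) (1 - s), so H is bounded. *)
pose H t s := Gamma (1 - c) * ((A t - A (t * s)) * (1 - s) `^ (- 1) * W (t * s)).
have iK : Rintegrable K by exact: integrable_conv_kern.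
have Ks s : K s != 0 -> 0 < s /\ s < 1.
  move=> Ks; split; rewrite ltNge; apply/negP => h; move/eqP: Ks; apply; rewrite /K.
    by rewrite (kern_le0 _ h) mulr0.
  by rewrite (@kern_le0 _ (1 - c) (1 - s)) ?subr_le0// mul0r.
exists (fun t => \int[mu]_s (K s * H t s)).
  apply: continuous_Rintegral_param => //.
  - move=> s t.
    have cts : {for t, continuous (fun t : R => t * s)} by apply: cvgM; [exact: cvg_id|exact: cvg_cst].
    apply: cvgM; first exact: cvg_cst.
    apply: cvgM; last by apply: (@continuous_comp _ _ _ (fun t : R => t * s) W) => //; exact: cW.
    apply: cvgM; last exact: cvg_cst.
    apply: cvgB; first exact: cA.
    by apply: (@continuous_comp _ _ _ (fun t : R => t * s) A) => //; exact: cA.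
  - move=> t.
    have mt : measurable_fun [set: R] (fun s : R => t * s) by exact: measurable_funM.
    apply: measurable_funM => //; apply: measurable_funM; last first.
      exact: (measurableT_comp (continuous_measurable_fun cW)).
    apply: measurable_funM.
      by apply: measurable_funB => //; exact: (measurableT_comp (continuous_measurable_fun cA)).
    by apply: (measurableT_comp (measurable_powR (- 1))); exact: measurable_funB.
  - move=> S; have [L L0 HL] := A_increment S; have [M M0 HM] := continuous_bounded cW S.
    exists (Gamma (1 - c) * (L * S `^ (1 - c) * M)) => t s tS /Ks[s0 s1].
    have s10 : 0 < 1 - s by rewrite subr_gt0.
    rewrite /H normrM gtr0_norm//; apply: ler_wpM2l; first exact: ltW.
    have ts : `|t * s| <= S by rewrite normrM (le_trans _ tS)// ler_piMr// gtr0_norm// ltW.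
    rewrite normrM; apply: ler_pM => //; last exact: HM.
    have [t0|t0] := leP t 0.
      rewrite (A_le0 t0) A_le0 ?subrr ?mul0r ?normr0; first by rewrite mulr_ge0// powR_ge0.
      by rewrite mulr_le0_ge0// ltW.
    have tS' : t <= S by rewrite (le_trans (ler_norm _)).
    have tst : t * s <= t by rewrite ler_piMr// ltW.
    have ts0 : 0 <= t * s by rewrite mulr_ge0// ltW.
    rewrite normrM (ger0_norm (powR_ge0 _ _)) powR_inv1; last exact: ltW.
    rewrite ler_pdivrMr//; apply: (le_trans (HL (t * s) t ts0 tst t0 tS')).
    rewrite -mulrA; apply: ler_wpM2l => //.
    rewrite (_ : t - t * s = t * (1 - s)); last by rewrite mulrBr mulr1.
    rewrite mulrA; apply: ler_wpM2r; first exact: ltW.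
    rewrite -[X in _ * X](powRr1 (ltW t0)) -gt0_powRD// addrC.
    by apply: ge0_ler_powR; rewrite ?nnegrE ?(ltW c10) ?(ltW t0)// (le_trans (ltW t0)).
move=> t t0; have t0' : t != 0 by rewrite gt_eqF.
have E (s : R) : D t (t * s + 0) * w (t * s + 0) = t `^ (- 1 - c) * (K s * H t s).
  rewrite addr0 /K; have [s0|s0] := leP s 0.
    by rewrite (kern_le0 _ s0) w_le0 ?mulr0 ?mul0r ?mulr0// mulr_ge0_le0// ltW.
  have [s1|s1] := leP 1 s.
    rewrite (@kern_le0 _ (1 - c) (1 - s)) ?subr_le0// !mul0r mulr0.
    have tst : (t * s < t) = false by rewrite gtr_pMr// ltNge s1.
    by rewrite /D tst mul0r.
  have s10 : 0 < 1 - s by rewrite subr_gt0.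
  rewrite /D gtr_pMr// s1 (kern1 s0) mulr1 wW ?mulr_gt0// oppr0 powRr0 mul1r.
  rewrite (_ : t - t * s = t * (1 - s)); last by rewrite mulrBr mulr1.
  rewrite powRM ?(ltW t0) ?(ltW s10)// kern_gt0// /H.
  rewrite (_ : 1 - c - 1 = - c); last by rewrite addrC addrA addNr add0r.
  rewrite (gt0_powRD (- 1) (- c) s10).
  move: ((1 - s) `^ (- 1)) ((1 - s) `^ (- c)) (t `^ (- 1 - c)) (W (t * s)) (A t - A (t * s)) (Gamma (1 - c)) G0.
  by move=> X Y Z U V G G0; field; rewrite gt_eqF.
have k0 : t `^ (- 1 - c) != 0 by rewrite gt_eqF// powR_gt0.
have iKH : Rintegrable (fun s : R => K s * H t s).
  have /(RintegrableZl ((t `^ (- 1 - c))^-1)) := @integrable_affine R t 0 t0' _ (iDw t).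
  by apply: Rintegrable_ext => s; rewrite E mulKf.
rewrite /J (@Rintegral_affine R t 0 t0' _ (iDw t)) (eq_RintegralT E) RintegralTZl// mulrA.
rewrite (gtr0_norm t0); congr (_ * _); rewrite -[X in X * _](powRr1 (ltW t0)) -gt0_powRD//.
by rewrite addrA subrr add0r.
Qed.

(* the Marchaud quotient at distance x from s, and the derivative of
   x |-> x^(-c) (A (s + x) - A s) apart from the factor -c of the former *)
Let e s x := (A (s + x) - A s) * x `^ (- 1 - c).
Let d s x := x `^ (- c) * b (s + x).
Let c' := (c + 1) / 2.
Let c'1 : c' < 1. Proof. by rewrite midf_lt. Qed.
Let cc' : c < c'. Proof. by rewrite midf_lt. Qed.

Let shift_continuous s x f : {for s + x, continuous f} -> {for x, continuous (fun x => f (s + x))}.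
Proof.
move=> cf; apply: (@continuous_comp _ _ _ (fun x : R => s + x) f) => //.
by apply: cvgD; [exact: cvg_cst|exact: cvg_id].
Qed.

(** As s > 0 is fixed, the weight (s + x)^(-c) of the increment is at most s^(-c), and the quotient
    is O(x^(-c)); an exponent strictly between c and 1 then suffices. *)
Let Ce s : 0 < s -> Cg c' (e s).
Proof.
move=> s0; apply: (Cg_gt_bound _ cc') => [x x0|S].
  apply: cvgM; last exact: continuous_powR_gt0.
  by apply: cvgB; [apply: shift_continuous; exact: cA|exact: cvg_cst].
have [L L0 HL] := A_increment (s + S); exists (L * s `^ (- c)) => x /andP[x0 xS].
have sx0 : 0 < s + x by rewrite addr_gt0.
rewrite /e normrM (ger0_norm (powR_ge0 _ _)).
have h : `|A (s + x) - A s| <= L * s `^ (- c) * x.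
  apply: (le_trans (HL s (s + x) (ltW s0) _ sx0 _)); rewrite ?lerD2l// ?lerDl ?(ltW x0)//.
  rewrite -mulrA; apply: ler_wpM2l => //.
  rewrite [s + x]addrC addrK; apply: ler_wpM2r; first exact: ltW.
  rewrite !powRN lef_pV2 ?posrE ?powR_gt0 ?addr_gt0//.
  by apply: ge0_ler_powR; rewrite ?nnegrE ?(ltW c0) ?(ltW s0) ?lerDr// ltW// addr_gt0.
apply: (le_trans (ler_wpM2r (powR_ge0 _ _) h)); rewrite -[leLHS]mulrA.
apply: ler_wpM2l; first by rewrite mulr_ge0// powR_ge0.
by rewrite -[X in X * _](powRr1 (ltW x0)) -gt0_powRD// addrA subrr add0r.
Qed.

Let Cd s : 0 < s -> Cg c' (d s).
Proof.
move=> s0; apply: (Cg_gt_bound _ cc') => [x x0|S].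
  apply: cvgM; first exact: continuous_powR_gt0.
  by apply: shift_continuous; apply: (Cg_continuous_at Cb); rewrite addr_gt0.
have [M M0 HM] := Cg_bound Cb (s + S); exists (M * s `^ (- c)) => x /andP[x0 xS].
have sx0 : 0 < s + x by rewrite addr_gt0.
rewrite /d normrM (ger0_norm (powR_ge0 _ _)) mulrC; apply: ler_wpM2r; first exact: powR_ge0.
apply: (le_trans (HM (s + x) _)); first by rewrite sx0 lerD2l.
apply: ler_wpM2l => //; rewrite !powRN lef_pV2 ?posrE ?powR_gt0//.
by apply: ge0_ler_powR; rewrite ?nnegrE ?(ltW c0) ?(ltW s0) ?(ltW sx0)// lerDl ltW.
Qed.

(** The fundamental theorem for x^(-c) (A(s + x) - A(s)), whose boundary value at x = 0 vanishes. *)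
Let by_parts s x : 0 < s -> 0 <= x ->
  x `^ (- c) * (A (s + x) - A s) = (- c) * RL 1 (e s) x + RL 1 (d s) x.
Proof.
move=> s0 x0.
have [u cu eu] := Ce s0.
(* The function equals x [e s x] for x > 0, and u is the continuous factor of [e s]: this form is
   continuous on the line and vanishes at 0 since c' < 1. *)
pose f x := `|x| `^ (1 - c') * u x.
have fE y : 0 < y -> f y = y `^ (- c) * (A (s + y) - A s).
  move=> y0; rewrite /f gtr0_norm// gt0_powRD// -mulrA -eu// powRr1 ?ltW// /e.
  rewrite (gt0_powRD (- 1) (- c) y0) powR_inv1 ?ltW//.
  by move: (A _ - _) (y `^ _) => U V; field; rewrite gt_eqF.
have f0 : f 0 = 0.
  by rewrite /f normr0 powR0 ?mul0r// gt_eqF ?subr_gt0.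
have cf : continuous f.
  move=> y; apply: cvgM; last exact: cu.
  by apply: continuous_norm_powR; rewrite subr_ge0 ltW.
have Cdf : Cg c' (fun x => (- c) * e s x + d s x) by apply: CgD; [apply: CgZ; exact: Ce|exact: Cd].
have -> : x `^ (- c) * (A (s + x) - A s) = f x.
  move: x0; rewrite le_eqVlt => /predU1P[<-|x0]; last by rewrite fE.
  by rewrite f0 addr0 subrr mulr0.
suff df y : 0 < y < x -> is_derive y 1 f (- c * e s y + d s y).
  rewrite (Cg_FTC c'1 Cdf (continuous_subspaceT cf) df); last by rewrite x0 lexx.
  rewrite f0 add0r (RLD x ltr01 c'1 (CgZ (- c) (Ce s0)) (Cd s0)).
  by rewrite (RLZ (- c) x ltr01 c'1 (Ce s0)).
move=> /andP[y0 _]; have sy0 : 0 < s + y by rewrite addr_gt0.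
have D1 : is_derive y 1 (fun x => x `^ (- c)) (- c * y `^ (- c - 1)) := is_derive_powR (- c) y0.
have D2 : is_derive y 1 (fun x => A (s + x) - A s) (b (s + y)).
  have D3 : is_derive y (1 : R) (fun x : R => s + x) (0 + 1) by apply: is_deriveD.
  have D4 := @is_derive1_comp R A (fun x => s + x) y _ _ (A_derive sy0) D3.
  rewrite -[b _]subr0; apply: is_deriveB => //.
  by rewrite add0r mulr1 in D4.
have D5 := is_deriveM D1 D2.
have E : (y `^ (- c) *: b (s + y) + (A (s + y) - A s) *: (- c * y `^ (- c - 1))) =
    - c * e s y + d s y.
  rewrite /GRing.scale/= /e /d (addrC (- c) (- 1)); move: (A _ - _) (b _) (y `^ _) (y `^ _) => U V X Y.
  by ring.
rewrite -E; apply: (near_eq_is_derive _ D5).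
by near=> z; rewrite fE//; near: z; exact: lt_nbhsr.
Unshelve. all: by end_near. Qed.
Let kap := c / Gamma (1 - c).

Let e_D s t : pospart (e s) (t - s) = D t s.
Proof. by rewrite /pospart subr_gt0 /D /e [s + _]addrC subrK. Qed.

Let d_kern s r : 0 < s ->
  pospart (fun x => (Gamma (1 - c))^-1 * d s x) (r - s) = kern (1 - c) (r - s) * pospart b r.
Proof.
move=> s0; rewrite /pospart subr_gt0.
case: (ltP s r) => sr; last by rewrite (@kern_le0 _ _ (r - s)) ?mul0r// subr_le0.
rewrite (lt_trans s0 sr) /d [s + _]addrC subrK kern_gt0 ?subr_gt0//.
rewrite (_ : 1 - c - 1 = - c); last by rewrite addrC addrA addNr add0r.
by rewrite mulrA; congr (_ * _); rewrite mulrC.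
Qed.

(** Translation by s turns both integrals into I^1 at t - s, and [by_parts] divided by Gamma(1 - c)
    relates them. The constant kap is the c produced by differentiating x^(-c), over this Gamma
    factor. *)
Let marchaud_kernel s t : 0 < s ->
  kap * \int[mu]_r (kern 1 (t - r) * D r s) =
  \int[mu]_r (kern 1 (t - r) * (kern (1 - c) (r - s) * pospart b r)) -
    kern (1 - c) (t - s) * (A t - A s).
Proof.
move=> s0; have G0 := Gamma_gt0 c10.
have shift f : Cg c' f -> \int[mu]_r (kern 1 (t - r) * pospart f (r - s)) = RL 1 f (t - s).
  move=> Cf; rewrite /RL (@Rintegral_affine R 1 (- s) (oner_neq0 R) _ (Rintegrable_RL (t - s) c'1 Cf ltr01)).
  rewrite normr1 mul1r; apply: eq_RintegralT => r.
  by congr (kern 1 _ * pospart f _); ring.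
have -> : \int[mu]_r (kern 1 (t - r) * D r s) = RL 1 (e s) (t - s).
  by rewrite -(shift _ (Ce s0)); apply: eq_RintegralT => r; rewrite e_D.
have -> : \int[mu]_r (kern 1 (t - r) * (kern (1 - c) (r - s) * pospart b r)) =
    (Gamma (1 - c))^-1 * RL 1 (d s) (t - s).
  rewrite -(RLZ _ _ ltr01 c'1 (Cd s0)) -(shift _ (CgZ _ (Cd s0))).
  by apply: eq_RintegralT => r; congr (_ * _); exact/esym/d_kern/s0.
have [ts|st] := leP t s.
  by rewrite !RL_le0 ?subr_le0// kern_le0 ?subr_le0// !mulr0 mul0r subr0.
have ts0 : 0 < t - s by rewrite subr_gt0.
have := by_parts s0 (ltW ts0); rewrite [s + _]addrC subrK (kern_powRN ts0 c1).
move: (A t - A s) (RL 1 _ _) (RL 1 _ _) (kern _ _) => U X Y Z; rewrite /kap.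
move: (Gamma (1 - c)) G0 => G G0 E.
have -> : X = G * Z * U + c * Y by rewrite E; ring.
by field; rewrite gt_eqF.
Qed.

Let q t := A t * p t + kap * J t.

Let Cq : Cg c q.
Proof. by apply: CgD; [exact: (CgM cA Cp)|exact: (CgZ kap J_regular)]. Qed.

Let J_le0 t : t <= 0 -> J t = 0.
Proof.
move=> t0; rewrite /J (@eq_RintegralT _ _ (fun=> 0)); first by rewrite Rintegral_cst// mul0r.
move=> s; have [s0|s0] := leP s 0; first by rewrite (w_le0 s0) mulr0.
by rewrite /D ltNge (le_trans t0 (ltW s0))/= mul0r.
Qed.

Let RL1w t : RL (1 - c) w t = RL 1 p t.
Proof. by rewrite /w (RL_semigroup t c10 c0 c1 Cp) subrK. Qed.

Let iD s t : 0 < s -> Rintegrable (fun r => kern 1 (t - r) * D r s).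
Proof.
move=> s0; have := @integrable_affine R 1 (- s) (oner_neq0 R) _ (Rintegrable_RL (t - s) c'1 (Ce s0) ltr01).
apply: Rintegrable_ext => r; rewrite -e_D.
by congr (kern 1 _ * pospart (e s) _); ring.
Qed.

Let iB s t : 0 < s -> Rintegrable (fun r => kern 1 (t - r) * (kern (1 - c) (r - s) * pospart b r)).
Proof.
move=> s0.
have := @integrable_affine R 1 (- s) (oner_neq0 R) _ (Rintegrable_RL (t - s) c'1 (CgZ (Gamma (1 - c))^-1 (Cd s0)) ltr01).
apply: Rintegrable_ext => r; have -> : t - s - (1 * r - s) = t - r by ring.
have -> : 1 * r - s = r - s by ring.
congr (_ * _); exact: d_kern s0.
Qed.

Lemma product_spec T L MA : 0 <= L ->
  (forall s t, 0 <= s -> 0 < t -> t <= T -> `|D t s| <= L * (t `^ (- c) * kern (1 - c) (t - s))) ->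
  0 <= MA -> (forall t, 0 < t <= T -> `|A t| <= MA) ->
  exists q : R -> R, [/\ Cg c q, forall t, 0 < t -> RL c q t = A t * RL c p t &
    forall lam S K, 0 <= lam -> S <= T -> 0 <= K -> wbound c lam S K p ->
      wbound c lam S ((MA + kap * (L * Gamma (1 - c) * kern (1 - c + 1) T)) * K) q].
Proof.
move=> L0 HL MA0 HA; exists q; split; first exact: Cq.
  have H := marchaud_product c0 c1 Cb cA A_derive mD Cp Cw pw J_regular J_le0 (fun r => erefl)
    DW_bound iDw iD iB (fun s t => @marchaud_kernel s t).
  exact: H.
move=> lam S K lam0 ST K0 HK t /andP[t0 tS].
have k0 : 0 <= kap by rewrite divr_ge0 ?(ltW c0)// ltW// Gamma_gt0.
have hJ : `|J t| <= L * Gamma (1 - c) * kern (1 - c + 1) T * K * (t `^ (- c) * expR (lam * t)).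
  by apply: (J_bound L0 HL lam0 ST K0 HK); rewrite t0.
have hp : `|p t| <= K * (t `^ (- c) * expR (lam * t)) by apply: HK; rewrite t0.
have hA : `|A t| <= MA by apply: HA; rewrite t0 (le_trans tS).
rewrite (_ : q t = A t * p t + kap * J t); last by [].
apply: (le_trans (ler_normD _ _)); rewrite (normrM (A t)) (normrM kap) (ger0_norm k0).
apply: (le_trans (lerD (ler_pM (normr_ge0 _) (normr_ge0 _) hA hp) (ler_wpM2l k0 hJ))).
rewrite le_eqVlt; apply/orP; left; apply/eqP.
by move: (kern _ _) (Gamma _) kap => U G k; ring.
Qed.
End factor.

(** C is chosen before p and lam: a large lam can later beat it. *)
Lemma product_regular T : exists2 C, 0 <= C & forall p, Cg c p -> exists q : R -> R,
  [/\ Cg c q, forall t, 0 < t -> RL c q t = (a0 + RL 1 b t) * RL c p t &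
    forall lam S K, 0 <= lam -> S <= T -> 0 <= K -> wbound c lam S K p -> wbound c lam S (C * K) q].
Proof.
have [L L0 HL] := D_bound T; have [MA MA0 HA] := continuous_bounded cA T.
have HA' t : 0 < t <= T -> `|A t| <= MA by move=> /andP[t0 tT]; apply: HA; rewrite gtr0_norm.
exists (MA + c / Gamma (1 - c) * (L * Gamma (1 - c) * kern (1 - c + 1) T)).
  have G0 := ltW (Gamma_gt0 c10).
  by rewrite addr_ge0// mulr_ge0 ?divr_ge0 ?(ltW c0)// !mulr_ge0// kern_ge0// addr_gt0.
move=> p Cp; exact: (product_spec Cp L0 HL MA0 HA').
Qed.
End product.

(** * The Volterra equation *)

Section contraction.
Variable R : realType.
Notation mu := (@lebesgue_measure R).
Implicit Types (f g h p q v : R -> R) (a b c k t s S : R).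

Lemma powR_le_expR (u th : R) : 0 < u -> 0 <= th <= 1 -> u `^ th <= expR u.
Proof.
move=> u0 /andP[th0 th1]; apply: le_trans (expR_ge1Dx u).
have [u1|u1] := leP u 1.
  apply: (@le_trans _ _ (1 `^ th)); last by rewrite powR1; lra.
  by apply: ge0_ler_powR; rewrite ?nnegrE// ltW.
apply: (@le_trans _ _ (u `^ 1)); first by apply: ler_powR => //; exact: ltW.
by rewrite powRr1 ?ltW//; lra.
Qed.

(** Part of the order is traded for smallness: x^th = lam^(-th) (lam x)^th, and (lam x)^th <= e^(lam
    x). *)
Lemma kern_expR_le (bt th lam x : R) : 0 < lam -> 0 <= th <= 1 -> th < bt ->
  kern bt x <= lam `^ (- th) * (Gamma (bt - th) / Gamma bt) * (kern (bt - th) x * expR (lam * x)).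
Proof.
move=> lam0 th01 thb; have [x0|x0] := leP x 0; first by rewrite !kern_le0// mul0r mulr0.
have th0 : 0 <= th by case/andP: th01.
have Gb : 0 < Gamma bt by rewrite Gamma_gt0//; lra.
have Gt : 0 < Gamma (bt - th) by rewrite Gamma_gt0//; lra.
have lx : 0 < lam * x by rewrite mulr_gt0.
have h := powR_le_expR lx th01.
rewrite !kern_gt0//.
have -> : x `^ (bt - 1) = x `^ (bt - th - 1) * x `^ th.
  by rewrite -gt0_powRD//; congr (_ `^ _); ring.
have -> : x `^ th = lam `^ (- th) * (lam * x) `^ th.
  rewrite powRM ?ltW// mulrA -gt0_powRD// addNr powRr0 mul1r//.
set X := x `^ _; set L := lam `^ _; set E := _ `^ th in h *.
have -> : L * (Gamma (bt - th) / Gamma bt) * (X / Gamma (bt - th) * expR (lam * x)) =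
   (L * X / Gamma bt) * expR (lam * x).
  by move: (Gamma _) (Gamma _) Gb Gt => U V U0 V0; field; rewrite !gt_eqF.
have -> : X * (L * E) / Gamma bt = (L * X / Gamma bt) * E by ring.
apply: ler_wpM2l; last exact: h.
by rewrite divr_ge0 ?mulr_ge0 ?powR_ge0 ?(ltW Gb).
Qed.

(** The exponential e^(lam (t - s)) from [kern_expR_le] and the e^(lam s) of the hypothesis combine
    to e^(lam t), and the factor lam^(-th) remains. *)
Lemma RL_contraction (c bt T eps : R) : c < 1 -> 0 < bt -> 0 < T -> 0 < eps ->
  exists2 lam0, 0 <= lam0 & forall lam, lam0 <= lam -> forall p S K, Cg c p -> S <= T -> 0 <= K ->
    wbound c lam S K p -> wbound c lam S (eps * K) (RL bt p).
Proof.
move=> c1 b0 T0 e0; have c10 : 0 < 1 - c by rewrite subr_gt0.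
(* Any th with 0 < th < bt and th <= 1 would do. *)
pose th := Num.min bt 1 / 2.
have m0 : 0 < Num.min bt 1 by rewrite lt_min b0 ltr01.
have mb : Num.min bt 1 <= bt by rewrite ge_min lexx.
have m1 : Num.min bt 1 <= 1 by rewrite ge_min lexx orbT.
have th0 : 0 < th by rewrite divr_gt0.
have thm : th < Num.min bt 1 by rewrite ltr_pdivrMr//; lra.
have thb : th < bt by rewrite (lt_le_trans thm).
have th1 : th <= 1 by rewrite ltW// (lt_le_trans thm).
have bth : 0 < bt - th by rewrite subr_gt0.
have b3 : 0 < bt - th + (1 - c) by rewrite addr_gt0.
pose C := (Gamma (bt - th) / Gamma bt) * Gamma (1 - c) * (T `^ (bt - th) / Gamma (bt - th + (1 - c))).
have C0 : 0 < C.
  by rewrite !mulr_gt0 ?invr_gt0 ?Gamma_gt0 ?powR_gt0.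
(* From this value on lam^(-th) C <= eps; the summand 1 makes lam positive. *)
exists ((C / eps) `^ th^-1 + 1) => [|lam lamge p S K Cp ST K0 HK t /andP[t0 tS]].
  by rewrite addr_ge0// powR_ge0.
have lam0 : 0 < lam by apply: lt_le_trans lamge; rewrite ltr_wpDl// powR_ge0.
have hl : lam `^ (- th) * C <= eps.
  rewrite powRN mulrC ler_pdivrMr ?powR_gt0// mulrC -ler_pdivrMr//.
  apply: (@le_trans _ _ (((C / eps) `^ th^-1) `^ th)).
    by rewrite -powRrM mulVf ?gt_eqF// powRr1// divr_ge0 ?ltW.
  apply: ge0_ler_powR; rewrite ?nnegrE ?powR_ge0 ?(ltW th0) ?(ltW lam0)//.
  by apply: le_trans lamge; rewrite lerDl.
pose X := K * expR (lam * t) * (lam `^ (- th) * (Gamma (bt - th) / Gamma bt) * Gamma (1 - c)).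
have X0 : 0 <= X.
  have G1 := ltW (Gamma_gt0 b0); have G2 := ltW (Gamma_gt0 bth); have G3 := ltW (Gamma_gt0 c10).
  by rewrite /X !mulr_ge0 ?expR_ge0 ?powR_ge0 ?divr_ge0 ?invr_ge0.
have iR := Rintegrable_RL t c1 Cp b0.
have iK := @integrable_conv_kern R (bt - th) (1 - c) t bth c10.
apply: (@le_trans _ _ (\int[mu]_s (X * (kern (bt - th) (t - s) * kern (1 - c) s)))).
  apply: Rintegral_norm_le => [//||s]; first exact: RintegrableZl.
  have [s0|s0] := leP s 0.
    by rewrite /pospart ltNge s0/= (kern_le0 _ s0) !mulr0 normr0.
  have [ts|st] := leP t s.
    by rewrite !(@kern_le0 _ _ (t - s)) ?subr_le0// !mul0r mulr0 normr0.
  rewrite /pospart s0 normrM (ger0_norm (kern_ge0 _ b0)).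
  have sS : 0 < s <= S by rewrite s0 ltW// (lt_le_trans st).
  have h1 := @kern_expR_le bt th lam (t - s) lam0 _ thb.
  have h2 := HK s sS.
  apply: (le_trans (ler_pM (kern_ge0 _ b0) (normr_ge0 _) (h1 _) h2)); first by rewrite ltW.
  rewrite (kern_powRN s0 c1) /X le_eqVlt; apply/orP; left; apply/eqP.
  have -> : expR (lam * t) = expR (lam * (t - s)) * expR (lam * s).
    by rewrite -expRD; congr expR; ring.
  by move: (kern _ _) (kern _ _) (Gamma (1 - c)) => U V W; ring.
rewrite RintegralTZl// Rconv_kern// kern_gt0//.
have h3 : t `^ (bt - th + (1 - c) - 1) <= T `^ (bt - th) * t `^ (- c).
  rewrite (_ : bt - th + (1 - c) - 1 = (bt - th) + (- c)); last by ring.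
  rewrite gt0_powRD//; apply: ler_wpM2r; first exact: powR_ge0.
  by apply: ge0_ler_powR; rewrite ?nnegrE ?(ltW t0) ?(ltW bth) ?(ltW T0)// (le_trans tS).
have G0 := Gamma_gt0 b3.
apply: (@le_trans _ _ (X * (T `^ (bt - th) * t `^ (- c) / Gamma (bt - th + (1 - c))))).
  by apply: ler_wpM2l => //; apply: ler_wpM2r => //; rewrite invr_ge0 ltW.
have -> : X * (T `^ (bt - th) * t `^ (- c) / Gamma (bt - th + (1 - c))) =
    lam `^ (- th) * C * (K * (t `^ (- c) * expR (lam * t))).
  by rewrite /X /C; move: (Gamma _) (Gamma _) (Gamma _) (Gamma _) => U V W Z; ring.
rewrite -[leRHS]mulrA; apply: ler_wpM2r => //.
by rewrite !mulr_ge0 ?powR_ge0 ?expR_ge0.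
Qed.

Lemma RLint_RL a c f : 0 < a -> c < 1 -> Cg c f -> RLint a f = RL a f.
Proof. by move=> a0 c1 Cf; apply/funext => t; exact: (RLintE a0 c1 Cf). Qed.

Lemma RLint0E f : RLint 0 f = f.
Proof. by apply/funext => t; rewrite /RLint eqxx. Qed.

Lemma RLintD a c f g : 0 <= a -> c < 1 -> Cg c f -> Cg c g ->
  forall t, RLint a (fun s => f s + g s) t = RLint a f t + RLint a g t.
Proof.
rewrite le_eqVlt => /predU1P[<-|a0] c1 Cf Cg_g t; first by rewrite !RLint0E.
by rewrite !(RLint_RL a0 c1)//; [exact: RLD c1 Cf Cg_g|exact: CgD].
Qed.

Lemma RLintZ a c k f : 0 <= a -> c < 1 -> Cg c f ->
  forall t, RLint a (fun s => k * f s) t = k * RLint a f t.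
Proof.
rewrite le_eqVlt => /predU1P[<-|a0] c1 Cf t; first by rewrite !RLint0E.
by rewrite !(RLint_RL a0 c1)//; [exact: RLZ c1 Cf|exact: CgZ].
Qed.

Lemma RLint_Cg a c f : 0 <= a -> c < 1 -> Cg c f -> Cg c (RLint a f).
Proof.
rewrite le_eqVlt => /predU1P[<-|a0] c1 Cf; first by rewrite RLint0E.
by rewrite (RLint_RL a0 c1 Cf); exact: RL_Cg.
Qed.

Lemma RLint_semigroup a b c f : 0 <= a -> 0 <= b -> c < 1 -> Cg c f ->
  RLint a (RLint b f) = RLint (a + b) f.
Proof.
rewrite le_eqVlt => /predU1P[<-|a0]; first by rewrite RLint0E add0r.
rewrite le_eqVlt => /predU1P[<-|b0] c1 Cf; first by rewrite RLint0E addr0.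
rewrite (RLint_RL b0 c1 Cf) (RLint_RL a0 c1 (RL_Cg b0 c1 Cf)) (RLint_RL (addr_gt0 a0 b0) c1 Cf).
by apply/funext => t; exact: RL_semigroup c1 Cf.
Qed.

Lemma RLint_RL_comm a b c f : 0 < b -> 0 <= a -> c < 1 -> Cg c f -> RLint a (RL b f) = RL (b + a) f.
Proof.
move=> b0 a0 c1 Cf; rewrite -(RLint_RL b0 c1 Cf) (RLint_semigroup a0 (ltW b0) c1 Cf) addrC.
by rewrite (RLint_RL _ c1 Cf)// ltr_pwDl.
Qed.

(** For c = 0, I^c is the identity: q is the plain product and C a bound of the factor on
    [-T, T]. *)
Lemma product_regularW c a0 (b : R -> R) T : 0 <= c -> c < 1 -> Cg c b -> exists2 C, 0 <= C &
  forall p, Cg c p -> exists q,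
  [/\ Cg c q, forall t, 0 < t -> RLint c q t = (a0 + RL 1 b t) * RLint c p t &
    forall lam S K, 0 <= lam -> S <= T -> 0 <= K -> wbound c lam S K p -> wbound c lam S (C * K) q].
Proof.
rewrite le_eqVlt => /predU1P[<-|c0] c1 Cb; last first.
  have [C C0 HC] := product_regular a0 c0 c1 Cb T; exists C => // p Cp.
  have [q [Cq qE qb]] := HC p Cp; exists q; split => // t t0.
  by rewrite (RLint_RL c0 c1 Cq) (RLint_RL c0 c1 Cp) qE.
have cA : continuous (fun t => a0 + RL 1 b t).
  move=> t; apply: cvgD; first exact: cvg_cst.
  exact: (RL_continuous ltr01 c1 ltr01 Cb).
have [M M0 HM] := continuous_bounded cA T; exists M => // p Cp.
exists (fun t => (a0 + RL 1 b t) * p t); split; first exact: CgM.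
- by move=> t _; rewrite !RLint0E.
- move=> lam S K lam0 ST K0 HK t tS; rewrite normrM -mulrA.
  apply: ler_pM => //; last exact: HK.
  by case/andP: tS => t0 tS; apply: HM; rewrite gtr0_norm// (le_trans tS).
Qed.

Lemma wbound_le c lam S K K' f : K <= K' -> wbound c lam S K f -> wbound c lam S K' f.
Proof.
move=> KK' H t tS; apply: (le_trans (H t tS)); apply: ler_wpM2r => //.
by rewrite mulr_ge0 ?powR_ge0 ?expR_ge0.
Qed.

Lemma wboundD c lam S K K' f g : wbound c lam S K f -> wbound c lam S K' g ->
  wbound c lam S (K + K') (fun t => f t + g t).
Proof.
move=> Hf Hg t tS; rewrite mulrDl; apply: (le_trans (ler_normD _ _)).
by apply: lerD; [exact: Hf|exact: Hg].
Qed.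

Section system.
Variables (c T : R) (bt a0 : nat -> R) (b : nat -> R -> R).
Hypotheses (c0 : 0 <= c) (c1 : c < 1) (T0 : 0 < T).

(** Serves the inhomogeneous term, a sum of products a_i I^c p_i that must be exhibited as one I^c
    q. *)
Lemma sum_product (r : seq nat) (p : nat -> R -> R) : (forall i, i \in r -> Cg c (b i)) ->
  (forall i, i \in r -> Cg c (p i)) ->
  exists2 q, Cg c q & forall t, 0 < t ->
    RLint c q t = \sum_(i <- r) (a0 i + RL 1 (b i) t) * RLint c (p i) t.
Proof.
elim: r => [|i r IH] Cb Cp.
  exists (fun=> 0); first exact: Cg0.
  move=> t t0; rewrite big_nil; have := @RLintZ c c 0 (fun=> 0) c0 c1 (Cg0 c) t.
  by rewrite !mul0r.
have [||q Cq qE] := IH; [by move=> j jr; apply: Cb; rewrite inE jr orbT|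
  by move=> j jr; apply: Cp; rewrite inE jr orbT|].
have [C C0 /(_ (p i)) HC] := product_regularW (a0 i) T c0 c1 (Cb i (mem_head _ _)).
have [q' [Cq' qE' _]] := HC (Cp i (mem_head _ _)).
exists (fun t => q' t + q t); first exact: CgD.
by move=> t t0; rewrite big_cons (RLintD c0 c1 Cq' Cq) qE'// qE.
Qed.

(** Each term is a_i I^c (I^(bt_i) v): the inner integral is small for large lam, and the product
    costs a constant only. The head and the tail of the sum get eps / 2 each. *)
Lemma sum_contraction (r : seq nat) : (forall i, i \in r -> Cg c (b i) /\ 0 < bt i) ->
  forall eps, 0 < eps -> exists2 lam0, 0 <= lam0 & forall lam, lam0 <= lam ->
  forall v, Cg c v -> exists q, [/\ Cg c q,
    forall t, 0 < t -> RLint c q t = \sum_(i <- r) (a0 i + RL 1 (b i) t) * RL (bt i + c) v t &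
    forall S K, S <= T -> 0 <= K -> wbound c lam S K v -> wbound c lam S (eps * K) q].
Proof.
elim: r => [|i r IH] Hr eps e0.
  exists 0 => // lam lam0 v Cv; exists (fun=> 0); split; first exact: Cg0.
  - move=> t t0; rewrite big_nil; have := @RLintZ c c 0 (fun=> 0) c0 c1 (Cg0 c) t.
    by rewrite !mul0r.
  - move=> S K ST K0 _ t tS; rewrite normr0 !mulr_ge0 ?powR_ge0 ?expR_ge0//; exact: ltW.
have [Cb bi0] := Hr i (mem_head _ _).
have e20 : 0 < eps / 2 by rewrite divr_gt0.
have [|l1 l10 H1] := IH _ (eps / 2) e20; first by move=> j jr; apply: Hr; rewrite inE jr orbT.
have [C C0 HC] := product_regularW (a0 i) T c0 c1 Cb.
(* The product multiplies the bound by C, which may be 0; hence C + 1 in the denominator. *)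
have e3 : 0 < eps / 2 / (C + 1) by rewrite divr_gt0// ltr_wpDl.
have [l2 l20 H2] := RL_contraction c1 bi0 T0 e3.
exists (Num.max l1 l2) => [|lam]; first by rewrite le_max l10.
rewrite ge_max => /andP[ll1 ll2] v Cv.
have lam0 : 0 <= lam by rewrite (le_trans l10).
have CR := RL_Cg bi0 c1 Cv.
have [q [Cq qE qb]] := H1 lam ll1 v Cv.
have [q' [Cq' qE' qb']] := HC _ CR.
exists (fun t => q' t + q t); split; first exact: CgD.
- move=> t t0; rewrite big_cons (RLintD c0 c1 Cq' Cq) qE'// qE//.
  by rewrite (RLint_RL_comm bi0 c0 c1 Cv).
- move=> S K ST K0 HK.
  have h1 := H2 lam ll2 v S K Cv ST K0 HK.
  have e3K : 0 <= eps / 2 / (C + 1) * K by rewrite mulr_ge0// ltW.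
  have h2 := qb' lam S _ lam0 ST e3K h1.
  have h3 := qb S K ST K0 HK.
  rewrite (_ : eps * K = eps / 2 * K + eps / 2 * K); last by field.
  apply: wboundD => //; apply: wbound_le h2.
  rewrite !mulrA; apply: ler_wpM2r => //.
  have -> : C * eps / 2 / (C + 1) = eps / 2 * (C / (C + 1)) by field; rewrite gt_eqF// ltr_wpDl.
  rewrite -[leRHS]mulr1; apply: ler_wpM2l; first exact: ltW.
  by rewrite ler_pdivrMr ?ltr_wpDl// mul1r lerDl.
Qed.
End system.
End contraction.

(** * Summation of the Neumann series, existence and uniqueness for the Volterra equation *)

Section series.
Variable R : realType.
Implicit Types (f g h p q v : R -> R) (a b c t s S T K M x : R).

Lemma le_div_expn_eq0 (x C : R) : 0 <= C -> (forall n : nat, x <= C / 2 ^+ n) -> x <= 0.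
Proof.
move=> C0 H; apply/ler_addgt0Pr => e e0; rewrite add0r.
have eC : 0 < e / (C + 1) by rewrite divr_gt0// ltr_wpDl.
have /(@filter_ex _ _ _) [n /= hn] := near_infty_natSinv_expn_lt (PosNum eC).
apply: (le_trans (H n)).
have C10 : 0 < C + 1 by rewrite ltr_wpDl.
apply: (@le_trans _ _ ((C + 1) * (e / (C + 1)))); last by rewrite mulrC divfK// gt_eqF.
apply: (@le_trans _ _ ((C + 1) / 2 ^+ n)).
  by apply: ler_wpM2r; [rewrite invr_ge0 exprn_ge0|rewrite lerDl].
by apply: ler_wpM2l; [exact: ltW|rewrite -div1r; exact: ltW].
Qed.

(** The subtracted term closes the induction: M / 2^n is exactly 2 M / 2^n - 2 M / 2^(n + 1). *)
Lemma tail_bound (u : nat -> R) M : (forall n, `|u n| <= M / 2 ^+ n) ->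
  forall N j, `|series u (N + j)%N - series u N| <= 2 * M / 2 ^+ N - 2 * M / 2 ^+ (N + j).
Proof.
move=> H N; elim=> [|j IH]; first by rewrite addn0 !subrr normr0.
rewrite addnS (_ : series u (N + j).+1 = series u (N + j)%N + u (N + j)%N); last first.
  by rewrite /series/= big_nat_recr.
rewrite addrAC; apply: (le_trans (ler_normD _ _)).
apply: (le_trans (lerD IH (H _))).
rewrite exprS le_eqVlt; apply/orP; left; apply/eqP.
have := exprn_gt0 (N + j) (ltr0n R 2); have := exprn_gt0 N (ltr0n R 2).
move: (2 ^+ N) (2 ^+ (N + j)) => X Y X0 Y0; field.
by rewrite !gt_eqF.
Qed.

Lemma M_test (u : nat -> R -> R) M : (forall n, continuous (u n)) ->
  (forall n x, `|u n x| <= M / 2 ^+ n) ->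
  exists2 G : R -> R, continuous G &
    forall N x, `|G x - \sum_(0 <= k < N) u k x| <= 2 * M / 2 ^+ N.
Proof.
move=> cu bu.
have M0 : 0 <= M by have := bu 0%N 0; rewrite expr0 divr1; exact: le_trans.
have cv x : cvgn (series (fun n => u n x)).
  apply: normed_cvg; apply: (@series_le_cvg _ _ (geometric M 2^-1)) => [n|n|n|].
  - exact: normr_ge0.
  - by rewrite /= mulr_ge0// exprn_ge0// invr_ge0.
  - by rewrite /= exprVn; exact: bu.
  - by apply: is_cvg_geometric_series; rewrite gtr0_norm ?invf_lt1// ltr1n.
pose G x := limn (series (fun n => u n x)).
have bG N x : `|G x - \sum_(0 <= k < N) u k x| <= 2 * M / 2 ^+ N.
  have h : `|series (fun n => u n x) n - series (fun n => u n x) N| @[n --> \oo] -->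
      `|G x - series (fun n => u n x) N|.
    by apply: cvg_norm; apply: cvgB; [exact: cv|exact: cvg_cst].
  rewrite -[leLHS](cvg_lim _ h)//; apply: limr_le; first exact: cvgP h.
  near=> n; have Nn : (N <= n)%N by near: n; exact: nbhs_infty_ge.
  rewrite -(subnKC Nn); apply: (le_trans (tail_bound (bu ^~ x) N (n - N))).
  by rewrite lerBlDr lerDl divr_ge0 ?mulr_ge0 ?exprn_ge0.
exists G => // x; apply/cvgrPdist_lt => e e0.
have e3 : 0 < e / 3 / (2 * M + 1) by rewrite !divr_gt0// ltr_wpDl// mulr_ge0.
have /(@filter_ex _ _ _) [N /= hN] := near_infty_natSinv_expn_lt (PosNum e3).
have hb : 2 * M / 2 ^+ N < e / 3.
  have M1 : 0 < 2 * M + 1 by rewrite ltr_wpDl// mulr_ge0.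
  apply: (@le_lt_trans _ _ ((2 * M + 1) / 2 ^+ N)).
    by apply: ler_wpM2r; [rewrite invr_ge0 exprn_ge0|rewrite lerDl].
  by rewrite -ltr_pdivlMl// mulrC; rewrite div1r in hN.
have cS : {for x, continuous (fun x => \sum_(0 <= k < N) u k x)}.
  elim: N {hN hb} => [|N IH].
    rewrite /prop_for /continuous_at; under eq_fun do rewrite big_geq//.
    by rewrite big_geq//; exact: cvg_cst.
  rewrite /prop_for /continuous_at; under eq_fun do rewrite big_nat_recr//=.
  by rewrite big_nat_recr//=; apply: cvgD; [exact: IH|exact: cu].
move/cvgrPdist_lt : cS => /(_ (e / 3)) cS.
have e30 : 0 < e / 3 by rewrite divr_gt0.
near=> y.
have h1 := bG N x; have h2 := bG N y.
have h3 : `|\sum_(0 <= k < N) u k x - \sum_(0 <= k < N) u k y| < e / 3.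
  by near: y; exact: cS.
move: h1 h2 h3 hb; move: (\sum_(_ <= _ < _) _) (\sum_(_ <= _ < _) _) (2 * M / _) => X Y Z.
rewrite !ler_distl !ltr_distl => /andP[? ?] /andP[? ?] /andP[? ?] ?.
by apply/andP; split; lra.
Unshelve. all: by end_near. Qed.

Lemma continuous_clamp T : continuous (fun x : R => Num.max 0 (Num.min x T) : R).
Proof.
move=> x; have h : {for x, continuous ((fun y : R => y : R^o) \min (fun=> T : R^o))}.
  by apply: continuous_min; [exact: cvg_id|exact: cvg_cst].
have := @continuous_max R R (fun=> 0 : R^o) _ x _ h; apply; exact: cvg_cst.
Qed.

(** The M-test is applied to the continuous factors of the terms, composed with the clamp to [0, T]
    to make the bounds global. Since T is fixed, e^(lam t) <= e^(lam T) enters the constant and the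
    tail bounds no longer carry an exponential. *)
Lemma series_Cg c lam T K (vs : nat -> R -> R) : 0 <= lam -> 0 < T ->
  (forall k, Cg c (vs k)) -> (forall k, wbound c lam T (K / 2 ^+ k) (vs k)) ->
  exists v C, [/\ 0 <= C, Cg c v &
    forall N, wbound c 0 T (C / 2 ^+ N) (fun t => v t - \sum_(0 <= k < N) vs k t)].
Proof.
move=> lam0 T0 Cv bv.
have [u Hu] : {u : nat -> R -> R & forall k, continuous (u k) /\ forall t, 0 < t -> vs k t = t `^ (- c) * u k t}.
  apply: (@choice _ _ (fun k u => continuous u /\ forall t, 0 < t -> vs k t = t `^ (- c) * u t)) => k.
  by have [w cw ww] := Cv k; exists w.
have K0 : 0 <= K.
  have := bv 0%N T; rewrite T0 lexx expr0 divr1 => /(_ isT) => h.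
  have := le_trans (normr_ge0 _) h; rewrite pmulr_lge0//.
  by rewrite mulr_gt0 ?powR_gt0 ?expR_gt0.
pose M := K * expR (lam * T).
have M0 : 0 <= M by rewrite mulr_ge0// expR_ge0.
pose clamp := fun x : R => Num.max 0 (Num.min x T) : R.
have bu k t : 0 < t <= T -> `|u k t| <= M / 2 ^+ k.
  move=> tT; case/andP: (tT) => t0 t1.
  have := bv k t tT; rewrite (Hu k).2// normrM (ger0_norm (powR_ge0 _ _)).
  rewrite mulrCA ler_pM2l ?powR_gt0// => h; apply: (le_trans h).
  rewrite /M -!mulrA (mulrC _ (2 ^- k)); apply: ler_wpM2l => //.
  by apply: ler_wpM2l; [rewrite invr_ge0 exprn_ge0|rewrite ler_expR ler_wpM2l].
(* The hypothesis says nothing at 0; the bound there follows by right continuity. *)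
have bu0 k : `|u k 0| <= M / 2 ^+ k.
  have h : `|u k t| @[t --> 0^'+] --> `|u k 0|.
    by apply: cvg_norm; apply: cvg_at_right_filter; exact: (Hu k).1.
  rewrite -[leLHS](cvg_lim _ h)//; apply: limr_le; first exact: cvgP h.
  near=> t; apply: bu; apply/andP; split; near: t; [exact: nbhs_right_gt|exact: nbhs_right_le].
have clampE t : 0 < t <= T -> clamp t = t.
  by move=> /andP[t0 tT]; rewrite /clamp (min_idPl tT) (max_idPr (ltW t0)).
have cclamp : continuous clamp.
  exact: continuous_clamp.
have bclamp k x : `|u k (clamp x)| <= M / 2 ^+ k.
  have [x0|x0] := leP x 0.
    have -> : clamp x = 0; last exact: bu0.
    by rewrite /clamp; apply: max_l; rewrite ge_min x0.
  have [xT|Tx] := leP x T; first by rewrite clampE ?x0//; apply: bu; rewrite x0.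
  rewrite /clamp (min_idPr (ltW Tx)) (max_idPr (ltW T0)).
  by apply: bu; rewrite T0 lexx.
have cc k : continuous (fun x => u k (clamp x)).
  move=> x; apply: (@continuous_comp _ _ _ clamp (u k)); first exact: cclamp.
  exact: (Hu k).1.
have [G cG bG] := M_test cc bclamp.
exists (fun t => t `^ (- c) * G t), (2 * M); split; first by rewrite mulr_ge0.
  by exists G.
move=> N t tT; case/andP: (tT) => t0 t1.
have -> : \sum_(0 <= k < N) vs k t = t `^ (- c) * \sum_(0 <= k < N) u k (clamp t).
  by rewrite big_distrr/=; apply: eq_bigr => k _; rewrite (Hu k).2// clampE.
rewrite -mulrBr normrM (ger0_norm (powR_ge0 _ _)) mul0r expR0 mulr1 mulrC.
by apply: ler_wpM2r; [exact: powR_ge0|exact: bG].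
Unshelve. all: by end_near. Qed.

Lemma cvg_of_div_expn (x : nat -> R) (y C : R) : 0 <= C ->
  (forall n, `|y - x n| <= C / 2 ^+ n) -> x n @[n --> \oo] --> y.
Proof.
move=> C0 H; apply/cvgrPdist_lt => e e0.
have eC : 0 < e / (C + 1) by rewrite divr_gt0// ltr_wpDl.
near=> n; apply: (le_lt_trans (H n)).
have C10 : 0 < C + 1 by rewrite ltr_wpDl.
apply: (@le_lt_trans _ _ ((C + 1) / 2 ^+ n)).
  by apply: ler_wpM2r; [rewrite invr_ge0 exprn_ge0|rewrite lerDl].
rewrite -ltr_pdivlMl// mulrC -[X in X < _]div1r; near: n.
exact: (near_infty_natSinv_expn_lt (PosNum eC)).
Unshelve. all: by end_near. Qed.

(** The tail is O(t^(-c)) with a geometric constant, and [wbound_RL] integrates this bound. *)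
Lemma RL_series a c T C v (vs : nat -> R -> R) : 0 < a -> c < 1 -> 0 <= C -> Cg c v ->
  (forall k, Cg c (vs k)) ->
  (forall N, wbound c 0 T (C / 2 ^+ N) (fun t => v t - \sum_(0 <= k < N) vs k t)) ->
  forall t, t <= T -> series (fun k => RL a (vs k) t) n @[n --> \oo] --> RL a v t.
Proof.
move=> a0 c1 C0 Cv Cvs bv t tT.
have CS N : Cg c (fun t => -1 * \sum_(0 <= k < N) vs k t) by apply: CgZ; exact: Cg_sum.
have c10 : 0 < a + (1 - c) by rewrite addr_gt0// subr_gt0.
have G0 : 0 <= Gamma (1 - c) * kern (a + (1 - c)) t.
  by rewrite mulr_ge0 ?kern_ge0// ltW// Gamma_gt0// subr_gt0.
apply: (@cvg_of_div_expn _ _ (C * (Gamma (1 - c) * kern (a + (1 - c)) t))).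
  by rewrite mulr_ge0.
move=> N; have CN : 0 <= C / 2 ^+ N by rewrite divr_ge0// exprn_ge0.
have Cd : Cg c (fun t => v t - \sum_(0 <= k < N) vs k t).
  by apply: (Cg_ext _ (CgD Cv (CS N))) => s _; rewrite mulN1r.
have := wbound_RL a0 c1 Cd (lexx 0) CN (bv N) tT.
have -> : RL a (fun t => v t - \sum_(0 <= k < N) vs k t) t = RL a v t - series (fun k => RL a (vs k) t) N.
  rewrite /series/= -(RL_sum _ t a0 c1 Cvs) -mulN1r -(RLZ (-1) t a0 c1 (Cg_sum _ (fun k _ => Cvs k))).
  rewrite -(RLD t a0 c1 Cv (CS N)); apply: eq_RL => s _; by rewrite mulN1r.
move=> h; apply: (le_trans h); rewrite mul0r expR0 mulr1.
by rewrite mulrAC.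
Qed.

Section volterra.
Variables (c T : R) (bt a0 : nat -> R) (b : nat -> R -> R) (r : seq nat).
Hypotheses (c0 : 0 <= c) (c1 : c < 1) (T0 : 0 < T).
Hypothesis Hr : forall i, i \in r -> Cg c (b i) /\ 0 < bt i.

Let opV v t := \sum_(i <- r) (a0 i + RL 1 (b i) t) * RL (bt i + c) v t.

Let wbound_exists lam S v : 0 <= lam -> Cg c v -> exists2 K, 0 <= K & wbound c lam S K v.
Proof.
move=> lam0 Cv; have [M M0 HM] := Cg_bound Cv S; exists M => // t tS.
apply: (le_trans (HM t tS)); apply: ler_wpM2l => //.
rewrite ler_peMr ?powR_ge0// -expR0 ler_expR mulr_ge0//.
by case/andP: tS => /ltW.
Qed.

Let contraction : exists2 lam, 0 <= lam & forall v, Cg c v -> exists q, [/\ Cg c q,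
    forall t, 0 < t -> RLint c q t = - opV v t &
    forall S K, S <= T -> 0 <= K -> wbound c lam S K v -> wbound c lam S (K / 2) q].
Proof.
have h2 : 0 < 2^-1 :> R by rewrite invr_gt0.
have [lam lam0 H] := sum_contraction a0 c0 c1 T0 Hr h2.
exists lam => // v Cv; have [q [Cq qE qb]] := H lam (lexx _) v Cv.
exists (fun t => -1 * q t); split; first exact: CgZ.
- by move=> t t0; rewrite (RLintZ (-1) c0 c1 Cq) mulN1r qE.
- move=> S K ST K0 HK t tS; rewrite mulN1r normrN (_ : K / 2 = 2^-1 * K); last exact: mulrC.
  exact: (qb S K ST K0 HK t tS).
Qed.

(** The identities I^c v_(k+1) = - [opV] v_k are summed and pass to the limit, fractional integrals
    acting termwise on the series. *)
Lemma volterra_series v0 : Cg c v0 -> exists (vs : nat -> R -> R) v,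
  [/\ vs 0%N = v0, forall k, Cg c (vs k),
    forall k t, 0 < t -> RLint c (vs k.+1) t = - opV (vs k) t,
    Cg c v /\ (forall a t, 0 < a -> t <= T -> series (fun k => RL a (vs k) t) n @[n --> \oo] --> RL a v t) &
    forall t, 0 < t <= T -> RLint c v t = RLint c v0 t - opV v t].
Proof.
move=> Cv0; have [lam lam0 H] := contraction.
(* Choice requires an image of every function; outside [Cg c] it is v itself, a dummy value. *)
have [B HB] : {B : (R -> R) -> (R -> R) & forall v, Cg c v -> [/\ Cg c (B v),
    forall t, 0 < t -> RLint c (B v) t = - opV v t &
    forall S K, S <= T -> 0 <= K -> wbound c lam S K v -> wbound c lam S (K / 2) (B v)]}.
  apply: (@choice _ _ (fun v q => Cg c v -> [/\ Cg c q, forall t, 0 < t -> RLint c q t = - opV v t &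
    forall S K, S <= T -> 0 <= K -> wbound c lam S K v -> wbound c lam S (K / 2) q])) => v.
  have [Cv|nCv] := pselect (Cg c v); last by exists v.
  by have [q Hq] := H v Cv; exists q.
pose vs k := iter k B v0.
have Cvs k : Cg c (vs k).
  by elim: k => // k IH; rewrite /vs iterS; have [] := HB _ IH.
have [K K0 bK] := wbound_exists T lam0 Cv0.
have bvs k : wbound c lam T (K / 2 ^+ k) (vs k).
  elim: k => [|k IH]; first by rewrite expr0 divr1.
  have [_ _ h] := HB _ (Cvs k).
  have := h T _ (lexx _) _ IH; rewrite divr_ge0 ?exprn_ge0// => /(_ isT).
  by rewrite -[_ / 2]mulrA -invfM -exprSr.
have [v [C [C0 Cv bv]]] := series_Cg lam0 T0 Cvs bvs.
have cvRL a t : 0 < a -> t <= T -> series (fun k => RL a (vs k) t) n @[n --> \oo] --> RL a v t.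
  by move=> ap tT; exact: (RL_series ap c1 C0 Cv Cvs bv).
exists vs, v; split=> //; first by move=> k; have [] := HB _ (Cvs k).
move=> t /andP[t0 tT].
have cvI : series (fun k => RLint c (vs k) t) n @[n --> \oo] --> RLint c v t.
  have [c00|cp] := eqVneq c 0.
    rewrite c00 RLint0E; under eq_fun do rewrite /series/=; under eq_fun do under eq_bigr do rewrite RLint0E.
    apply: (@cvg_of_div_expn _ _ (C * (t `^ (- c) * expR (0 * t)))) => [|N].
      by rewrite mulr_ge0// mulr_ge0 ?powR_ge0 ?expR_ge0.
    by have := bv N t; rewrite t0 tT => /(_ isT); rewrite mulrAC.
  have cpos : 0 < c by rewrite lt_neqAle eq_sym cp.
  rewrite (RLint_RL cpos c1 Cv).
  rewrite (_ : (fun k => RLint c (vs k) t) = (fun k => RL c (vs k) t)); first exact: cvRL.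
  by apply/funext => k; rewrite (RLint_RL cpos c1 (Cvs k)).
have cvO : \sum_(i <- r) (a0 i + RL 1 (b i) t) * series (fun k => RL (bt i + c) (vs k) t) n @[n --> \oo] --> opV v t.
  rewrite /opV; elim: r Hr => [|i r' IH] Hr'.
    by under eq_fun do rewrite big_nil; rewrite big_nil; exact: cvg_cst.
  under eq_fun do rewrite big_cons; rewrite big_cons; apply: cvgD; last first.
    by apply: IH => j jr; apply: Hr'; rewrite inE jr orbT.
  apply: cvgM; first exact: cvg_cst.
  apply: cvRL => //; have [_ bi0] := Hr' i (mem_head _ _).
  by rewrite ltr_pwDl.
(* One more term on the left: the initial term is split off, and the n others come from v_0, ...,
   v_(n-1). *)
have E n : series (fun k => RLint c (vs k) t) n.+1 = RLint c v0 t -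
    \sum_(i <- r) (a0 i + RL 1 (b i) t) * series (fun k => RL (bt i + c) (vs k) t) n.
  rewrite /series/= big_nat_recl//; congr (_ + _).
  transitivity (\sum_(0 <= k < n) - opV (vs k) t).
    by apply: eq_bigr => k _; have [_ -> //] := HB _ (Cvs k).
  rewrite sumrN; congr (- _); rewrite /opV exchange_big/=.
  by apply: eq_bigr => i _; rewrite big_distrr.
have cv2 : series (fun k => RLint c (vs k) t) n.+1 @[n --> \oo] --> RLint c v0 t - opV v t.
  by under eq_fun do rewrite E; apply: cvgB => //; exact: cvg_cst.
rewrite -(cvg_lim _ cv2)//; apply/esym/cvg_lim => //.
by rewrite (cvg_shiftS (series (fun k => RLint c (vs k) t))); exact: cvI.
Qed.

(** Injectivity of I^c identifies w with its own image, so any bound on w can be halved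
    indefinitely. *)
Lemma volterra_unique w S : Cg c w -> S <= T ->
  (forall t, 0 < t < S -> RLint c w t = - opV w t) -> forall t, 0 < t < S -> w t = 0.
Proof.
move=> Cw ST wE; have [lam lam0 H] := contraction.
have [q [Cq qE qb]] := H w Cw.
have qw t : 0 < t < S -> q t = w t.
  have E s : 0 < s < S -> RLint c q s = RLint c w s.
    by move=> sS; rewrite wE// qE//; case/andP: sS.
  have [c00|cp] := eqVneq c 0.
    by move=> /E; rewrite c00 !RLint0E.
  have cpos : 0 < c < 1 by rewrite lt_neqAle eq_sym cp c0.
  move: t; apply: (RL_inj cpos c1 Cq Cw) => s /E.
  by rewrite (RLint_RL _ c1 Cq) ?(RLint_RL _ c1 Cw)//; case/andP: cpos.
have [K K0 bK] := wbound_exists S lam0 Cw.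
(* The equality with the image holds on the open interval only, while weighted bounds include their
   right endpoint; hence S' < S. *)
have bn n S' : S' < S -> wbound c lam S' (K / 2 ^+ n) w.
  elim: n S' => [|n IH] S' S'S.
    by rewrite expr0 divr1 => t /andP[t0 tS]; apply: bK; rewrite t0 (le_trans tS)// ltW.
  move=> t tS; rewrite -qw; last by case/andP: tS => -> h; rewrite (le_lt_trans h).
  have KK : 0 <= K / 2 ^+ n by rewrite divr_ge0// exprn_ge0.
  have := qb S' _ (le_trans (ltW S'S) ST) KK (IH S' S'S) t tS.
  by rewrite -[_ / 2 ^+ n / 2]mulrA -invfM -exprSr.
move=> t /andP[t0 tS]; apply/eqP; rewrite -normr_le0.
apply: (@le_div_expn_eq0 _ (K * (t `^ (- c) * expR (lam * t)))).
  by rewrite mulr_ge0// mulr_ge0 ?powR_ge0 ?expR_ge0.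
by move=> n; have := bn n t tS t; rewrite t0 lexx => /(_ isT); rewrite mulrAC.
Qed.
End volterra.
End series.

(** * Derivatives relative to [0, T] and Caputo derivatives *)

Definition has_deriv_on (R : realType) (A : set R) (f : R -> R) (x l : R) : Prop :=
  (f y - f x) / (y - x) @[y --> within A x^'] --> l.

Section deriv_on.
Variable R : realType.
Implicit Types (f g u v : R -> R) (t T l x y : R).

(** Uniqueness of the limit defining [deriv_on] needs t to be an accumulation point of [0, T];
    points are taken to the right of t, or to the left if t = T. *)
Lemma within_dnbhs_proper T t : 0 < T -> 0 <= t <= T -> ProperFilter (within `[0, T] t^').
Proof.
move=> T0 /andP[t0 tT]; apply: Build_ProperFilter_ex => P.
rewrite /within/= /dnbhs /within/= => /nbhs_ballP[e /= e0 H].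
have [tT'|Tt] := ltP t T.
  pose d := Num.min (e / 2) (T - t).
  have d0 : 0 < d by rewrite lt_min divr_gt0// subr_gt0.
  have d1 : d <= e / 2 by rewrite ge_min lexx.
  have d2 : d <= T - t by rewrite ge_min lexx orbT.
  exists (t + d); apply: H.
  - by rewrite /ball/= opprD addNKr normrN gtr0_norm//; lra.
  - by rewrite gt_eqF// ltrDl.
  - by rewrite in_itv/=; apply/andP; split; lra.
pose d := Num.min (e / 2) T.
have d0 : 0 < d by rewrite lt_min divr_gt0.
have d1 : d <= e / 2 by rewrite ge_min lexx.
have d2 : d <= T by rewrite ge_min lexx orbT.
exists (t - d); apply: H.
- by rewrite /ball/= opprB addrC subrK gtr0_norm//; lra.
- by rewrite lt_eqF// ltrBlDr ltrDl.
- by rewrite in_itv/=; apply/andP; split; lra.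
Qed.

Lemma has_deriv_on_ext T f g t l : (forall y, 0 <= y <= T -> f y = g y) -> 0 <= t <= T ->
  has_deriv_on `[0, T] f t l -> has_deriv_on `[0, T] g t l.
Proof.
move=> fg tT; rewrite /has_deriv_on; apply: cvg_trans; apply: near_eq_cvg.
by rewrite near_withinE; near=> y; rewrite /= in_itv/= => yT; rewrite !fg.
Unshelve. all: by end_near. Qed.

Lemma deriv_onE T f t l : 0 < T -> 0 <= t <= T -> has_deriv_on `[0, T] f t l ->
  deriv_on `[0, T] f t = l.
Proof. by move=> T0 tT H; have := within_dnbhs_proper T0 tT => PF; exact: cvg_lim H. Qed.

Lemma derivable_has_deriv_on T f t : derivable_on `[0, T] f t ->
  has_deriv_on `[0, T] f t (deriv_on `[0, T] f t).
Proof. by []. Qed.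

Lemma is_derive_has_deriv_on A f t l : is_derive t 1 f l -> has_deriv_on A f t l.
Proof.
move=> /is_derive1_caratheodory[g [E cg <-]].
have h : g y @[y --> within A t^'] --> g t.
  by apply: cvg_within_filter; apply: cvg_trans cg; apply: cvg_app; exact: cvg_within.
apply: cvg_trans h; apply: near_eq_cvg; rewrite near_withinE; near=> y => _.
rewrite E mulfK// subr_eq0; near: y; exact: nbhs_dnbhs_neq.
Unshelve. all: by end_near. Qed.

Lemma has_deriv_on_is_derive T f t l : 0 < t < T -> has_deriv_on `[0, T] f t l -> is_derive t 1 f l.
Proof.
move=> /andP[t0 tT] H; apply/is_derive1_caratheodory.
exists (fun z => if z == t then l else (f z - f t) / (z - t)); split; last by rewrite eqxx.
  move=> z; case: eqVneq => [->|zt]; first by rewrite !subrr mulr0.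
  by rewrite divfK// subr_eq0.
rewrite /prop_for /continuous_at eqxx; apply/cvgrPdist_lt => e e0.
move/cvgrPdist_lt : H => /(_ e e0); rewrite near_withinE /dnbhs near_withinE => h.
near=> z; case: eqVneq => [_|zt]; first by rewrite subrr normr0.
have : z != t -> [set` `[0, T]] z -> `|l - (f z - f t) / (z - t)| < e by near: z.
apply => //=; rewrite in_itv/=; apply/andP; split; near: z.
- by apply: filterS (lt_nbhsr t0) => z /ltW.
- by apply: filterS (lt_nbhsl tT) => z /ltW.
Unshelve. all: by end_near. Qed.

Lemma has_deriv_onD A f g t l k : has_deriv_on A f t l -> has_deriv_on A g t k ->
  has_deriv_on A (fun s => f s + g s) t (l + k).
Proof.
move=> Hf Hg; have H : ((f y - f t) / (y - t) + (g y - g t) / (y - t)) @[y --> within A t^'] --> l + k.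
  exact: cvgD.
apply: cvg_trans H; by apply: near_eq_cvg; near=> y; rewrite /= -mulrDl; congr (_ / _); ring.
Unshelve. all: by end_near. Qed.

Lemma has_deriv_onN A f t l : has_deriv_on A f t l -> has_deriv_on A (fun s => - f s) t (- l).
Proof.
move=> Hf; have H : (- ((f y - f t) / (y - t))) @[y --> within A t^'] --> - l.
  exact: cvgN.
apply: cvg_trans H; by apply: near_eq_cvg; near=> y; rewrite /= -mulNr; congr (_ / _); ring.
Unshelve. all: by end_near. Qed.

Lemma deriv0_const T u : {within `[0, T], continuous u} ->
  (forall t, 0 < t < T -> has_deriv_on `[0, T] u t 0) -> forall t, 0 <= t <= T -> u t = u 0.
Proof.
move=> cu du t /andP[]; rewrite le_eqVlt => /predU1P[<-//|t0] tT.
have [] := @MVT R u (fun=> 0) 0 t t0.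
- move=> s; rewrite in_itv/= => /andP[s0 st].
  by apply: (@has_deriv_on_is_derive T); [|apply: du]; rewrite s0 (lt_le_trans st).
- by apply: continuous_subspaceW cu; apply: subset_itvl; rewrite bnd_simp.
by move=> s _ /eqP; rewrite mul0r subr_eq0 => /eqP.
Qed.

(** By the mean value theorem, difference quotients at 0 are values of w at points tending to 0. *)
Lemma has_deriv_on_at0 T u w l : continuous u -> (forall t, 0 < t -> is_derive t 1 u (w t)) ->
  w t @[t --> 0^'+] --> l -> has_deriv_on `[0, T] u 0 l.
Proof.
move=> cu du /cvgrPdist_le wl; apply/cvgrPdist_le => e e0.
have [d /= d0 Hd] := wl e e0.
rewrite near_withinE; near=> y; rewrite /= in_itv/= => /andP[y0 _].
have yp : 0 < y by rewrite lt_neqAle y0 andbT eq_sym; near: y; exact: nbhs_dnbhs_neq.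
have yd : y < d.
  have : ball 0 d y by near: y; apply: cvg_within; exact: nbhsx_ballx.
  by rewrite /ball/= sub0r normrN gtr0_norm.
have [] := @MVT R u w 0 y yp.
- by move=> s; rewrite in_itv/= => /andP[s0 _]; exact: du.
- exact: continuous_subspaceT.
move=> s; rewrite in_itv/= => /andP[s0 sy] ->; rewrite mulfK ?subr0 ?gt_eqF//.
by apply: Hd => //; rewrite /ball/= sub0r normrN gtr0_norm// (lt_trans sy).
Unshelve. all: by end_near. Qed.

(** A candidate sequence F certifies all iterated derivatives at once. The point 0 is treated apart:
    the n-th derivative may blow up there, and for n = 0 even f 0 is free. *)
Lemma derivn_onE T n f (F : nat -> R -> R) : 0 < T ->
  (forall t, 0 < t <= T -> f t = F 0%N t) -> ((0 < n)%N -> f 0 = F 0%N 0) ->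
  (forall k t, (k.+1 < n)%N -> 0 <= t <= T -> has_deriv_on `[0, T] (F k) t (F k.+1 t)) ->
  (forall k t, (k < n)%N -> 0 < t <= T -> has_deriv_on `[0, T] (F k) t (F k.+1 t)) ->
  [/\ forall k t, (k < n)%N -> 0 <= t <= T -> derivn_on `[0, T] k f t = F k t,
      forall t, 0 < t <= T -> derivn_on `[0, T] n f t = F n t,
      forall k t, (k.+1 < n)%N -> 0 <= t <= T -> derivable_on `[0, T] (derivn_on `[0, T] k f) t &
      forall k t, (k < n)%N -> 0 < t <= T -> derivable_on `[0, T] (derivn_on `[0, T] k f) t].
Proof.
move=> T0 fF fF0 dF dF'.
have H k t : (k < n)%N -> 0 <= t <= T -> derivn_on `[0, T] k f t = F k t.
  elim: k t => [|k IH] t kn tT.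
    rewrite /derivn_on/=; case/andP: (tT); rewrite le_eqVlt => /predU1P[<-|t0] tT'.
      exact: fF0.
    by rewrite fF// t0.
  rewrite /derivn_on iterS; apply: deriv_onE => //.
  apply: (@has_deriv_on_ext T (F k)) => [y yT|//|]; last exact: dF.
  by rewrite -IH// ltnW.
have D k t : (k < n)%N -> 0 <= t <= T -> has_deriv_on `[0, T] (F k) t (F k.+1 t) ->
    has_deriv_on `[0, T] (derivn_on `[0, T] k f) t (F k.+1 t).
  by move=> kn tT; apply: has_deriv_on_ext => // y yT; rewrite H.
have W t : 0 < t <= T -> 0 <= t <= T by move=> /andP[/ltW-> ->].
split=> //.
- move=> t tT; case: n fF0 dF dF' H D => [|n] fF0 dF dF' H D; first exact: fF.
  rewrite /derivn_on iterS; apply: deriv_onE; [by []|exact: W|].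
  by apply: D; [|exact: W|exact: dF'].
- by move=> k t kn tT; apply: cvgP (D k t (ltnW kn) tT (dF k t kn tT)).
- by move=> k t kn tT; apply: cvgP (D k t kn (W t tT) (dF' k t kn tT)).
Qed.
End deriv_on.

(** * Monomials, iterated primitives and representation of C^n_gamma functions *)

Section monomials.
Variable R : realType.
Implicit Types (f g u v y z : R -> R) (a c p s t T l : R).

(** The k-th derivative of t^j / j!, as a polynomial on the whole line: real powers would be awkward
    to differentiate at 0. *)
Definition mono (j k : nat) (t : R) : R :=
  if (k <= j)%N then t ^+ (j - k) / (j - k)`!%:R else 0.

Lemma is_derive_mono j k t : is_derive t 1 (mono j k) (mono j k.+1 t).
Proof.
rewrite /mono; have [jk|kj] := leqP j k.
  have [kj|jk'] := leqP k j.
    have -> : j = k by apply/eqP; rewrite eqn_leq jk.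
    rewrite (_ : (fun s : R => _) = cst 1); first exact: is_derive_cst.
    by apply/funext => s; rewrite subnn expr0 fact0 divr1.
  exact: is_derive_cst.
rewrite (ltnW kj) -(subnSK kj); set i := (j - k.+1)%N.
rewrite (_ : (fun s : R => s ^+ i.+1 / i.+1`!%:R) = (i.+1`!%:R)^-1 \*: ((id : R -> R) ^+ i.+1)); last first.
  apply/funext => s; rewrite /= mulrC; congr (_ * _).
  by elim: (i.+1) => [|n IH]; rewrite ?expr0// !exprS IH.
have h := @is_deriveX R R id i.+1 t 1 1 (is_derive_id _ _).
have hZ := is_deriveZ (i.+1`!%:R)^-1 h.
apply: (is_derive_eq hZ).
rewrite /= factS natrM /GRing.scale/= mulr1 invfM.
have : i.+1%:R != 0 :> R by rewrite pnatr_eq0.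
have : i`!%:R != 0 :> R by rewrite pnatr_eq0 -lt0n fact_gt0.
by move: (i.+1%:R) (i`!%:R) (t ^+ i) => A B C B0 A0; field; rewrite ?A0 ?B0.
Qed.

Lemma continuous_mono j k : continuous (mono j k).
Proof.
move=> t; apply: differentiable_continuous; apply/derivable1_diffP.
by case: (is_derive_mono j k t).
Qed.

Lemma mono_at0 j k : mono j k 0 = (k == j)%:R.
Proof.
rewrite /mono; case: ltngtP => [kj|//|->]; last by rewrite subnn expr0 fact0 divr1.
by rewrite expr0n subn_eq0 leqNgt kj mul0r.
Qed.

Lemma Phi_mono j t : 0 < t -> Phi j.+1%:R t = mono j 0 t.
Proof.
elim: j t => [|j IH] t t0.
  by rewrite /Phi subrr powRr0 Gamma1 /mono leqnn subn0 expr0 fact0.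
have Cm : Cg 0 (mono j.+1 1) by apply: Cg_continuous; exact: continuous_mono.
have h := @Cg_FTC R 0 (mono j.+1 0) (mono j.+1 1) t ltr01 Cm.
rewrite (h _ _ t); first last.
- by rewrite lexx ltW.
- by move=> s _; exact: is_derive_mono.
- by apply: continuous_subspaceT; exact: continuous_mono.
rewrite mono_at0 add0r -(@eq_RL _ _ (Phi j.+1%:R)); last first.
  by move=> s /andP[s0 _]; rewrite IH// /mono !leq0n subSS.
rewrite RL_Phi// ?ltr0n//.
by rewrite kern_gt0// /Phi -!natrD add1n.
Qed.
End monomials.

Section RLint_deriv.
Variable R : realType.
Implicit Types (f g u v y z : R -> R) (a c p s t T l : R).

Lemma RLint_le0 a c f t : 0 < a -> c < 1 -> Cg c f -> t <= 0 -> RLint a f t = 0.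
Proof. by move=> a0 c1 Cf t0; rewrite (RLint_RL a0 c1 Cf) RL_le0. Qed.

Lemma RLint_ext a c f g t : 0 <= a -> c < 1 -> Cg c g -> (forall s, 0 < s < t -> f s = g s) ->
  f t = g t -> RLint a f t = RLint a g t.
Proof.
rewrite le_eqVlt => /predU1P[<-|a0] c1 Cg_g fg fgt; first by rewrite !RLint0E.
by rewrite (RLint_RL a0 c1 Cg_g); exact: RLintE a0 c1 Cg_g fg.
Qed.

Lemma RLint_Phi a c p t : 0 <= a -> 0 < p -> c < 1 -> 1 <= p + c -> 0 < t ->
  RLint a (Phi p) t = Phi (a + p) t.
Proof.
rewrite le_eqVlt => /predU1P[<-|a0] p0 c1 pc t0; first by rewrite RLint0E add0r.
by rewrite (RLint_RL a0 c1 (Cg_Phi pc)) RL_Phi// kern_gt0.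
Qed.

Lemma RLint_natS_derive k c f t : c < 1 -> Cg c f -> 0 < t ->
  is_derive t 1 (RLint k.+1%:R f) (RLint k%:R f t).
Proof.
move=> c1 Cf t0; have Ck := RLint_Cg (ler0n R k) c1 Cf.
rewrite -addn1 natrD addrC -(RLint_semigroup ler01 (ler0n R k) c1 Cf).
by rewrite (RLint_RL ltr01 c1 Ck); exact: RL1_derive c1 Ck t0.
Qed.

Lemma RLint_nat_continuous k c f : c < 1 -> Cg c f -> continuous (RLint k.+1%:R f).
Proof.
move=> c1 Cf; have k0 : 0 < k.+1%:R :> R by rewrite ltr0n.
rewrite (RLint_RL k0 c1 Cf); apply: (RL_continuous k0 c1 _ Cf).
by rewrite (lt_le_trans c1)// ler1n.
Qed.

(** At t = 0 the order k must be positive: I^0 f is f, which may be unbounded there. *)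
Lemma RLint_nat_has_deriv_on k c f T t : c < 1 -> Cg c f -> (0 < t) || (0 < k)%N && (t == 0) ->
  has_deriv_on `[0, T] (RLint k.+1%:R f) t (RLint k%:R f t).
Proof.
move=> c1 Cf /orP[t0|/andP[k0 /eqP ->]].
  by apply: is_derive_has_deriv_on; exact: RLint_natS_derive c1 Cf t0.
apply: (@has_deriv_on_at0 _ _ _ (RLint k%:R f)).
- exact: RLint_nat_continuous c1 Cf.
- by move=> s s0; exact: RLint_natS_derive c1 Cf s0.
- apply: cvg_at_right_filter.
  have : continuous (RLint k%:R f); last exact.
  by rewrite -(prednK k0); exact: RLint_nat_continuous c1 Cf.
Qed.

Lemma mono_RLint_has_deriv_on e j k i c f T t : c < 1 -> Cg c f -> (0 < t) || (0 < k)%N && (t == 0) ->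
  has_deriv_on `[0, T] (fun s => e * mono j i s + RLint k.+1%:R f s) t
    (e * mono j i.+1 t + RLint k%:R f t).
Proof.
move=> c1 Cf tk; apply: has_deriv_onD; last exact: RLint_nat_has_deriv_on c1 Cf tk.
apply: is_derive_has_deriv_on.
exact: (is_deriveZ e (is_derive_mono j i t)).
Qed.

(** The coefficient e is 1 for y itself and 0 for the fractional integrals inside a Caputo
    derivative. *)
Lemma derivn_on_mono_RLint T n j e c f z : 0 < T -> c < 1 -> Cg c f ->
  (forall t, 0 < t <= T -> z t = e * mono j 0 t + RLint n%:R f t) ->
  ((0 < n)%N -> z 0 = e * mono j 0 0) ->
  [/\ forall k t, (k < n)%N -> 0 <= t <= T ->
        derivn_on `[0, T] k z t = e * mono j k t + RLint (n - k)%:R f t,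
      forall t, 0 < t <= T -> derivn_on `[0, T] n z t = e * mono j n t + f t,
      forall k t, (k.+1 < n)%N -> 0 <= t <= T -> derivable_on `[0, T] (derivn_on `[0, T] k z) t &
      forall k t, (k < n)%N -> 0 < t <= T -> derivable_on `[0, T] (derivn_on `[0, T] k z) t].
Proof.
move=> T0 c1 Cf zE z0.
have := @derivn_onE R T n z (fun k s => e * mono j k s + RLint (n - k)%:R f s) T0.
case=> [||k t kn tT|k t kn /andP[t0 tT]|H1 H2 H3 H4].
- by move=> t tT; rewrite (subn0 n); exact: zE.
- move=> n0; have nR : 0 < n%:R :> R by rewrite ltr0n.
  by rewrite (z0 n0) (subn0 n) (RLint_le0 nR c1 Cf (lexx 0)) addr0.
- rewrite -(subnSK (ltnW kn)); apply: mono_RLint_has_deriv_on c1 Cf _.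
  by rewrite subn_gt0 kn/=; case/andP: tT; rewrite le_eqVlt => /predU1P[<-|->]; rewrite ?eqxx ?orbT.
- by rewrite -(subnSK kn); apply: mono_RLint_has_deriv_on c1 Cf _; rewrite t0.
- by split=> // t tT; rewrite H2// subnn RLint0E.
Qed.

Lemma Cg_Cgamma T c f g : Cg c g -> (forall t, 0 < t <= T -> f t = g t) -> Cgamma T c f.
Proof.
move=> [u cu gu] fg; exists u; first exact: continuous_subspaceT.
move=> t tT; case/andP: (tT) => t0 _; rewrite fg// gu// mulrA -gt0_powRD// addrN.
by rewrite powRr0 mul1r.
Qed.

Lemma continuous_within_ext T f g : continuous g -> (forall t, 0 <= t <= T -> f t = g t) ->
  {within `[0, T], continuous f}.
Proof.
move=> cg fg; apply: (@subspace_eq_continuous _ _ _ g).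
  by move=> t; rewrite inE/= in_itv/= => tT; exact/esym/fg.
exact: continuous_subspaceT.
Qed.

Lemma mono_RLint_Cngamma T n j c v z : 0 < T -> c < 1 -> Cg c v -> (j < n)%N ->
  (forall t, 0 <= t <= T -> z t = mono j 0 t + RLint n%:R v t) -> Cngamma T n c z.
Proof.
move=> T0 c1 Cv jn zE; have n0 : (0 < n)%N by exact: leq_ltn_trans jn.
have [||H1 H2 H3 H4] := @derivn_on_mono_RLint T n j 1 c v z T0 c1 Cv.
- by move=> t /andP[t0 tT]; rewrite mul1r zE// ltW.
- move=> _; have nR : 0 < n%:R :> R by rewrite ltr0n.
  by rewrite zE ?lexx ?ltW// (RLint_le0 nR c1 Cv (lexx 0)) addr0 mul1r.
split=> [k kn|k kn t tT|k kn t tT|].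
- apply: (@continuous_within_ext _ _ (fun t => 1 * mono j k t + RLint (n - k)%:R v t)).
    have cR : continuous (RLint (n - k)%:R v).
      by rewrite -(subnSK kn); exact: RLint_nat_continuous c1 Cv.
    move=> t; apply: cvgD; last exact: cR.
    by apply: cvgM; [exact: cvg_cst|exact: continuous_mono].
  by move=> t tT; exact: H1.
- exact: H3.
- exact: H4.
- apply: (Cg_Cgamma Cv) => t tT; rewrite H2// /mono leqNgt jn/= mulr0 add0r//.
Qed.

(** Composing the continuous factor with the clamp to [0, T] extends it to the line. *)
Lemma Cgamma_extend T c f : 0 < T -> Cgamma T c f ->
  exists2 g, Cg c g & forall t, 0 < t <= T -> f t = g t.
Proof.
move=> T0 [u cu uf].
pose k (x : R) : R := Num.max 0 (Num.min x T).
have kT x : 0 <= k x <= T.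
  by rewrite /k le_max lexx/= ge_max (ltW T0) ge_min lexx orbT.
have cw : continuous (fun x => u (k x)).
  move=> x; apply/cvgrPdist_lt => e e0.
  have Ak : [set` `[0, T]] (k x) by rewrite /= in_itv/= kT.
  have : u y @[y --> within [set` `[0, T]] (nbhs (k x))] --> u (k x).
    by rewrite (nbhs_subspace_in Ak); exact: cu.
  move/cvgrPdist_lt => /(_ e e0); rewrite near_withinE => H.
  have h : \forall y \near x, [set` `[0, T]] (k y) -> `|u (k x) - u (k y)| < e.
    exact: (@continuous_clamp R T x _ H).
  near=> y; have : [set` `[0, T]] (k y) by rewrite /= in_itv/=; exact: kT.
  by near: y; exact: h.
exists (fun t => t `^ (- c) * u (k t)); first by exists (fun x => u (k x)).
move=> t tT; case/andP: (tT) => t0 tT'; rewrite /k (min_idPl tT') (max_idPr (ltW t0)) uf//.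
by rewrite mulrA -gt0_powRD// addNr powRr0 mul1r.
Unshelve. all: by end_near. Qed.

Lemma FTC_on T c u w : 0 < T -> c < 1 -> Cg c w -> {within `[0, T], continuous u} ->
  (forall t, 0 < t < T -> has_deriv_on `[0, T] u t (w t)) ->
  forall t, 0 <= t <= T -> u t = u 0 + RL 1 w t.
Proof.
move=> T0 c1 Cw cu du; apply: (Cg_FTC c1 Cw cu) => t tT.
exact: has_deriv_on_is_derive tT (du t tT).
Qed.

Lemma Cngamma1_repr T c f : 0 < T -> c < 1 -> Cngamma T 1 c f ->
  exists2 w, Cg c w & forall t, 0 <= t <= T -> f t = f 0 + RL 1 w t.
Proof.
move=> T0 c1 [H1 _ H3 H4]; have [w Cw fw] := Cgamma_extend T0 H4.
exists w => //; apply: (FTC_on T0 c1 Cw (H1 0%N isT)) => t /andP[t0 tT].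
have tT' : 0 < t <= T by rewrite t0 ltW.
rewrite -(fw t tT'); exact: derivable_has_deriv_on (H3 0%N isT t tT').
Qed.

(** Descending induction on the order: a derivative of z and its candidate [G k] agree at 0 and have
    the same derivative inside, hence coincide. *)
Lemma Cngamma_repr T n j c z : 0 < T -> c < 1 -> (j < n)%N -> Cngamma T n c z ->
  (forall k, (k < n)%N -> derivn_on `[0, T] k z 0 = (k == j)%:R) ->
  exists2 v, Cg c v & forall t, 0 <= t <= T -> z t = mono j 0 t + RLint n%:R v t.
Proof.
move=> T0 c1 jn [H1 _ H3 H4] z0; have n0 : (0 < n)%N by exact: leq_ltn_trans jn.
have [v Cv zv] := Cgamma_extend T0 H4; exists v => //.
pose G k t := 1 * mono j k t + RLint (n - k)%:R v t.
have step k : (k < n)%N -> (forall t, 0 < t <= T -> derivn_on `[0, T] k.+1 z t = G k.+1 t) ->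
    forall t, 0 <= t <= T -> derivn_on `[0, T] k z t = G k t.
  move=> kn IH t tT.
  have cR : continuous (RLint (n - k)%:R v).
    by rewrite -(subnSK kn); exact: RLint_nat_continuous c1 Cv.
  have cG : continuous (fun t => - G k t).
    move=> s; apply: cvgN; apply: cvgD; last exact: cR.
    by apply: cvgM; [exact: cvg_cst|exact: continuous_mono].
  have := @deriv0_const R T (fun t => derivn_on `[0, T] k z t + - G k t).
  have nk : 0 < (n - k)%:R :> R by rewrite ltr0n subn_gt0.
  have -> : derivn_on `[0, T] k z 0 + - G k 0 = 0.
    by rewrite (z0 k kn) /G mono_at0 mul1r (RLint_le0 nk c1 Cv (lexx 0)) addr0 subrr.
  move=> H; apply/eqP; rewrite -subr_eq0; apply/eqP; apply: H tT.
    by move=> x; apply: cvgD; [exact: H1|exact: (continuous_subspaceT cG)].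
  move=> s /andP[s0 sT]; have sT' : 0 < s <= T by rewrite s0 ltW.
  rewrite -[X in has_deriv_on _ _ _ X](subrr (G k.+1 s)); apply: has_deriv_onD.
    rewrite -(IH s sT'); exact: derivable_has_deriv_on (H3 k kn s sT').
  apply: has_deriv_onN; rewrite /G -(subnSK kn).
  by apply: mono_RLint_has_deriv_on c1 Cv _; rewrite s0.
(* The induction stops at order 1 and excludes t = 0, where order n is not controlled; one more
   [step] gives order 0 on the closed interval. *)
have P i : (i < n)%N -> forall t, 0 < t <= T -> derivn_on `[0, T] (n - i) z t = G (n - i)%N t.
  elim: i => [|i IH] iN t tT.
    rewrite subn0 zv// /G subnn RLint0E /mono leqNgt jn/=.
    by rewrite mulr0 add0r.
  apply: step; first by rewrite ltn_subrL.
    by move=> s sT; rewrite (subnSK (ltnW iN)); apply: IH => //; exact: ltnW.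
  by case/andP: tT => /ltW-> ->.
have h1 s : 0 < s <= T -> derivn_on `[0, T] 1 z s = G 1%N s.
  have := P n.-1; rewrite prednK// leqnn (_ : (n - n.-1)%N = 1%N); last first.
    by rewrite -subn1 subKn.
  by move/(_ isT); exact.
move=> t tT; have := step 0%N n0 h1 t tT.
by rewrite /G (subn0 n) mul1r.
Qed.
End RLint_deriv.

(** * Orders of differentiation and the Caputo derivatives of t^j/j! + I^n0 v *)

Section ceiln.
Variable R : realType.
Implicit Types al : R.

Lemma ceilnE al : 0 <= al -> (Num.ceil al)%:~R = (ceiln al)%:R :> R.
Proof.
move=> al0; have c0 : 0 <= Num.ceil al by rewrite ceil_ge0; lra.
by rewrite /ceiln -[in LHS](gez0_abs c0) -pmulrn.
Qed.

Lemma ceiln_itv al : 0 <= al -> (ceiln al)%:R - 1 < al <= (ceiln al)%:R.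
Proof. by move=> al0; have := ceil_itv al; rewrite intrB ceilnE. Qed.

Lemma ceiln_le al (n : nat) : 0 <= al -> (ceiln al <= n)%N = (al <= n%:R).
Proof.
move=> al0; have c0 : 0 <= Num.ceil al by rewrite ceil_ge0; lra.
by rewrite -lez_nat /ceiln (gez0_abs c0) ceil_le_int pmulrn.
Qed.
End ceiln.

Section caputo.
Variables (R : realType) (T c : R) (n0 j : nat) (v y : R -> R).
Hypotheses (T0 : 0 < T) (c0 : 0 <= c) (c1 : c < 1) (Cv : Cg c v) (jn : (j < n0)%N).
Hypothesis yE : forall t, 0 <= t <= T -> y t = mono j 0 t + RLint n0%:R v t.

Lemma derivn_on_mono_RLint_at0 k : (k < n0)%N -> derivn_on `[0, T] k y 0 = (k == j)%:R.
Proof.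
move=> kn; have n0R : 0 < n0%:R :> R by rewrite ltr0n (leq_ltn_trans _ jn).
have [t tT|_|H _ _ _] := @derivn_on_mono_RLint R T n0 j 1 c v y T0 c1 Cv.
- by rewrite mul1r; apply: yE; case/andP: tT => /ltW-> ->.
- by rewrite mul1r yE ?lexx ?ltW// (RLint_le0 n0R c1 Cv (lexx 0)) addr0.
have nk : 0 < (n0 - k)%:R :> R by rewrite ltr0n subn_gt0.
rewrite H//; last by rewrite lexx ltW.
by rewrite mono_at0 (RLint_le0 nk c1 Cv (lexx 0)) addr0 mul1r.
Qed.

Lemma subTaylor_mono_RLint n t : (n <= n0)%N -> 0 <= t <= T ->
  subTaylor T n y t = (n <= j)%N%:R * mono j 0 t + RLint n0%:R v t.
Proof.
move=> nn0 tT; rewrite /subTaylor yE//.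
have -> : \sum_(0 <= k < n) derivn_on `[0, T] k y 0 / k`!%:R * t ^+ k =
    if (0 <= j < n)%N then t ^+ j / j`!%:R else 0.
  rewrite -(@big_nat1_eq _ 0 +%R (fun k => t ^+ k / k`!%:R)) big_mkcond/=; apply: eq_big_nat => k /andP[_ kn].
  rewrite (derivn_on_mono_RLint_at0 (leq_trans kn nn0)); case: eqVneq => _.
    by rewrite mul1r mulrC.
  by rewrite !mul0r.
rewrite leq0n/= {1 2}/mono leq0n subn0; case: ltnP => _; rewrite ?mul0r ?mul1r; ring.
Qed.

(** With n the ceiling of al, y minus its Taylor polynomial is I^n f. Since I^(n - al) I^n f = I^n
    (I^(n - al) f), the n derivatives leave I^(n - al) f. *)
Lemma Caputo_mono_RLint al : 0 <= al <= n0%:R ->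
  Caputo_derivable T al `]0, T] y /\
  forall t, 0 < t <= T ->
    Caputo T al y t = RLint (n0%:R - al) v t + (if al <= j%:R then Phi (j.+1%:R - al) t else 0).
Proof.
move=> /andP[al0 aln]; have /andP[n1 n2] := ceiln_itv al0.
have nj := ceiln_le j al0.
have nn0 : (ceiln al <= n0)%N by rewrite ceiln_le.
rewrite /Caputo_derivable /Caputo /RLderivable /RLder.
move: (ceiln al) n1 n2 nj nn0 => n n1 n2 nj nn0.
(* The n-th derivative of what the subtraction leaves of t^j/j!: the monomial survives exactly when
   n <= j, that is when al <= j. *)
pose P : R -> R := if (n <= j)%N then Phi (j.+1%:R - n%:R) else fun=> 0.
have P0 : Cg 0 P.
  rewrite /P; case: ifPn => h; last exact: Cg0.
  have hj : (n < j.+1)%N by rewrite ltnS.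
  by apply: Cg_Phi; rewrite addr0 -natrB ?(ltnW hj)// ler1n subn_gt0.
have CP : Cg c P by exact: Cg_le P0.
have PE a t : 0 <= a -> 0 < t -> RLint a P t = if (n <= j)%N then Phi (a + (j.+1%:R - n%:R)) t else 0.
  move=> a0 t0; rewrite /P; case: ifPn => h; last first.
    by have := @RLintZ R a 0 0 (fun=> 0) a0 ltr01 (Cg0 0) t; rewrite !mul0r.
  have h2 : (n < j.+1)%N by rewrite ltnS.
  apply: (RLint_Phi (c := 0)) => //; rewrite -natrB ?(ltnW h2)//.
    by rewrite ltr0n subn_gt0.
  by rewrite addr0 ler1n subn_gt0.
pose f s := P s + RLint (n0 - n)%:R v s.
have CR := RLint_Cg (ler0n R (n0 - n)) c1 Cv.
have Cf : Cg c f by exact: CgD.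
have na0 : 0 <= n%:R - al by rewrite subr_ge0.
pose f' := RLint (n%:R - al) f.
have Cf' : Cg c f' by exact: RLint_Cg na0 c1 Cf.
(* At t = 0 this is claimed for n > 0 only, when both sides vanish. *)
have gE t : 0 <= t <= T -> (0 < t) || (0 < n)%N -> subTaylor T n y t = RLint n%:R f t.
  move=> tT tn; rewrite (subTaylor_mono_RLint nn0 tT) /f.
  rewrite (RLintD (ler0n R n) c1 CP CR) (RLint_semigroup (ler0n R n) (ler0n _ _) c1 Cv).
  rewrite -natrD subnKC//; congr (_ + _).
  have [t0|t0] := ltP 0 t.
    rewrite PE// (addrC n%:R) subrK; case: ifP => _; rewrite ?mul0r ?mul1r//.
    by rewrite Phi_mono.
  have t00 : t = 0 by apply/eqP; rewrite eq_le t0; case/andP: tT.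
  move: tn; rewrite t00 ltxx/= => n_gt0; have nR : 0 < n%:R :> R by rewrite ltr0n.
  rewrite (RLint_le0 nR c1 CP (lexx 0)) mono_at0; case: leqP => h; last by rewrite mul0r.
  by rewrite (_ : (0 == j)%N = false) ?mulr0//; apply/eqP => j0; move: h; rewrite -j0 leqNgt n_gt0.
have zE t : 0 <= t <= T -> (0 < t) || (0 < n)%N ->
    RLint (n%:R - al) (subTaylor T n y) t = RLint n%:R f' t.
  move=> tT tn.
  rewrite (RLint_ext na0 c1 (RLint_Cg (ler0n R n) c1 Cf) (g := RLint n%:R f)).
  - rewrite /f' (RLint_semigroup na0 (ler0n _ _) c1 Cf) (RLint_semigroup (ler0n _ _) na0 c1 Cf).
    by rewrite addrC.
  - move=> s /andP[s0 st]; apply: gE; last by rewrite s0.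
    by rewrite (ltW s0); case/andP: tT => _ tT; rewrite (ltW (lt_le_trans st tT)).
  - exact: gE.
have [t tT|n_gt0|_ H2 _ H4] := @derivn_on_mono_RLint R T n 0 0 c f' (RLint (n%:R - al) (subTaylor T n y)) T0 c1 Cf'.
- by rewrite mul0r add0r; case/andP: tT => t0 tT; apply: zE; rewrite ?t0// ltW.
- have nR : 0 < n%:R :> R by rewrite ltr0n.
  by rewrite mul0r zE ?n_gt0 ?orbT ?lexx ?ltW// (RLint_le0 nR c1 Cf' (lexx 0)).
split=> [k kn t|t tT].
  by rewrite /= in_itv/=; exact: H4.
case/andP: (tT) => t0 _.
rewrite (H2 t tT) mul0r add0r /f' /f (RLintD na0 c1 CP CR).
rewrite (RLint_semigroup na0 (ler0n _ _) c1 Cv) (PE _ _ na0 t0) nj natrB// addrC.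
have -> : n%:R - al + (n0%:R - n%:R) = n0%:R - al by ring.
by have -> : n%:R - al + (j.+1%:R - n%:R) = j.+1%:R - al by ring.
Qed.
End caputo.

(** * The fundamental system *)

Section fundamental_system.
Variables (R : realType) (T : R) (m : nat) (alpha : nat -> R) (n0 : nat) (a : nat -> R -> R).
Notation c := (n0%:R - alpha 0%N).
Hypotheses (T0 : 0 < T) (m_gt0 : (1 <= m)%N).
Hypothesis alpha_decr : forall i, (i < m)%N -> alpha i.+1 < alpha i.
Hypothesis alpha_m : 0 <= alpha m.
Hypothesis alpha0_itv : n0%:R - 1 < alpha 0%N <= n0%:R.
Hypothesis a_reg : forall i, (1 <= i <= m)%N -> Cngamma T 1 c (a i).

Let c0 : 0 <= c. Proof. by rewrite subr_ge0; case/andP: alpha0_itv. Qed.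
Let c1 : c < 1. Proof. by rewrite ltrBlDl -ltrBlDr; case/andP: alpha0_itv. Qed.

Lemma alpha_anti i k : (i <= k)%N -> (k <= m)%N -> alpha k <= alpha i.
Proof.
elim: k => [|k IH]; first by rewrite leqn0 => /eqP->.
rewrite leq_eqVlt => /predU1P[->//|ik] km.
by rewrite (le_trans (ltW (alpha_decr km)))// IH// ltnW.
Qed.

Lemma alpha_ge0 i : (i <= m)%N -> 0 <= alpha i.
Proof. by move=> im; apply: (le_trans alpha_m); exact: alpha_anti. Qed.

Lemma alpha_le i : (i <= m)%N -> alpha i <= n0%:R.
Proof.
by move=> im; case/andP: alpha0_itv => _; apply: le_trans; exact: alpha_anti.
Qed.

Lemma alpha_lt0 i : (1 <= i <= m)%N -> 0 < alpha 0%N - alpha i.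
Proof.
move=> /andP[i1 im]; rewrite subr_gt0 (le_lt_trans (alpha_anti i1 im))//.
exact: alpha_decr.
Qed.

Lemma alpha0_gt0 : 0 < alpha 0%N.
Proof. by rewrite (le_lt_trans (alpha_ge0 m_gt0))// alpha_decr. Qed.

Lemma n0_gt0 : 0 < n0%:R :> R.
Proof. by case/andP: alpha0_itv => _; apply: lt_le_trans alpha0_gt0. Qed.

(** The sum in (E) once y = t^j/j! + I^n0 v is substituted. The test on [alpha i] stands for i >=
    h_j, and its terms add up to g_j. *)
Definition rhs (j : nat) (v : R -> R) (t : R) : R :=
  \sum_(1 <= i < m.+1) a i t * (RLint (n0%:R - alpha i) v t +
    (if alpha i <= j%:R then Phi (j.+1%:R - alpha i) t else 0)).

Lemma solution_rhs j v y : (j < n0)%N -> Cg c v ->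
  (forall t, 0 <= t <= T -> y t = mono j 0 t + RLint n0%:R v t) ->
  solution T m alpha a y <-> forall t, 0 < t < T -> RLint c v t = - rhs j v t.
Proof.
move=> jn Cv yE.
have H i : (i <= m)%N -> Caputo_derivable T (alpha i) `]0, T] y /\
  forall t, 0 < t <= T -> Caputo T (alpha i) y t = RLint (n0%:R - alpha i) v t +
     (if alpha i <= j%:R then Phi (j.+1%:R - alpha i) t else 0).
  move=> im; apply: (Caputo_mono_RLint T0 c0 c1 Cv jn yE).
  by rewrite alpha_ge0//= alpha_le.
(* The left side of (E) has no Phi term, because j <= n0 - 1 < alpha_0. *)
have aj : alpha 0%N <= j%:R = false.
  apply/negbTE; rewrite -ltNge; case/andP: alpha0_itv => h _; apply: le_lt_trans h.
  by rewrite lerBrDr natr1 ler_nat.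
have E t : 0 < t < T -> (Caputo T (alpha 0%N) y t = - \sum_(1 <= i < m.+1) a i t * Caputo T (alpha i) y t)
    = (RLint c v t = - rhs j v t).
  move=> /andP[t0 tT]; have tT' : 0 < t <= T by rewrite t0 ltW.
  rewrite (H 0%N (leq0n _)).2// aj addr0; congr (_ = - _); apply: eq_big_nat => i /andP[_ im].
  by rewrite (H i im).2.
split=> [[_ S] t tT|S]; first by rewrite -E//; exact: S.
split=> [i im|t tT]; last by rewrite E//; exact: S.
move=> k kn t /=; rewrite in_itv/= => /andP[t0 tT].
by apply: (H i im).1 => //=; rewrite in_itv/= t0 ltW.
Qed.

Let bt i := alpha 0%N - alpha i.
Let r := index_iota 1 m.+1.

Let a_repr : exists b : nat -> R -> R, forall i, (1 <= i <= m)%N -> Cg c (b i) /\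
  forall t, 0 <= t <= T -> a i t = a i 0 + RL 1 (b i) t.
Proof.
have [b Hb] : {b : nat -> R -> R & forall i, (1 <= i <= m)%N -> Cg c (b i) /\
  forall t, 0 <= t <= T -> a i t = a i 0 + RL 1 (b i) t}.
  apply: (@choice _ _ (fun i b => (1 <= i <= m)%N -> Cg c b /\
    forall t, 0 <= t <= T -> a i t = a i 0 + RL 1 b t)) => i.
  have [im|im] := boolP (1 <= i <= m)%N; last by exists (fun=> 0).
  by have [b Cb bE] := Cngamma1_repr T0 c1 (a_reg im); exists b.
by exists b.
Qed.

Let memr i : (i \in r) = (1 <= i <= m)%N.
Proof. by rewrite mem_index_iota ltnS. Qed.

Let op_rhs b v t : (forall i, (1 <= i <= m)%N -> Cg c (b i) /\
  forall t, 0 <= t <= T -> a i t = a i 0 + RL 1 (b i) t) -> Cg c v -> 0 <= t <= T ->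
  \sum_(i <- r) (a i 0 + RL 1 (b i) t) * RL (bt i + c) v t =
  \sum_(1 <= i < m.+1) a i t * RLint (n0%:R - alpha i) v t.
Proof.
move=> Hb Cv tT; apply: eq_big_nat => i /andP[i1 im].
have im' : (1 <= i <= m)%N by rewrite i1.
rewrite -(Hb i im').2//; congr (_ * _).
have -> : n0%:R - alpha i = bt i + c by rewrite /bt; ring.
by rewrite (RLint_RL _ c1 Cv)// ltr_wpDr//; exact: alpha_lt0.
Qed.

Lemma rhsE j v t : rhs j v t = (\sum_(1 <= i < m.+1) a i t * RLint (n0%:R - alpha i) v t) +
  \sum_(1 <= i < m.+1) a i t * (if alpha i <= j%:R then Phi (j.+1%:R - alpha i) t else 0).
Proof. by rewrite -big_split/=; apply: eq_bigr => i _; rewrite mulrDr. Qed.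

(** The inhomogeneous terms cancel in v - w, which then solves the homogeneous Volterra equation. *)
Lemma rhs_unique j v w : Cg c v -> Cg c w ->
  (forall t, 0 < t < T -> RLint c v t = - rhs j v t) ->
  (forall t, 0 < t < T -> RLint c w t = - rhs j w t) ->
  forall t, 0 < t < T -> v t = w t.
Proof.
move=> Cv Cw vE wE; have [b Hb] := a_repr.
have Cw' := CgZ (-1) Cw.
have Hr i : i \in r -> Cg c (b i) /\ 0 < bt i.
  by rewrite memr => im; split; [exact: (Hb i im).1|exact: alpha_lt0].
have := @volterra_unique R c T bt (a ^~ 0) b r c0 c1 T0 Hr (fun t => v t + (-1) * w t) T (CgD Cv Cw') (lexx T).
move=> H t tT; apply/eqP; rewrite -subr_eq0 -mulN1r; apply/eqP; apply: H tT => s sT.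
have sT' : 0 <= s <= T by case/andP: sT => /ltW-> /ltW->.
rewrite (op_rhs Hb (CgD Cv Cw') sT').
rewrite (RLintD c0 c1 Cv Cw') (RLintZ (-1) c0 c1 Cw) vE// wE// !rhsE.
rewrite (_ : \sum_(1 <= i < m.+1) a i s * RLint (n0%:R - alpha i) (fun t => v t + -1 * w t) s =
  \sum_(1 <= i < m.+1) a i s * RLint (n0%:R - alpha i) v s -
  \sum_(1 <= i < m.+1) a i s * RLint (n0%:R - alpha i) w s).
  by move: (\sum_(_ <= _ < _) _) (\sum_(_ <= _ < _) _) (\sum_(_ <= _ < _) _) => X Y Z; ring.
rewrite -sumrB; apply: eq_big_nat => i /andP[i1 im].
have ai : 0 <= n0%:R - alpha i by rewrite subr_ge0 alpha_le.
by rewrite (RLintD ai c1 Cv Cw') (RLintZ (-1) ai c1 Cw); ring.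
Qed.

Lemma fundamental_solution (hj j : nat) : (j < n0)%N -> is_min (Hset m alpha j) hj ->
  exists v, [/\ Cg c v, forall t, 0 < t < T -> RLint c v t = - rhs j v t &
   forall t, 0 <= t <= T ->
     series (fun k => (-1) ^+ k.+1 * RLint (alpha 0%N)
       (iter k (opA m alpha a)
          (fun s => \sum_(hj <= i < m.+1) a i s * Phi (j.+1%:R - alpha i) s)) t) N
     @[N --> \oo] --> RLint n0%:R v t].
Proof.
move=> jn [[/andP[h1 hm] /andP[_ haj]] hmin]; have [b Hb] := a_repr.
have Hr i : i \in r -> Cg c (b i) /\ 0 < bt i.
  by rewrite memr => im; split; [exact: (Hb i im).1|exact: alpha_lt0].
(* The order is lowered by c so that I^c p_i is the required Phi; it stays at least 1 - c, which
   puts p_i in [Cg c]. *)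
pose p i : R -> R := if alpha i <= j%:R then Phi (j.+1%:R - alpha i - c) else fun=> 0.
have pos i : alpha i <= j%:R -> 1 <= j.+1%:R - alpha i - c + c.
  by move=> h; rewrite subrK -natr1 addrAC lerDr subr_ge0.
have Cp i : Cg c (p i).
  by rewrite /p; case: ifP => h; [apply: Cg_Phi; exact: pos|exact: Cg0].
have pE i t : 0 < t -> RLint c (p i) t = if alpha i <= j%:R then Phi (j.+1%:R - alpha i) t else 0.
  move=> t0; rewrite /p; case: ifP => h.
    have h' : 0 < j.+1%:R - alpha i - c.
      by rewrite subr_gt0 (lt_le_trans c1)// -natr1 addrAC lerDr subr_ge0.
    rewrite (RLint_Phi c0 h' c1 (pos i h) t0).
    by rewrite addrC subrK.
  by have := @RLintZ R c c 0 (fun=> 0) c0 c1 (Cg0 c) t; rewrite !mul0r.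
have [q Cq qE] := @sum_product R c T (a ^~ 0) b c0 c1 r p (fun i ir => (Hr i ir).1) (fun i _ => Cp i).
have Cv0 := CgZ (-1) Cq.
pose g s := \sum_(hj <= i < m.+1) a i s * Phi (j.+1%:R - alpha i) s.
have gE t : 0 < t <= T -> \sum_(1 <= i < m.+1) a i t *
    (if alpha i <= j%:R then Phi (j.+1%:R - alpha i) t else 0) = g t.
  move=> tT; rewrite (big_cat_nat_idem _ h1 (leqW hm))/= ?addr0// big1_seq ?add0r.
    apply: eq_big_nat => i /andP[hi im]; rewrite ifT//.
    by apply: le_trans haj; exact: alpha_anti.
  move=> i /andP[_]; rewrite mem_index_iota => /andP[i1 ih].
  case: ifP => [aij|_]; last by rewrite mulr0.
  have im : (i <= m)%N by rewrite (leq_trans (ltnW ih)).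
  have := hmin i; rewrite leqNgt ih => /(_ _)/wrap[]//.
  by split; rewrite ?i1//= alpha_ge0.
have qg t : 0 < t <= T -> RLint c q t = g t.
  move=> tT; case/andP: (tT) => t0 tT'; rewrite qE// -gE//; apply: eq_big_nat => i /andP[i1 im].
  by rewrite pE// -(Hb i _).2 ?i1 ?(ltW t0).
have [vs [v [vs0 Cvs vsE [Cv cv] vE]]] := @volterra_series R c T bt (a ^~ 0) b r c0 c1 T0 Hr _ Cv0.
exists v; split=> //.
  move=> t /andP[t0 tT]; have tT' : 0 < t <= T by rewrite t0 ltW.
  rewrite vE// (RLintZ (-1) c0 c1 Cq) qg// -gE// rhsE (op_rhs Hb Cv) ?(ltW t0) ?(ltW tT)//.
  by move: (\sum_(_ <= _ < _) _) (\sum_(_ <= _ < _) _) => X Y; ring.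
(* Dictionary between the two iterations: the powers of [opA] on g are, up to sign, I^c of the
   Neumann iterates. Applying I^alpha_0 turns I^c into I^n0, and the signs cancel. *)
have it k s : 0 < s <= T -> iter k (opA m alpha a) g s = (-1) ^+ k.+1 * RLint c (vs k) s.
  elim: k s => [|k IH] s sT; case/andP: (sT) => s0 sT'.
    by rewrite vs0 expr1 (RLintZ (-1) c0 c1 Cq) qg//=; ring.
  rewrite iterS vsE// (op_rhs Hb (Cvs k)) ?(ltW s0)// mulrN exprS mulN1r mulNr opprK big_distrr/=.
  apply: eq_big_nat => i /andP[i1 im].
  have bi0 : 0 < alpha 0%N - alpha i by rewrite alpha_lt0// i1.
  have Ck := RLint_Cg c0 c1 (Cvs k).
  rewrite (RLintE bi0 c1 (CgZ ((-1) ^+ k.+1) Ck)); last first.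
    by move=> u /andP[u0 us]; apply: IH; rewrite u0 ltW// (lt_le_trans us).
  rewrite (RLZ _ _ bi0 c1 Ck) -(RLint_RL bi0 c1 Ck) (RLint_semigroup (ltW bi0) c0 c1 (Cvs k)).
  have -> : alpha 0%N - alpha i + c = n0%:R - alpha i by ring.
  by rewrite mulrCA.
move=> t /andP[t0 tT].
have -> : RLint n0%:R v = RL n0%:R v by exact: RLint_RL n0_gt0 c1 Cv.
have := cv n0%:R t n0_gt0 tT; rewrite (_ : (fun k => RL n0%:R (vs k) t) = (fun k => (-1) ^+ k.+1 *
  RLint (alpha 0%N) (iter k (opA m alpha a) g) t)) //.
apply/funext => k; have Ck := RLint_Cg c0 c1 (Cvs k).
rewrite (RLintE alpha0_gt0 c1 (CgZ ((-1) ^+ k.+1) Ck)); last first.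
  by move=> u /andP[u0 us]; apply: it; rewrite u0 ltW// (lt_le_trans us).
rewrite (RLZ _ _ alpha0_gt0 c1 Ck) -(RLint_RL alpha0_gt0 c1 Ck).
rewrite (RLint_semigroup (ltW alpha0_gt0) c0 c1 (Cvs k)) mulrA -exprD addnn -mul2n exprM sqrrN expr1n expr1n mul1r.
by rewrite addrC subrK (RLint_RL n0_gt0 c1 (Cvs k)).
Qed.
End fundamental_system.

Lemma within_cvg_at0 (R : realType) (T : R) (f : R -> R) : 0 < T ->
  {within `[0, T], continuous f} -> f t @[t --> 0^'+] --> f 0.
Proof. by move=> T0 /(continuous_within_itvP _ T0)[]. Qed.

Lemma Phi_mono_ge0 (R : realType) j (t : R) : 0 <= t -> Phi j.+1%:R t = mono j 0 t.
Proof.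
rewrite le_eqVlt => /predU1P[<-|]; last exact: Phi_mono.
rewrite mono_at0 /Phi -natr1 addrK; case: j => [|j].
  by rewrite powRr0 add0r Gamma1 divr1.
by rewrite powR0 ?mul0r// pnatr_eq0.
Qed.

Theorem theorem1 (R : realType) (T : R) (m : nat) (alpha : nat -> R)
    (n : nat -> nat) (a : nat -> R -> R) (h : nat -> nat)
    (hT : 0 < T) (hm : (1 <= m)%N)
    (halpha : forall i, (i < m)%N -> alpha i.+1 < alpha i)
    (halpham : 0 <= alpha m)
    (hn : forall i, (i <= m)%N -> (n i)%:R - 1 < alpha i <= (n i)%:R)
    (hn01 : n 0%N = n 1%N)
    (ha : forall i, (1 <= i <= m)%N -> Cngamma T 1 ((n 0%N)%:R - alpha 0%N) (a i))
    (hDa : forall i, (1 <= i <= m)%N ->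
       RLderivable T ((n 0%N)%:R - alpha 0%N) `]0, T] (a i) /\
       Cgamma T 0 (RLder T ((n 0%N)%:R - alpha 0%N) (a i)))
    (hH0 : Hset m alpha 0 !=set0)
    (hh : forall j, (j < n 0%N)%N -> is_min (Hset m alpha j) (h j)) :
  exists y : 'I_(n 0%N) -> R -> R,
    [/\ forall j, Cngamma T (n 0%N) ((n 0%N)%:R - alpha 0%N) (y j),
        canonical_system T m alpha a y,
        forall z : 'I_(n 0%N) -> R -> R,
          (forall j, Cngamma T (n 0%N) ((n 0%N)%:R - alpha 0%N) (z j)) ->
          canonical_system T m alpha a z ->
          forall (j : 'I_(n 0%N)) (t : R), 0 <= t <= T -> z j t = y j t &
        forall (j : 'I_(n 0%N)) (t : R), 0 <= t <= T ->
          Phi j.+1%:R t +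
            series (fun k => (-1) ^+ k.+1 *
              RLint (alpha 0%N)
                (iter k (opA m alpha a)
                  (fun s => \sum_(h j <= i < m.+1)
                     a i s * Phi (j.+1%:R - alpha i) s)) t) N
          @[N --> \oo] --> y j t].
Proof.
pose c := (n 0%N)%:R - alpha 0%N.
have hn0 := hn 0%N (leq0n m).
have c0 : 0 <= c by rewrite subr_ge0; case/andP: hn0.
have c1 : c < 1 by rewrite ltrBlDl -ltrBlDr; case/andP: hn0.
have n0R := n0_gt0 hm halpha halpham hn0.
have [v Hv] := choice (fun j : 'I_(n 0%N) =>
  fundamental_solution hT hm halpha halpham hn0 ha (ltn_ord j) (hh j (ltn_ord j))).
pose y (j : 'I_(n 0%N)) (t : R) : R := mono j 0 t + RLint (n 0%N)%:R (v j) t.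
have Cv j : Cg c (v j) by have [] := Hv j.
have yE j t : 0 <= t <= T -> y j t = mono j 0 t + RLint (n 0%N)%:R (v j) t by [].
have yC j : Cngamma T (n 0%N) c (y j).
  by apply: (mono_RLint_Cngamma (j := j) hT c1 (Cv j)).
exists y; split=> //.
- split=> [j|k j].
    have [_ S] := solution_rhs a hT halpha halpham hn0 (ltn_ord j) (Cv j) (yE j).
    apply: S.
    by have [] := Hv j.
  have [H _ _ _] := yC j.
  have := within_cvg_at0 hT (H k (ltn_ord k)).
  by rewrite (derivn_on_mono_RLint_at0 hT c1 (Cv j) (ltn_ord j) (yE j) (ltn_ord k)).
- move=> z zC [zS zI] j t tT.
  have z0 k : (k < n 0%N)%N -> derivn_on `[0, T] k (z j) 0 = (k == j :> nat)%:R.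
    move=> kn; have [H _ _ _] := zC j.
    (* Initial conditions are limits at 0+; derivatives of order below n0 are continuous on [0, T],
       so these limits are their values at 0. *)
    have h1 := within_cvg_at0 hT (H k kn).
    have h2 := zI (Ordinal kn) j.
    by rewrite -(cvg_lim _ h1)// (cvg_lim _ h2).
  have [w Cw zw] := Cngamma_repr hT c1 (ltn_ord j) (zC j) z0.
  have wE := (solution_rhs a hT halpha halpham hn0 (ltn_ord j) Cw zw).1 (zS j).
  have [_ vE _] := Hv j.
  have vw := rhs_unique hT hm halpha hn0 ha (Cv j) Cw vE wE.
  rewrite zw// /y; congr (_ + _).
  rewrite (RLint_RL n0R c1 Cw) (RLint_RL n0R c1 (Cv j)).
  (* Equality of v and w inside (0, T) suffices up to t = T: the integral ignores its endpoint. *)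
  apply: eq_RL => s /andP[s0 st]; apply/esym/vw; rewrite s0 (lt_le_trans st)//.
  by case/andP: tT.
- move=> j t tT; have [_ _ H] := Hv j.
  rewrite (Phi_mono_ge0 j); last by case/andP: tT.
  by apply: cvgD; [exact: cvg_cst|exact: H].
Qed.
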